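(* There exists a torsion-free lattice $\Gamma$ in $\mathrm{PU}(2,1)$ and a surjective homomorphism $\rho : \Gamma \to \mathbb{Z}$ with finitely generated kernel.
   Context: $\mathrm{PU}(2,1)$ is the group of holomorphic isometries of the unit ball $\mathbb{B}^2 \subset \mathbb{C}^2$ with its Bergman metric; a lattice is a discrete subgroup of finite covolume. *)

(* Defs.v *)
From HB Require Import structures.
From mathcomp Require Import all_boot all_order all_algebra.
From mathcomp Require Import complex.
From mathcomp Require Import all_classical all_reals all_analysis.
Set Implicit Arguments.
Unset Strict Implicit.
Unset Printing Implicit Defensive.
Import Order.TTheory GRing.Theory Num.Theory.
Import numFieldNormedType.Exports.
Local Open Scope classical_set_scope.
Local Open Scope ring_scope.
Local Open Scope complex_scope.

(* Matrices over R[i] get their topology from the topology of the coefficient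
   type, which is not inferred for the concrete type R[i] without this. *)
HB.instance Definition _ (R : realType) := PseudoPointedMetric.copy R[i] R[i]^o.

Section Ball.
Variable R : realType.
Notation C2 := 'rV[R[i]]_2.

Definition sqnorm (z : C2) : R[i] := \sum_j `|z 0 j| ^+ 2.

Definition B2 : set C2 := [set z | sqnorm z < 1].

(* The Bergman kernel of the ball satisfies K(z,z) = 2/pi^2 (1 - |z|^2)^-3, and
   the Bergman metric is g_jk = d^2 log K(z,z) / (dz_j dzbar_k), that is,
   g_jk = 3 ((1 - |z|^2) delta_jk + zbar_j z_k) / (1 - |z|^2)^2. *)
Definition bergman_mx (z : C2) : 'M[R[i]]_2 :=
  \matrix_(j, k) (3 * ((1 - sqnorm z) * (j == k)%:R + (z 0 j)^* * z 0 k)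
                  / (1 - sqnorm z) ^+ 2).

Definition bergman (z v w : C2) : R[i] :=
  \sum_j \sum_k v 0 j * bergman_mx z j k * (w 0 k)^*.

(* The ball is open, so the values of [extend f] off it do not affect its
   differentials at points of the ball. *)
Definition extend (f : B2 -> B2) (z : C2) : C2 :=
  if insub z is Some u then \val (f u) else z.

(* [differentiable] is over the scalar field R[i], i.e. complex. *)
Definition holomorphic (f : B2 -> B2) : Prop :=
  forall z : B2, differentiable (extend f) (\val z).

Definition bergman_isometric (f : B2 -> B2) : Prop :=
  forall (z : B2) (v w : C2),
    bergman (\val (f z)) ('d (extend f) (\val z) v) ('d (extend f) (\val z) w)
    = bergman (\val z) v w.

Definition holomorphic_isometry (f : B2 -> B2) : Prop :=
  [/\ holomorphic f, bergman_isometric f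
    & exists g : B2 -> B2, [/\ holomorphic g, cancel f g & cancel g f]].

Lemma extend_val f (z : B2) : extend f (\val z) = \val (f z).
Proof. by rewrite /extend valK. Qed.

Lemma extend_comp f g : extend (f \o g) = extend f \o extend g.
Proof.
apply/funext => z; rewrite /extend /=.
by case: (insubP B2 z) => [u _ _|nz]; rewrite ?valK // insubN.
Qed.

Lemma extend_id : extend id = id.
Proof.
apply/funext => z; rewrite /extend.
by case: (insubP B2 z) => [u _ ->|].
Qed.

Lemma holomorphic_comp f g :
  holomorphic f -> holomorphic g -> holomorphic (f \o g).
Proof.
move=> hf hg z; rewrite extend_comp.
by apply: differentiable_comp; [exact: hg|rewrite extend_val; exact: hf].
Qed.

Lemma diff_extend_comp f g (z : B2) (v : C2) :
  holomorphic f -> holomorphic g ->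
  'd (extend (f \o g)) (\val z) v =
  'd (extend f) (\val (g z)) ('d (extend g) (\val z) v).
Proof.
move=> hf hg; have := hf (g z); rewrite -extend_val => hfz.
by rewrite extend_comp; exact: (congr1 (@^~ v) (diff_comp (hg z) hfz)).
Qed.

Lemma holomorphic_isometry_id : holomorphic_isometry id.
Proof.
have hid : holomorphic id.
  by move=> z; rewrite extend_id; case: (is_diff_id (\val z : C2)).
split=> //; last by exists id; split.
move=> z v w; rewrite extend_id.
by case: (is_diff_id (\val z : C2)) => _ ->.
Qed.

Lemma holomorphic_isometry_comp f g :
  holomorphic_isometry f -> holomorphic_isometry g ->
  holomorphic_isometry (f \o g).
Proof.
move=> [hf kf [f' [hf' ff' f'f]]] [hg kg [g' [hg' gg' g'g]]]; split.
- exact: holomorphic_comp.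
- move=> z v w; apply: etrans (etrans (kf (g z) _ _) (kg z v w)).
  exact: (congr2 (bergman (\val (f (g z)))) (diff_extend_comp z v hf hg)
                                         (diff_extend_comp z w hf hg)).
- exists (g' \o f'); split; first exact: holomorphic_comp.
    exact: (can_comp ff' gg').
  exact: (can_comp g'g f'f).
Qed.

Lemma holomorphic_isometry_inv f g : holomorphic_isometry f ->
  holomorphic g -> cancel f g -> cancel g f -> holomorphic_isometry g.
Proof.
move=> [hf kf _] hg fg gf; split; [exact: hg| |by exists f].
have fgid : f \o g = id by apply/funext => z; exact: gf.
have dK (z : B2) v : 'd (extend f) (\val (g z)) ('d (extend g) (\val z) v) = v.
  apply: etrans (esym (diff_extend_comp z v hf hg)) _.
  by rewrite fgid extend_id; case: (is_diff_id (\val z : C2)) => _ ->.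
move=> z v w; apply: etrans (esym (kf (g z) _ _)) _.
apply: etrans (congr2 _ (dK z v) (dK z w)) _.
by rewrite gf.
Qed.

End Ball.
Arguments B2 R : clear implicits.

Record PU21 (R : realType) := MkPU21 {
  PU21_fun :> B2 R -> B2 R;
  PU21P : holomorphic_isometry PU21_fun
}.

Section PU21Group.
Variable R : realType.
Notation G := (PU21 R).

HB.instance Definition _ := gen_eqMixin G.
HB.instance Definition _ := gen_choiceMixin G.

Lemma PU21_eq (f g : G) : (f : B2 R -> B2 R) =1 g -> f = g.
Proof.
case: f g => [f pf] [g pg] /= /funext fg; case: _ / fg in pg *.
by rewrite (Prop_irrelevance pf pg).
Qed.

Definition PU21_one : G := MkPU21 (holomorphic_isometry_id R).

Definition PU21_mul (f g : G) : G :=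
  MkPU21 (holomorphic_isometry_comp (PU21P f) (PU21P g)).

Lemma PU21_inv_ex (f : G) : exists g : G, cancel f g /\ cancel g f.
Proof.
have [_ _ [g [hg fg gf]]] := PU21P f.
by exists (MkPU21 (holomorphic_isometry_inv (PU21P f) hg fg gf)).
Qed.

Definition PU21_inv (f : G) : G := sval (cid (PU21_inv_ex f)).

Let mulA : associative PU21_mul.
Proof. by move=> f g h; exact: PU21_eq. Qed.
Let mul1 : left_id PU21_one PU21_mul.
Proof. by move=> f; exact: PU21_eq. Qed.
Let mulr1 : right_id PU21_one PU21_mul.
Proof. by move=> f; exact: PU21_eq. Qed.
Let mulV : left_inverse PU21_one PU21_inv PU21_mul.
Proof.
by move=> f; apply: PU21_eq => z; exact: (svalP (cid (PU21_inv_ex f))).1.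
Qed.
Let mulrV : right_inverse PU21_one PU21_inv PU21_mul.
Proof.
by move=> f; apply: PU21_eq => z; exact: (svalP (cid (PU21_inv_ex f))).2.
Qed.

HB.instance Definition _ := isGroup.Build G mulA mul1 mulr1 mulV mulrV.

HB.instance Definition _ := Topological.copy G
  (@initial_topology G {compact-open, B2 R -> B2 R} (@PU21_fun R)).

End PU21Group.

Section Groups.
Variable G : groupType.
Implicit Types H K : set G.
Local Open Scope group_scope.

Definition is_subgroup H : Prop :=
  [/\ H 1, forall x y, H x -> H y -> H (x * y) & forall x, H x -> H x^-1].

Definition torsion_free H : Prop :=
  forall x n, H x -> (0 < n)%N -> x ^+ n = 1 -> x = 1.

Definition finitely_generated H : Prop :=
  exists2 S : set G, finite_set S & H = smallest is_subgroup S.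

(* Only the values of rho on H matter. *)
Definition homomorphism_to_int H (rho : G -> int) : Prop :=
  forall x y, H x -> H y -> rho (x * y) = (rho x + rho y)%R.

Definition hom_kernel H (rho : G -> int) : set G :=
  H `&` [set x | rho x = 0%R].

End Groups.

Section Lattice.
Variable R : realType.
Notation C2 := 'rV[R[i]]_2.
Notation G := (PU21 R).
Notation RB := (measurableTypeR R).
Notation R4 := (RB * RB * RB * RB)%type.

Definition C2_of_R4 (x : R4) : C2 :=
  \row_j (if j == 0 then x.1.1.1 +i* x.1.1.2 else x.1.2 +i* x.2).

Definition lebesgue4 : {measure set R4 -> \bar R} :=
  (@lebesgue_measure R \x @lebesgue_measure R \x @lebesgue_measure R
   \x @lebesgue_measure R)%E.

Definition coords (D : set (B2 R)) : set R4 :=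
  C2_of_R4 @^-1` (set_val @` D).

(* Up to a constant factor depending on normalizations, the Riemannian volume
   of a Hermitian metric g is det(g) times Lebesgue measure. *)
Definition bergman_volume (D : set (B2 R)) : \bar R :=
  (\int[lebesgue4]_(x in coords D)
     (complex.Re (\det (bergman_mx (C2_of_R4 x))))%:E)%E.

Definition fundamental_domain (Gam : set G) (D : set (B2 R)) : Prop :=
  [/\ measurable (coords D),
      forall z, exists2 g, Gam g & D (g z)
    & forall g, Gam g -> g <> 1%g -> bergman_volume ((g @` D) `&` D) = 0%E].

Definition discrete_subgroup (Gam : set G) : Prop := Gam `<=` isolated Gam.

(* The covolume of a discrete subgroup is the volume of a fundamental domain
   for its action on the ball.  Since PU(2,1) acts transitively on the ball with
   compact point stabilizers, it is finite exactly when the covolume for Haar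
   measure on PU(2,1) is. *)
Definition finite_covolume (Gam : set G) : Prop :=
  exists2 D, fundamental_domain Gam D & (bergman_volume D < +oo)%E.

Definition is_lattice (Gam : set G) : Prop :=
  [/\ is_subgroup Gam, discrete_subgroup Gam & finite_covolume Gam].

End Lattice.

(* Main.v *)
Require Import Defs.
From HB Require Import structures.
From mathcomp Require Import all_boot all_order all_algebra.
From mathcomp Require Import zify ring lra complex.
From mathcomp Require Import all_classical all_reals all_analysis.
From mathcomp Require Import measurable_realfun.
Set Implicit Arguments.
Unset Strict Implicit.
Unset Printing Implicit Defensive.
Import Order.TTheory GRing.Theory Num.Theory.
Import numFieldNormedType.Exports.
Local Open Scope classical_set_scope.
Local Open Scope ring_scope.

(* Let O be the ring of Eisenstein integers, U the unitary group over O of the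
   form v1 w3* + v2 w2* + v3 w1*, and Gamma its principal congruence subgroup of
   level 3, which is torsion free by Minkowski's argument.  Call two cusps (the
   vectors in the U-orbit of e1) adjacent when their product is a unit or they
   span the same line.

   Residues modulo 3 determine an O-valued cocycle on adjacent cusps: for cusps
   whose third coordinate is prime to sqrt(-3) it lifts the difference of the
   classes of v2 / v3 modulo 3.  Each cusp v other than e1 has, up to units, a
   neighbour of smaller level |v3|^2, and any two such neighbours are joined by a
   chain of adjacent ones; hence the cocycle is the coboundary of a potential F, by
   induction on the level.  An element of Gamma shifts F by a constant, and the
   omega-coordinates of these constants generate the image of Gamma in Z.

   The kernel of this homomorphism is finitely generated by Schreier's lemma: it is
   the intersection of Gamma with the group generated by three reflections, one
   translation and the scalars, and U is a union of four cosets of N0 P, where P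
   fixes the line of e1 and normalizes the group N0 of the reflections.

   By reduction theory every orbit of Gamma on the ball meets a finite union of
   nontangential cones at boundary points, on which the Bergman volume is finite.
   In each orbit, the point of this union least for a lexicographic order gives a
   point of an exact fundamental domain. *)

(** * Eisenstein integers *)

(** The six units of O stay distinct modulo 3, so an equality of units of O can be checked by
    computation in the finite ring O/3. Since 2 is not a norm from O, three mutually neighbouring
    cusps have a determinant of norm 1; this makes the cocycle additive over O and not only modulo
    3.

    The obstacle is the ramified cusps, whose third coordinate is divisible by sqrt(-3): there v2 /
    v3 has no residue. No two of them are neighbours, and around each one the increments are given
    by a determinant; group elements are therefore followed at unramified cusps only.

    The kernel is under control because each reflection fixes an unramified cusp and hence does not
    shift F. So N0 shifts F by 0, an element of Gamma is parabolic modulo N0, and its shift is the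
    translation part b of the parabolic. If the omega-coordinate vanishes, b is in Z: one
    translation generates these, up to vertical translations, which lie in N0 up to scalars. *)

Record eis (F : Type) := Eis { ere : F; eom : F }.

Section EisRing.
Variable F : comNzRingType.
Notation E := (eis F).

Definition eis_pair (x : E) := (ere x, eom x).
Definition pair_eis (p : F * F) : E := Eis p.1 p.2.
Lemma eis_pairK : cancel eis_pair pair_eis.
Proof. by case. Qed.
HB.instance Definition _ := Choice.copy E (can_type eis_pairK).

Definition eis_add (x y : E) : E := Eis (ere x + ere y) (eom x + eom y).
Definition eis_opp (x : E) : E := Eis (- ere x) (- eom x).
Definition eis_mul (x y : E) : E :=
  Eis (ere x * ere y - eom x * eom y)
      (ere x * eom y + eom x * ere y - eom x * eom y).

Let addA : associative eis_add.
Proof. by move=> x y z; congr Eis; rewrite /= addrA. Qed.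
Let addC : commutative eis_add.
Proof. by move=> x y; congr Eis; rewrite /= addrC. Qed.
Let add0 : left_id (Eis 0 0) eis_add.
Proof. by case=> a b; rewrite /eis_add /= !add0r. Qed.
Let addN : left_inverse (Eis 0 0) eis_opp eis_add.
Proof. by case=> a b; rewrite /eis_add /= !addNr. Qed.
HB.instance Definition _ := GRing.isZmodule.Build E addA addC add0 addN.

Let mulA : associative eis_mul.
Proof. by move=> x y z; congr Eis => /=; ring. Qed.
Let mulC : commutative eis_mul.
Proof. by move=> x y; congr Eis => /=; ring. Qed.
Let mul1 : left_id (Eis 1 0) eis_mul.
Proof. by case=> a b; congr Eis => /=; ring. Qed.
Let mulD : left_distributive eis_mul +%R.
Proof. by move=> x y z; congr Eis => /=; ring. Qed.
Let one_neq0 : Eis 1 0 != 0 :> E.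
Proof. by apply/eqP => -[/eqP]; rewrite oner_eq0. Qed.
HB.instance Definition _ :=
  GRing.Zmodule_isComNzRing.Build E mulA mulC mul1 mulD one_neq0.

Lemma eis_eq (x y : E) : ere x = ere y -> eom x = eom y -> x = y.
Proof. by case: x y => [a b] [c d] /= -> ->. Qed.

Lemma ereD (x y : E) : ere (x + y) = ere x + ere y. Proof. by []. Qed.
Lemma eomD (x y : E) : eom (x + y) = eom x + eom y. Proof. by []. Qed.
Lemma ereN (x : E) : ere (- x) = - ere x. Proof. by []. Qed.
Lemma eomN (x : E) : eom (- x) = - eom x. Proof. by []. Qed.
Lemma ereM (x y : E) : ere (x * y) = ere x * ere y - eom x * eom y.
Proof. by []. Qed.
Lemma eomM (x y : E) :
  eom (x * y) = ere x * eom y + eom x * ere y - eom x * eom y.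
Proof. by []. Qed.
Lemma ere0 : ere (0 : E) = 0. Proof. by []. Qed.
Lemma eom0 : eom (0 : E) = 0. Proof. by []. Qed.
Lemma ere1 : ere (1 : E) = 1. Proof. by []. Qed.
Lemma eom1 : eom (1 : E) = 0. Proof. by []. Qed.
Definition eisE := (ereD, eomD, ereN, eomN, ereM, eomM, ere0, eom0, ere1, eom1).

Definition econj (x : E) : E := Eis (ere x - eom x) (- eom x).
Let conjB : {morph econj : x y / x - y}.
Proof. by move=> x y; apply: eis_eq; rewrite /= ?eisE; ring. Qed.
Let conjM : monoid_morphism econj.
Proof.
by split=> [|x y]; apply: eis_eq; rewrite /= ?eisE; ring.
Qed.
HB.instance Definition _ := GRing.isZmodMorphism.Build E E econj conjB.
HB.instance Definition _ := GRing.isMonoidMorphism.Build E E econj conjM.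

Lemma econjK : involutive econj.
Proof. by move=> x; apply: eis_eq => /=; ring. Qed.

Definition enorm (x : E) : F := ere x ^+ 2 - ere x * eom x + eom x ^+ 2.

Definition ofF (a : F) : E := Eis a 0.

Lemma mul_econj x : x * econj x = ofF (enorm x).
Proof. by apply: eis_eq; rewrite /enorm !eisE /=; ring. Qed.

Lemma enormM x y : enorm (x * y) = enorm x * enorm y.
Proof. by rewrite /enorm !eisE; ring. Qed.
Lemma enorm1 : enorm 1 = 1. Proof. by rewrite /enorm !eisE; ring. Qed.
Lemma enormJ x : enorm (econj x) = enorm x.
Proof. by rewrite /enorm /=; ring. Qed.
Lemma enormN x : enorm (- x) = enorm x.
Proof. by rewrite /enorm !eisE; ring. Qed.

End EisRing.

Definition emap (F G : comNzRingType) (f : {rmorphism F -> G}) (x : eis F) : eis G :=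
  Eis (f (ere x)) (f (eom x)).

Section Emap.
Variables (F G : comNzRingType) (f : {rmorphism F -> G}).
Let mapB : {morph emap f : x y / x - y}.
Proof. by move=> x y; apply: eis_eq; rewrite /= rmorphB. Qed.
Let mapM : monoid_morphism (emap f).
Proof.
split=> [|x y]; apply: eis_eq => /=.
- exact: rmorph1. - exact: rmorph0.
- by rewrite rmorphB !rmorphM. - by rewrite rmorphB rmorphD !rmorphM.
Qed.
HB.instance Definition _ := GRing.isZmodMorphism.Build _ _ (emap f) mapB.
HB.instance Definition _ := GRing.isMonoidMorphism.Build _ _ (emap f) mapM.
Lemma emap_conj x : emap f (econj x) = econj (emap f x).
Proof. by apply: eis_eq; rewrite /= ?rmorphB ?rmorphN. Qed.
Lemma enorm_map x : enorm (emap f x) = f (enorm x).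
Proof. by rewrite /enorm /= !rmorphD rmorphN !rmorphXn rmorphM. Qed.
End Emap.

Notation O := (eis int).
Definition omega {F : comNzRingType} : eis F := Eis 0 1.
Definition is_unit (x : O) : bool := enorm x == 1.
Definition units : seq O :=
  [:: Eis 1 0; Eis 0 1; Eis (-1) (-1); Eis (-1) 0; Eis 0 (-1); Eis 1 1].

Lemma unitsP x : reflect (x \in units) (is_unit x).
Proof.
apply: (iffP idP); last by rewrite !inE => /or4P[|||/or3P[||]] /eqP ->.
case: x => a b; rewrite /is_unit /enorm /= => /eqP e.
have [ha hb] : (-1 <= a <= 1) /\ (-1 <= b <= 1) by split; nia.
have : (a == -1) || (a == 0) || (a == 1) by lia.
have : (b == -1) || (b == 0) || (b == 1) by lia.
by move=> /orP[/orP[]|] /eqP eb /orP[/orP[]|] /eqP ea; move: e; rewrite ea eb.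
Qed.

Lemma enorm_ge0 (x : O) : 0 <= enorm x.
Proof. by case: x => a b; rewrite /enorm /=; nia. Qed.

Lemma enorm_eq0 (x : O) : (enorm x == 0) = (x == 0).
Proof.
apply/eqP/eqP => [|->]; last by [].
case: x => a b; rewrite /enorm /= => e.
have [-> ->] : a = 0 /\ b = 0 by split; nia.
by [].
Qed.

Lemma mul_unitJ x : is_unit x -> x * econj x = 1.
Proof. by move=> /eqP e; rewrite mul_econj e. Qed.

Lemma eis_mulf_eq0 (x y : O) : x * y = 0 -> x = 0 \/ y = 0.
Proof.
move=> e; have /eqP : enorm (x * y) = 0 by rewrite e.
by rewrite enormM mulf_eq0 !enorm_eq0 => /orP[]/eqP ->; [left|right].
Qed.

(** An enumerated field with three elements, so that the exhaustive checks over O/3 reduce by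
    [vm_compute]. *)
Inductive F3 := F30 | F31 | F32.
Definition F3_nat (x : F3) := match x with F30 => 0 | F31 => 1 | F32 => 2 end%N.
Definition nat_F3 (n : nat) := match n with 0 => F30 | 1 => F31 | _ => F32 end%N.
Lemma F3_natK : cancel F3_nat nat_F3. Proof. by case. Qed.
HB.instance Definition _ := Countable.copy F3 (can_type F3_natK).
Definition F3_add (x y : F3) : F3 :=
  match x, y with
  | F30, z | z, F30 => z
  | F31, F31 => F32 | F32, F32 => F31 | _, _ => F30
  end.
Definition F3_opp (x : F3) : F3 :=
  match x with F30 => F30 | F31 => F32 | F32 => F31 end.
Definition F3_mul (x y : F3) : F3 :=
  match x, y with
  | F30, _ | _, F30 => F30
  | F31, z | z, F31 => z
  | F32, F32 => F31
  end.
Lemma F3_addA : associative F3_add. Proof. by do 3!case. Qed.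
Lemma F3_addC : commutative F3_add. Proof. by do 2!case. Qed.
Lemma F3_add0 : left_id F30 F3_add. Proof. by case. Qed.
Lemma F3_addN : left_inverse F30 F3_opp F3_add. Proof. by case. Qed.
HB.instance Definition _ := GRing.isZmodule.Build F3 F3_addA F3_addC F3_add0 F3_addN.
Lemma F3_mulA : associative F3_mul. Proof. by do 3!case. Qed.
Lemma F3_mulC : commutative F3_mul. Proof. by do 2!case. Qed.
Lemma F3_mul1 : left_id F31 F3_mul. Proof. by case. Qed.
Lemma F3_mulD : left_distributive F3_mul +%R. Proof. by do 3!case. Qed.
Lemma F3_nz : F31 != 0. Proof. by []. Qed.
HB.instance Definition _ :=
  GRing.Zmodule_isComNzRing.Build F3 F3_mulA F3_mulC F3_mul1 F3_mulD F3_nz.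

Definition red3 : O -> eis F3 := emap (intr : {rmorphism int -> F3}).
HB.instance Definition _ := GRing.RMorphism.on red3.

Lemma intr_Z3_eq0 (n : int) : (n%:~R : F3) = 0 -> exists k, n = 3 * k.
Proof.
move=> h; exists (n %/ 3)%Z.
have e : n = 3 * (n %/ 3)%Z + (n %% 3)%Z by lia.
have : ((n %% 3)%Z%:~R : F3) = 0.
  move: h; rewrite {1}e rmorphD rmorphM /=.
  have -> : (3%:~R : F3) = 0 by apply/eqP; vm_compute.
  by rewrite mul0r add0r.
have : (n %% 3)%Z \in [:: 0; 1; 2] by rewrite !inE; lia.
by rewrite !inE => /or3P[] /eqP r; rewrite r // => _; lia.
Qed.

Lemma red3P (x y : O) : red3 x = red3 y <-> exists k, x = y + 3 * k.
Proof.
split; last first.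
  move=> [k ->]; rewrite rmorphD rmorphM rmorph_nat.
  have -> : (3%:R : eis F3) = 0 by apply/eqP; vm_compute.
  by rewrite mul0r addr0.
move=> e; have : red3 (x - y) = 0.
  by rewrite rmorphB; apply/eqP; rewrite subr_eq0; exact/eqP.
case=> /intr_Z3_eq0[a ha] /intr_Z3_eq0[b hb]; exists (Eis a b).
case: x y ha hb {e} => [x1 x2] [y1 y2]; rewrite /= => ha hb.
have -> : (3 : O) = Eis 3 0 by [].
by apply: eis_eq; rewrite !eisE /=; lia.
Qed.

Definition Z3s : seq F3 := [:: 0; 1; -1].
Definition E3s : seq (eis F3) := [seq Eis a b | a <- Z3s, b <- Z3s].

Lemma mem_Z3s (a : F3) : a \in Z3s.
Proof. by case: a. Qed.
Lemma mem_E3s (x : eis F3) : x \in E3s.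
Proof.
by case: x => a b; apply/allpairsP; exists (a, b); rewrite !mem_Z3s.
Qed.
Lemma all_E3s (P : pred (eis F3)) : all P E3s -> forall x, P x.
Proof. by move=> /allP h x; apply: h; exact: mem_E3s. Qed.

(* The units of O are pairwise incongruent modulo 3. *)
Definition lift3 (x : eis F3) : O := head 0 [seq u <- units | red3 u == x].

Lemma lift3K u : is_unit u -> lift3 (red3 u) = u.
Proof.
move=> /unitsP; rewrite !inE.
by move=> /or4P[|||/or3P[||]] /eqP ->; apply/eqP; vm_compute.
Qed.

(** * Hermitian forms of signature (2, 1) *)

Definition vec (A : Type) : Type := (A * A * A)%type.
Definition mat (A : Type) : Type := vec (vec A).

Section MatDef.
Variable A : comNzRingType.
Implicit Types (v w : vec A) (a b : mat A).

Definition dotp (r v : vec A) : A :=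
  r.1.1 * v.1.1 + r.1.2 * v.1.2 + r.2 * v.2.
Definition mv a v : vec A := (dotp a.1.1 v, dotp a.1.2 v, dotp a.2 v).
Definition vadd v w : vec A := (v.1.1 + w.1.1, v.1.2 + w.1.2, v.2 + w.2).
Definition vscale (x : A) v : vec A := (x * v.1.1, x * v.1.2, x * v.2).
Definition vm (r : vec A) b : vec A :=
  vadd (vadd (vscale r.1.1 b.1.1) (vscale r.1.2 b.1.2)) (vscale r.2 b.2).
Definition mm a b : mat A := (vm a.1.1 b, vm a.1.2 b, vm a.2 b).
Definition I3 : mat A := ((1, 0, 0), (0, 1, 0), (0, 0, 1)).
Definition scal (x : A) : mat A := ((x, 0, 0), (0, x, 0), (0, 0, x)).
Definition det3 (u v w : vec A) : A :=
  u.1.1 * (v.1.2 * w.2 - v.2 * w.1.2)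
  - u.1.2 * (v.1.1 * w.2 - v.2 * w.1.1)
  + u.2 * (v.1.1 * w.1.2 - v.1.2 * w.1.1).

End MatDef.

Ltac matE := rewrite ?/mm ?/mv ?/dotp ?/vm ?/vadd ?/vscale /=.

Section Mat.
Variable A : comNzRingType.
Implicit Types (v w : vec A) (a b : mat A).

Lemma vec_eq (x1 x2 x3 y1 y2 y3 : A) :
  x1 = y1 -> x2 = y2 -> x3 = y3 -> (x1, x2, x3) = (y1, y2, y3).
Proof. by move=> -> -> ->. Qed.

Lemma mv_mm a b v : mv (mm a b) v = mv a (mv b v).
Proof. by apply: vec_eq; matE; ring. Qed.
Lemma vm_vm r a b : vm (vm r a) b = vm r (mm a b).
Proof. by apply: vec_eq; matE; ring. Qed.
Lemma mmA : associative (@mm A).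
Proof. by move=> a b c; rewrite /mm /= !vm_vm. Qed.
Lemma mv1 v : mv (I3 A) v = v.
Proof. by case: v => [[x y] z]; apply: vec_eq; matE; ring. Qed.
Lemma mm1 a : mm (I3 A) a = a.
Proof.
case: a => [[[[a1 a2] a3] [[b1 b2] b3]] [[x1 x2] x3]].
by congr (_, _, _); apply: vec_eq; matE; ring.
Qed.
Lemma mmr1 a : mm a (I3 A) = a.
Proof.
case: a => [[[[a1 a2] a3] [[b1 b2] b3]] [[x1 x2] x3]].
by congr (_, _, _); apply: vec_eq; matE; ring.
Qed.
Lemma mv_scale a x v : mv a (vscale x v) = vscale x (mv a v).
Proof. by apply: vec_eq; matE; ring. Qed.
Lemma mv_scal x v : mv (scal x) v = vscale x v.
Proof. by apply: vec_eq; matE; ring. Qed.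
Lemma vscaleA x y v : vscale x (vscale y v) = vscale (x * y) v.
Proof. by apply: vec_eq; matE; ring. Qed.
Lemma vscale1 v : vscale 1 v = v.
Proof. by case: v => [[x y] z]; rewrite /vscale /= !mul1r. Qed.
Lemma det3_mv a u v w :
  det3 (mv a u) (mv a v) (mv a w) = det3 a.1.1 a.1.2 a.2 * det3 u v w.
Proof. rewrite /det3; matE; ring. Qed.
Lemma det3_scale x u v w : det3 (vscale x u) v w = x * det3 u v w.
Proof. rewrite /det3; matE; ring. Qed.
End Mat.

Section Herm.
Variable F : comNzRingType.
Notation E := (eis F).
Implicit Types (v w : vec E) (a b : mat E).

Definition herm v w : E :=
  v.1.1 * econj w.2 + v.1.2 * econj w.1.2 + v.2 * econj w.1.1.
Definition adjm a : mat E :=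
  ((econj a.2.2, econj a.1.2.2, econj a.1.1.2),
   (econj a.2.1.2, econj a.1.2.1.2, econj a.1.1.1.2),
   (econj a.2.1.1, econj a.1.2.1.1, econj a.1.1.1.1)).

Lemma hermC v w : herm w v = econj (herm v w).
Proof. by rewrite /herm !rmorphD !rmorphM /= !econjK; ring. Qed.
Lemma herm_adj a v w : herm (mv a v) w = herm v (mv (adjm a) w).
Proof. by rewrite /herm /mv /dotp /adjm; matE; rewrite !rmorphD !rmorphM /= !econjK; ring. Qed.
Lemma adjmK : involutive adjm.
Proof.
move=> [[[[a1 a2] a3] [[b1 b2] b3]] [[x1 x2] x3]].
by rewrite /adjm /= !econjK.
Qed.
Lemma adjmM a b : adjm (mm a b) = mm (adjm b) (adjm a).
Proof.
by rewrite /adjm /mm /vm /vadd /vscale /=; congr (_, _, _); apply: vec_eq;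
  rewrite /= !rmorphD !rmorphM /=; ring.
Qed.
Lemma adjm1 : adjm (I3 E) = I3 E.
Proof. by rewrite /adjm /= rmorph0 rmorph1. Qed.
Lemma hermZl x v w : herm (vscale x v) w = x * herm v w.
Proof. rewrite /herm /=; ring. Qed.
Lemma hermZr x v w : herm v (vscale x w) = econj x * herm v w.
Proof. rewrite /herm /= !rmorphM; ring. Qed.

(* The Gram matrix of (u, v, w) has determinant -|det(u, v, w)|^2. *)
Lemma gram_null u v w : herm u u = 0 -> herm v v = 0 -> herm w w = 0 ->
  let p := herm u v * herm v w * herm w u in
  p + econj p = - (det3 u v w * econj (det3 u v w)).
Proof.
move=> hu hv hw p.
have -> : - (det3 u v w * econj (det3 u v w)) =
  herm u u * (herm v v * herm w w - herm v w * econj (herm v w))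
  - herm u v * (econj (herm u v) * herm w w - herm v w * herm w u)
  + econj (herm w u) *
      (econj (herm u v) * econj (herm v w) - herm v v * herm w u).
  rewrite /det3 /herm.
  case: u v w {hu hv hw p} => [[u1 u2] u3] [[v1 v2] v3] [[w1 w2] w3] /=.
  by rewrite !(rmorphD, rmorphB, rmorphN, rmorphM) /= !econjK; ring.
rewrite hu hv hw /p !rmorphM /=. ring.
Qed.
End Herm.

(** * Plane geometry behind the chains of cusps *)

Section Plane.
Variable F : realFieldType.
Implicit Types (x y k m n : F).

Definition qf x y : F := x ^+ 2 - x * y + y ^+ 2.

(* In coordinates of the Heisenberg group where the lattice point over m + n w has
   height k, this is 4 |<lattice point, h>|^2 / |h_3|^2 for h over x + y w of height t. *)
Definition cyg (x y t m n k : F) : F :=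
  qf (x - m) (y - n) ^+ 2 + 3 * (k - t + n * x - m * y) ^+ 2.

Lemma qf_ge0 x y : 0 <= qf x y.
Proof. by rewrite /qf; nra. Qed.

(** With p the product of m + n w and the conjugate of x + y w, this is 4 |p|^2 = T^2 + 3 c^2, where
    T is the trace of p and c its omega-coordinate. *)
Lemma qf_cross x y m n :
  4 * qf m n * qf x y =
  (2 * (m * x + n * y) - (m * y + n * x)) ^+ 2 + 3 * (n * x - m * y) ^+ 2.
Proof. rewrite /qf; ring. Qed.

(* The circumradius of an equilateral triangle of side 1 is 1/sqrt 3. *)
Lemma qf_frac (u v : F) : 0 <= u <= 1 -> 0 <= v <= 1 ->
  [|| qf u v <= 1/3, qf (u - 1) v <= 1/3, qf u (v - 1) <= 1/3
    | qf (u - 1) (v - 1) <= 1/3].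
Proof.
move=> hu hv; apply/negPn/negP.
rewrite !negb_or -!ltNge /qf => /and4P[h1 h2 h3 h4].
case: (leP v u) => huv.
  (* The weights 1 - u, u - v, v are the barycentric coordinates in the triangle 0, 1, 1 + w. The
     weighted mean of the squared distances to its vertices is the sum of the pairwise products of
     the weights, at most 1/3. *)
  have e : (1 - u) * (u ^+ 2 - u * v + v ^+ 2) + (u - v) * ((u - 1) ^+ 2 - (u - 1) * v + v ^+ 2)
     + v * ((u - 1) ^+ 2 - (u - 1) * (v - 1) + (v - 1) ^+ 2) =
     (1 - u) * (u - v) + (1 - u) * v + (u - v) * v by ring.
  nra.
have e : (1 - v) * (u ^+ 2 - u * v + v ^+ 2) + (v - u) * (u ^+ 2 - u * (v - 1) + (v - 1) ^+ 2)
     + u * ((u - 1) ^+ 2 - (u - 1) * (v - 1) + (v - 1) ^+ 2) =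
     (1 - v) * (v - u) + (1 - v) * u + (v - u) * u by ring.
nra.
Qed.

(** Here s is the relative height of a lattice point and d the twist of the height when its base
    point moves by a unit. That move changes the parity of heights, which leaves the offsets 1 and
    -1; as |s - d| <= 2, one of them suffices. *)
Lemma int_step (s d : F) : s ^+ 2 + d ^+ 2 <= 2 ->
  (s - d - 1) ^+ 2 <= 1 \/ (s - d + 1) ^+ 2 <= 1.
Proof.
move=> h; have {}h : (s - d) ^+ 2 <= 4 by have := sqr_ge0 (s + d); lra.
have [t1 t2] : -2 <= s - d /\ s - d <= 2.
  by split; rewrite leNgt; apply/negP => h'; nra.
by case: (leP 0 (s - d)) => h'; [left|right]; nra.
Qed.

Lemma cross_small (x y m n c : F) : qf m n = 1 -> qf x y <= c ->
  3 * (n * x - m * y) ^+ 2 <= 4 * c.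
Proof.
move=> h1 h2; have := qf_cross x y m n; rewrite h1.
have := sqr_ge0 (2 * (m * x + n * y) - (m * y + n * x)); lra.
Qed.

(* A lattice point over a unit of the plane has a neighbour over 0. *)
Lemma step_unit (x y t m n k : F) : qf x y <= 1/3 -> qf m n = 1 ->
  cyg x y t m n k <= 4 ->
  cyg x y t 0 0 (k - 1) < 4 \/ cyg x y t 0 0 (k + 1) < 4.
Proof.
move=> hB hu hw; rewrite /cyg in hw *.
have h1 : (k - t + n * x - m * y) ^+ 2 <= 4/3.
  have := sqr_ge0 (qf (x - m) (y - n)); lra.
have h2 : (n * x - m * y) ^+ 2 <= 4/9 by have := cross_small hu hB; lra.
have hq : qf (x - 0) (y - 0) ^+ 2 <= 1/9.
  by rewrite !subr0; have := qf_ge0 x y; nra.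
have [h|h] : _ \/ _ := @int_step (k - t + n * x - m * y) (n * x - m * y) ltac:(lra); [left|right].
  have -> : k - 1 - t + 0 * x - 0 * y = k - t + n * x - m * y - (n * x - m * y) - 1 by ring.
  lra.
have -> : k + 1 - t + 0 * x - 0 * y = k - t + n * x - m * y - (n * x - m * y) + 1 by ring.
lra.
Qed.

(* A lattice point over the sum b + c of adjacent units has a neighbour over b or c. *)
Lemma step_far (x y t m n m' n' k : F) : qf x y <= 1/3 ->
  qf m n = 1 -> qf m' n' = 1 -> qf (m + m') (n + n') = 3 ->
  cyg x y t (m + m') (n + n') k <= 4 ->
  let c := m * n' - n * m' in
  [\/ cyg x y t m n (k + c - 1) < 4, cyg x y t m n (k + c + 1) < 4,
      cyg x y t m' n' (k - c - 1) < 4 | cyg x y t m' n' (k - c + 1) < 4].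
Proof.
move=> hB hu hv huv hw c; rewrite /cyg in hw *.
have h1 : (k - t + (n + n') * x - (m + m') * y) ^+ 2 <= 4/3.
  have := sqr_ge0 (qf (x - (m + m')) (y - (n + n'))); lra.
have h2 : qf (x - (m + m')) (y - (n + n')) <= 2.
  have := sqr_ge0 (k - t + (n + n') * x - (m + m') * y) => h.
  by rewrite leNgt; apply/negP => h'; nra.
(* The parallelogram identity for 0, b, c, b + c, where twice the inner product of b and c is 3 - 1
   - 1 = 1, together with qf x y <= 1/3. *)
have par : qf (x - m) (y - n) + qf (x - m') (y - n') <=
    qf (x - (m + m')) (y - (n + n')) - 2/3.
  by move: hu hv huv hB h2; rewrite /qf; lra.
have gen (a b a' b' : F) (s := k - t + (n + n') * x - (m + m') * y)
    (d := b' * (x - a) - a' * (y - b)) : qf a' b' = 1 ->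
    qf (x - a) (y - b) <= (qf (x - (m + m')) (y - (n + n')) - 2/3) / 2 ->
    (s - d - 1) ^+ 2 <= 1 \/ (s - d + 1) ^+ 2 <= 1.
  (* With Q the squared distance to b + c, s^2 <= (4 - Q^2) / 3 and d^2 <= (2 Q - 4/3) / 3, so s^2 +
     d^2 <= (11/3 - (Q - 1)^2) / 3 < 2. *)
  move=> ha hb; have := cross_small ha hb => h3; apply: int_step.
  by have := sqr_ge0 (qf (x - (m + m')) (y - (n + n')) - 1); rewrite /s /d; lra.
case: (leP (qf (x - m) (y - n)) ((qf (x - (m + m')) (y - (n + n')) - 2/3) / 2)) => hm.
  have q4 : qf (x - m) (y - n) ^+ 2 <= 4/9 by have := qf_ge0 (x - m) (y - n); nra.
  have [h|h] := gen m n m' n' hv hm; [apply: Or41|apply: Or42].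
    set z := (X in 3 * X ^+ 2); have -> : z = k - t + (n + n') * x - (m + m') * y - (n' * (x - m) - m' * (y - n)) - 1.
      by rewrite /z /c; ring.
    lra.
  set z := (X in 3 * X ^+ 2); have -> : z = k - t + (n + n') * x - (m + m') * y - (n' * (x - m) - m' * (y - n)) + 1.
    by rewrite /z /c; ring.
  lra.
have hm' : qf (x - m') (y - n') <= (qf (x - (m + m')) (y - (n + n')) - 2/3) / 2 by lra.
have q4 : qf (x - m') (y - n') ^+ 2 <= 4/9 by have := qf_ge0 (x - m') (y - n'); nra.
have [h|h] := gen m' n' m n hu hm'; [apply: Or43|apply: Or44].
  set z := (X in 3 * X ^+ 2); have -> : z = k - t + (n + n') * x - (m + m') * y - (n * (x - m') - m * (y - n')) - 1.
    by rewrite /z /c; ring.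
  lra.
set z := (X in 3 * X ^+ 2); have -> : z = k - t + (n + n') * x - (m + m') * y - (n * (x - m') - m * (y - n')) + 1.
  by rewrite /z /c; ring.
lra.
Qed.

(* Two points of the closed ball over 0, at heights 0 and 2 s, have a common
   neighbour over 1 or -1. *)
Lemma step_vert (x y t s : F) : qf x y <= 1/3 -> t ^+ 2 <= 1 -> s ^+ 2 = 1 ->
  cyg x y t 0 0 (2 * s) <= 4 ->
  cyg x y t 1 0 s < 4 \/ cyg x y t (-1) 0 s < 4.
Proof.
move=> hB ht hs hw; rewrite /cyg in hw *.
have h1 : (2 * s - t) ^+ 2 <= 4/3.
  by move: hw; have := sqr_ge0 (qf (x - 0) (y - 0)); rewrite !mul0r addr0 subr0; lra.
(* From |2 s - t| <= 2 / sqrt 3 < 1.16 and |t| <= 1, t is within 4/25 of s, and (4/25)^2 =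
   0.0256. *)
have h2 : (s - t) ^+ 2 <= 7/250.
  have /orP[] : (s == 1) || (s == -1) by rewrite -eqf_sqr hs expr1n.
    move=> /eqP es; rewrite es in h1 *.
    have : 21/25 <= t by rewrite leNgt; apply/negP => h; nra.
    have : t <= 1 by rewrite leNgt; apply/negP => h; nra.
    nra.
  move=> /eqP es; rewrite es in h1 *.
  have : t <= -21/25 by rewrite leNgt; apply/negP => h; nra.
  have : -1 <= t by rewrite leNgt; apply/negP => h; nra.
  nra.
have hy : 3 * y ^+ 2 <= 4/3.
  have /cross_small : qf (1 : F) 0 = 1 by rewrite /qf; ring.
  by move=> /(_ _ _ _ hB); rewrite mul0r mul1r sub0r sqrrN; lra.
have gen (q d : F) : 0 <= q -> q <= 4/3 -> 3 * d ^+ 2 <= 4/3 -> q ^+ 2 + 3 * (s - t + d) ^+ 2 < 4.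
  move=> q0 q1 d1.
  have : (s - t + d) ^+ 2 <= 7/10 by have := sqr_ge0 (4 * (s - t) - d); nra.
  nra.
(* The sign tells which of 1 and -1 is nearer in the plane: qf (x - 1) y = qf x y - (2 x - y) +
   1. *)
case: (leP 0 (2 * x - y)) => h; [left|right].
  have -> : s - t + 0 * x - 1 * y = s - t - y by ring.
  apply: gen; [exact: qf_ge0| |by rewrite sqrrN].
  by move: hB; rewrite /qf; lra.
have -> : s - t + 0 * x - -1 * y = s - t + y by ring.
apply: gen; [exact: qf_ge0| |by []].
by move: hB; rewrite /qf; lra.
Qed.
End Plane.

(** * The unitary group over the Eisenstein integers *)

Definition unitary (a : mat O) : bool :=
  (mm a (adjm a) == I3 _) && (mm (adjm a) a == I3 _).

Definition U : Type := {a : mat O | unitary a}.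
HB.instance Definition _ := Choice.on U.

Lemma unitary1 : unitary (I3 _).
Proof. by rewrite /unitary adjm1 mm1 eqxx. Qed.
Lemma unitaryM a b : unitary a -> unitary b -> unitary (mm a b).
Proof.
move=> /andP[/eqP a1 /eqP a2] /andP[/eqP b1 /eqP b2]; rewrite /unitary adjmM.
by rewrite -!mmA (mmA b) b1 mm1 a1 (mmA (adjm a)) a2 mm1 b2 eqxx.
Qed.
Lemma unitaryV a : unitary a -> unitary (adjm a).
Proof. by rewrite /unitary adjmK andbC. Qed.

Definition mkU a (h : unitary a) : U := exist _ a h.
Definition U1 : U := mkU unitary1.
Definition Umul (a b : U) : U := mkU (unitaryM (svalP a) (svalP b)).
Definition Uinv (a : U) : U := mkU (unitaryV (svalP a)).

Lemma UmulA : associative Umul.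
Proof. by move=> a b c; apply: val_inj; exact: mmA. Qed.
Lemma Umul1 : left_id U1 Umul.
Proof. by move=> a; apply: val_inj; exact: mm1. Qed.
Lemma Umulr1 : right_id U1 Umul.
Proof. by move=> a; apply: val_inj; exact: mmr1. Qed.
Lemma UmulV : left_inverse U1 Uinv Umul.
Proof. by move=> a; apply: val_inj; apply/eqP; case/andP: (svalP a). Qed.
Lemma UmulrV : right_inverse U1 Uinv Umul.
Proof. by move=> a; apply: val_inj; apply/eqP; case/andP: (svalP a). Qed.
HB.instance Definition _ := isGroup.Build U UmulA Umul1 Umulr1 UmulV UmulrV.

Definition act (g : U) (v : vec O) : vec O := mv (val g) v.

Lemma act1 v : act 1%g v = v. Proof. exact: mv1. Qed.
Lemma actM g h v : act (g * h)%g v = act g (act h v).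
Proof. exact: mv_mm. Qed.
Lemma actK g : cancel (act g) (act g^-1%g).
Proof. by move=> v; rewrite -actM mulVg act1. Qed.
Lemma actVK g : cancel (act g^-1%g) (act g).
Proof. by move=> v; rewrite -actM mulgV act1. Qed.
Lemma act_scale g x v : act g (vscale x v) = vscale x (act g v).
Proof. exact: mv_scale. Qed.
Lemma act_adj g v w : herm (act g v) w = herm v (act g^-1%g w).
Proof. exact: herm_adj. Qed.
Lemma herm_act g v w : herm (act g v) (act g w) = herm v w.
Proof. by rewrite act_adj actK. Qed.

Definition e1 : vec O := (1, 0, 0).
Definition e3 : vec O := (0, 0, 1).

Lemma herm_e1 v : herm v e1 = v.2.
Proof. by rewrite /herm /e1 /= rmorph0 rmorph1; ring. Qed.

(* The null vectors of third coordinate 1, over b and at height 2 j + |b|^2. *)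
Definition height (b : O) (j : int) : int := 2 * j + enorm b.
Definition lat (b : O) (j : int) : vec O := (Eis j (height b j), b, 1).

Definition tr_mx (b : O) (j : int) : mat O :=
  ((1, - econj b, Eis j (height b j)), (0, 1, b), (0, 0, 1)).

Lemma tr_unitary b j : unitary (tr_mx b j).
Proof.
rewrite /unitary /tr_mx /adjm /mm /vm /vadd /vscale /I3 /height /enorm /=.
rewrite !(rmorphN, rmorph0, rmorph1) /= econjK; case: b => m n.
by apply/andP; split; apply/eqP; congr (_, _, _); apply: vec_eq; apply: eis_eq;
  rewrite !eisE /=; ring.
Qed.
Definition tr b j : U := mkU (tr_unitary b j).

Definition rot_mx (x : O) : mat O := ((1, 0, 0), (0, x, 0), (0, 0, 1)).
Lemma rot_unitary x : is_unit x -> unitary (rot_mx x).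
Proof. by move=> /unitsP; rewrite !inE => /or4P[|||/or3P[||]] /eqP ->. Qed.
Lemma scal_unitary x : is_unit x -> unitary (scal x).
Proof. by move=> /unitsP; rewrite !inE => /or4P[|||/or3P[||]] /eqP ->. Qed.
Definition swap : U := @mkU ((0, 0, 1), (0, -1, 0), (1, 0, 0)) erefl.

Lemma act_tr_e3 b j : act (tr b j) e3 = lat b j.
Proof. by apply: vec_eq; rewrite /dotp /=; ring. Qed.

Lemma act_tr_e1 b j : act (tr b j) e1 = e1.
Proof. by apply: vec_eq; rewrite /dotp /=; ring. Qed.

Lemma lat_null b j : herm (lat b j) (lat b j) = 0.
Proof. by rewrite -act_tr_e3 herm_act. Qed.

Lemma null_lat (w : vec O) : herm w w = 0 -> is_unit w.2 ->
  exists b j, w = vscale w.2 (lat b j).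
Proof.
case: w => [[x y] z] /=; rewrite {1}/herm /= => h hz.
have hz' := mul_unitJ hz.
exists (y * econj z), (ere (x * econj z)).
have hx : x = z * (x * econj z) by rewrite mulrCA hz' mulr1.
have hy : y = z * (y * econj z) by rewrite mulrCA hz' mulr1.
apply: vec_eq; rewrite ?mulr1 //=; rewrite {1}hx; congr (_ * _).
apply: eis_eq => //=; rewrite /height enormM enormJ (eqP hz) mulr1.
have {}h : x * econj z + econj (x * econj z) + y * econj y = 0.
  by rewrite -[RHS]h rmorphM /= econjK; ring.
move: h; rewrite mul_econj => /(congr1 (@ere int)); rewrite /= => h.
by rewrite /= in h *; lia.
Qed.

Lemma enorm_lat b j b' j' :
  4 * enorm (herm (lat b j) (lat b' j')) =
  enorm (b - b') ^+ 2 +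
  3 * (height b j - height b' j' + eom b * ere b' - ere b * eom b') ^+ 2.
Proof.
by case: b b' => [m n] [m' n']; rewrite /herm /lat /height /enorm /=; ring.
Qed.

Definition vmap (A B : Type) (f : A -> B) (v : vec A) : vec B :=
  (f v.1.1, f v.1.2, f v.2).

Lemma herm_map (F G : comNzRingType) (f : {rmorphism F -> G}) (v w : vec (eis F)) :
  herm (vmap (emap f) v) (vmap (emap f) w) = emap f (herm v w).
Proof. by rewrite /herm /vmap /= !rmorphD !rmorphM /= !emap_conj. Qed.

Lemma cyg_herm (F : realFieldType) (B A b : eis F) (j : F) :
  herm (A, B, 1) (A, B, 1) = 0 ->
  4 * enorm (herm (Eis j (2 * j + enorm b), b, 1) (A, B, 1)) =
  cyg (ere B) (eom B) (eom A) (ere b) (eom b) (2 * j + enorm b).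
Proof.
case: A B b => [al ka] [x y] [m n] /(congr1 (@ere F)); rewrite /herm /cyg /qf /enorm /=.
move=> e; have {e} -> : ka = 2 * al + (x ^+ 2 - x * y + y ^+ 2).
  by apply/eqP; rewrite -subr_eq0 -oppr_eq0; apply/eqP; rewrite -[RHS]e; ring.
ring.
Qed.

(** Over Q(w) the vector [h] can be scaled to third coordinate 1, where [cyg_herm] applies: x + y w
    is then its second coordinate and [t] the omega-coordinate of the first. *)
Lemma herm_lat (h : vec O) : herm h h = 0 -> h.2 != 0 ->
  exists x y t : rat, forall b j,
    (4 * enorm (herm (lat b j) h))%:~R =
    (enorm h.2)%:~R * cyg x y t (ere b)%:~R (eom b)%:~R (height b j)%:~R.
Proof.
move=> h0 hD; pose f : {rmorphism O -> eis rat} := emap intr.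
have hD' : enorm (f h.2) != 0 by rewrite enorm_map intr_eq0 enorm_eq0.
pose z := econj (f h.2) * ofF (enorm (f h.2))^-1.
have hz : f h.2 * z = 1.
  rewrite /z mulrA mul_econj; apply: eis_eq; rewrite /= ?mulr0 ?mul0r ?subr0 ?addr0 ?mulfV //.
pose A := f h.1.1 * z; pose B := f h.1.2 * z.
have hh : vmap f h = vscale (f h.2) (A, B, 1).
  by apply: vec_eq; rewrite /= ?mulr1 // mulrCA hz mulr1.
have hn : herm (A, B, 1) (A, B, 1) = 0.
  have : herm (vmap f h) (vmap f h) = 0 by rewrite herm_map h0 rmorph0.
  rewrite hh hermZl hermZr => e.
  set X := herm _ _ in e *.
  have -> : X = (f h.2 * z) * econj (f h.2 * z) * X by rewrite hz rmorph1 !mul1r.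
  rewrite rmorphM; transitivity (z * econj z * (f h.2 * (econj (f h.2) * X))).
    by ring.
  by rewrite e mulr0.
exists (ere B), (eom B), (eom A) => b j.
rewrite -(enorm_map intr h.2) rmorphM /= -enorm_map -herm_map hh hermZr enormM enormJ.
rewrite mulrCA; congr (_ * _); rewrite (_ : 4%:~R = 4) //.
have -> : vmap (emap intr) (lat b j) =
    (Eis j%:~R (2 * j%:~R + enorm (f b)), f b, 1) :> vec (eis rat).
  apply: vec_eq; rewrite /= ?rmorph1 //; apply: eis_eq => //=.
  by rewrite enorm_map rmorphD rmorphM /=.
rewrite (cyg_herm _ _ hn) /=; congr cyg.
by rewrite enorm_map /height [in RHS]intrD intrM.
Qed.

Lemma round_eis (F : archiRealFieldType) (x y : F) :
  exists m n : int, qf (x - m%:~R) (y - n%:~R) <= 1/3.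
Proof.
pose m := Num.floor x; pose n := Num.floor y.
have frac (t : F) : 0 <= t - (Num.floor t)%:~R <= 1.
  by have := floor_le t; have := floorD1_gt t; rewrite intrD rmorph1; lra.
have e (t k : F) : t - k - 1 = t - (k + 1) by ring.
have := qf_frac (frac x) (frac y); rewrite !e -!(intrD _ _ 1) /=.
by case/or4P => h; [exists m, n|exists (m + 1), n|exists m, (n + 1)|exists (m + 1), (n + 1)].
Qed.

Lemma round_even (F : archiRealFieldType) (c : F) :
  exists j : int, (2 * j%:~R - c) ^+ 2 <= 1.
Proof.
pose j := Num.floor ((c + 1) / 2); exists j.
have h1 : j%:~R <= (c + 1) / 2 by exact: floor_le.
have h2 : (c + 1) / 2 < (j + 1)%:~R by exact: floorD1_gt.
by rewrite intrD rmorph1 in h2; nra.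
Qed.

(** The group law of the Heisenberg group. The index [j''] comes from [null_lat], the image being
    null with third coordinate 1, so the parity of the height takes care of itself. *)
Lemma act_tr_lat b j b' j' : exists j'',
  act (tr b j) (lat b' j') = lat (b + b') j'' /\
  height (b + b') j'' = height b' j' + height b j + ere b' * eom b - eom b' * ere b.
Proof.
have [b'' [j'' e]] : exists b'' j'', act (tr b j) (lat b' j') = lat b'' j''.
  have h3 : (act (tr b j) (lat b' j')).2 = 1 by rewrite /act /mv /dotp /=; ring.
  have [||b'' [j'' e]] := @null_lat (act (tr b j) (lat b' j')).
  - by rewrite herm_act lat_null.
  - by rewrite h3.
  by exists b'', j''; rewrite e h3 vscale1.
have eb : b'' = b + b'.
  have : (act (tr b j) (lat b' j')).1.2 = b'' by rewrite e.
  by move=> <-; rewrite /act /mv /dotp /=; ring.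
subst b''; exists j''; split=> //.
have : eom (act (tr b j) (lat b' j')).1.1 = height (b + b') j'' by rewrite e.
by move=> <-; rewrite /act /mv /dotp /=; ring.
Qed.

(* [h] lies in the fundamental lex_domain of the lattice translations. *)
Definition reduced (h : vec O) (x y t : rat) : Prop :=
  [/\ qf x y <= 1/3, t ^+ 2 <= 1 & forall b j,
    (4 * enorm (herm (lat b j) h))%:~R =
    (enorm h.2)%:~R * cyg x y t (ere b)%:~R (eom b)%:~R (height b j)%:~R].

(** The base point is rounded to the nearest Eisenstein integer; heights over a fixed base point are
    spaced by 2, so a further vertical translation gives |t| <= 1. *)
Lemma reduce h : herm h h = 0 -> h.2 != 0 -> exists b j x y t,
  reduced (act (tr b j)^-1%g h) x y t.
Proof.
move=> h0 h2; have [x [y [t ht]]] := herm_lat h0 h2.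
have [m [n hmn]] := round_eis x y.
pose b := Eis m n; pose X := x - m%:~R; pose Y := y - n%:~R.
pose s := t - n%:~R * X + m%:~R * Y - (enorm b)%:~R.
have [j hj] := round_even s.
exists b, j, X, Y, (s - 2 * j%:~R); split=> //; first by rewrite -sqrrN opprB.
move=> b' j'; have [j'' [e1 e2]] := act_tr_lat b j b' j'.
have -> : (act (tr b j)^-1%g h).2 = h.2.
  by rewrite -!herm_e1 act_adj invgK act_tr_e1.
rewrite hermC act_adj invgK -hermC e1 ht e2; congr (_ * _).
rewrite /cyg /height /X /Y /s /X /Y /b /enorm /=.
rewrite !(intrD, intrM, rmorphN, rmorphB, rmorphXn) /=.
congr (qf _ _ ^+ 2 + 3 * _ ^+ 2); ring.
Qed.

(** The inequality behind all descents on the level: on the reduced domain, qf x y ^ 2 + 3 t^2 <=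
    1/9 + 3 < 4. *)
Lemma reduced_center h x y t : reduced h x y t -> h.2 != 0 ->
  enorm (herm (lat 0 0) h) < enorm h.2.
Proof.
move=> [h1 h2 /(_ 0 0) e] h3; rewrite -(ltr_int rat).
have D0 : 0 < (enorm h.2)%:~R :> rat by rewrite ltr0z lt_def enorm_eq0 h3 enorm_ge0.
have : cyg x y t 0 0 0 < 4.
  have -> : cyg x y t 0 0 0 = qf x y ^+ 2 + 3 * t ^+ 2 by rewrite /cyg /qf; ring.
  by have := qf_ge0 x y; nra.
by move: e; rewrite intrM (_ : height 0 0 = 0) //= !mulr0z; nra.
Qed.

Lemma lat_decrease h : herm h h = 0 -> h.2 != 0 ->
  exists b j, enorm (herm h (lat b j)) < enorm h.2.
Proof.
move=> h0 h2; have [b [j [x [y [t r]]]]] := reduce h0 h2.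
have e2 : (act (tr b j)^-1%g h).2 = h.2.
  by rewrite -!herm_e1 act_adj invgK act_tr_e1.
have := reduced_center r; rewrite e2 => /(_ h2).
have -> : lat 0 0 = e3 by [].
rewrite -[enorm (herm _ _)]enormJ -hermC act_adj invgK act_tr_e3.
by exists b, j.
Qed.

Lemma level0 (v : vec O) : herm v v = 0 -> v.2 = 0 -> v.1.2 = 0.
Proof.
case: v => [[v1 v2] v3] /= h e; move: h; rewrite e /herm /= rmorph0 mulr0 mul0r add0r addr0.
by move/eis_mulf_eq0 => [//|/(congr1 (@econj _))]; rewrite econjK rmorph0.
Qed.

Lemma unit_adjM (x y : O) : x * y = 1 -> is_unit x.
Proof.
move/(congr1 (@enorm _)); rewrite enormM enorm1 /is_unit => e.
have := enorm_ge0 x; have := enorm_ge0 y; move: (enorm x) (enorm y) e => a b e b0 a0.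
have a1 : a != 0 by apply/eqP => a0'; rewrite a0' mul0r in e.
have b1 : b != 0 by apply/eqP => b0'; rewrite b0' mulr0 in e.
by apply/eqP; nia.
Qed.

Definition scU (x : O) (h : is_unit x) : U := mkU (scal_unitary h).
Definition rotU (x : O) (h : is_unit x) : U := mkU (rot_unitary h).

Lemma act_sc x (h : is_unit x) v : act (scU h) v = vscale x v.
Proof. exact: mv_scal. Qed.

Lemma herm_e3 v : herm v e3 = v.1.1.
Proof. by rewrite /herm /e3 /= rmorph0 rmorph1; ring. Qed.

Lemma rot_mx_eq (m : mat O) (e2 := (0, 1, 0) : vec O) :
  mv m e1 = e1 -> mv m e3 = e3 -> (mv m e2).1.1 = 0 -> (mv m e2).2 = 0 ->
  m = rot_mx (mv m e2).1.2.
Proof.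
case: m => [[[[p1 p2] p3] [[q1 q2] q3]] [[r1 r2] r3]].
rewrite /mv /dotp /rot_mx /=; rewrite !(mulr0, mulr1, add0r, addr0).
by move=> [-> -> ->] [-> -> ->] -> ->.
Qed.

(** Peel off a scalar to fix [e1], then a translation to fix [e3]; what remains preserves the
    orthogonal line of these two and is a rotation. *)
Lemma stab_e1 (g : U) : (act g e1).2 = 0 -> exists x (hx : is_unit x) y (hy : is_unit y) b j,
  g = (scU hx * tr b j * rotU hy)%g.
Proof.
move=> h2; have e0 : herm (act g e1) (act g e1) = 0.
  by rewrite herm_act herm_e1.
have h1 := level0 e0 h2.
set x := (act g e1).1.1.
have ge : act g e1 = vscale x e1.
  rewrite -/(_ (act g e1)); move: h1 h2; rewrite /x.
  by case: (act g e1) => [[a b] c] /= -> ->; rewrite /vscale /= mulr1 !mulr0.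
have hx : is_unit x.
  have : herm (act g e3) (act g e1) = 1 by rewrite herm_act herm_e1.
  rewrite ge hermZr herm_e1 => /unit_adjM.
  by rewrite /is_unit enormJ.
pose g1 := ((scU hx)^-1 * g)%g.
have g1e : act g1 e1 = e1.
  rewrite actM ge -act_sc actK; done.
have g13 : (act g1 e3).2 = 1 by rewrite -herm_e1 -[X in herm _ X]g1e herm_act herm_e1.
have [||b [j e]] := @null_lat (act g1 e3).
- by rewrite herm_act.
- by rewrite g13.
rewrite g13 vscale1 in e.
pose g2 := ((tr b j)^-1 * g1)%g.
have g2e1 : act g2 e1 = e1 by rewrite actM g1e -{1}(act_tr_e1 b j) actK.
have g2e3 : act g2 e3 = e3 by rewrite actM e -act_tr_e3 actK.
pose e2 : vec O := (0, 1, 0).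
have a3 : (act g2 e2).2 = 0 by rewrite -herm_e1 -[X in herm _ X]g2e1 herm_act herm_e1.
have a1 : (act g2 e2).1.1 = 0.
  by rewrite -herm_e3 -[X in herm _ X]g2e3 herm_act herm_e3.
set y := (act g2 e2).1.2.
have hy : is_unit y.
  have : herm (act g2 e2) (act g2 e2) = 1 by rewrite herm_act; apply: eis_eq.
  by rewrite /herm a1 a3 !mul0r add0r addr0 => /unit_adjM.
exists x, hx, y, hy, b, j.
have -> : g = (scU hx * tr b j * g2)%g by rewrite /g2 /g1 !mulgA mulgK mulgV mul1g.
congr (_ * _)%g; apply: val_inj; exact: rot_mx_eq.
Qed.

(** A Euclidean algorithm on the level of [act g e1]: undoing [tr b j * swap] replaces this level by
    the norm of its product with [lat b j], which [lat_decrease] makes smaller. *)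
Lemma U_ind (K : U -> Prop) :
  (forall g, (act g e1).2 = 0 -> K g) ->
  (forall b j g, K g -> K (tr b j * swap * g)%g) -> forall g, K g.
Proof.
move=> K0 KS g; have [n] := ubnP `|enorm (act g e1).2|.
elim: n g => // n IH g /ltnSE hn.
have [/eqP/K0 //|h2] := boolP ((act g e1).2 == 0).
have h0 : herm (act g e1) (act g e1) = 0 by rewrite herm_act herm_e1.
have [b [j lt]] := lat_decrease h0 h2.
have -> : g = (tr b j * swap * ((tr b j * swap)^-1 * g))%g by rewrite mulVKg.
apply: KS; apply: IH; apply: leq_trans hn.
have -> : (act ((tr b j * swap)^-1 * g)%g e1).2 = herm (act g e1) (lat b j).
  by rewrite -herm_e1 actM act_adj invgK actM (_ : act swap e1 = e3) ?act_tr_e3.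
by move: lt (enorm_ge0 (herm (act g e1) (lat b j))); move: (enorm _) (enorm _); lia.
Qed.

(** * Chains of cusps *)

Definition cusp (v : vec O) : Prop := exists g, v = act g e1.
Definition level (v : vec O) : nat := `|enorm v.2|%N.
Definition nbr (v w : vec O) : bool := is_unit (herm v w).
Definition assoc (v w : vec O) : Prop := exists2 x, is_unit x & w = vscale x v.
Definition adj (v w : vec O) : Prop := nbr v w \/ assoc v w.

Lemma cusp_act g v : cusp v -> cusp (act g v).
Proof. by case=> h ->; exists (g * h)%g; rewrite actM. Qed.
Lemma cusp_null v : cusp v -> herm v v = 0.
Proof. by case=> g ->; rewrite herm_act herm_e1. Qed.
Lemma cusp_scale x v : is_unit x -> cusp v -> cusp (vscale x v).
Proof. by move=> hx /(cusp_act (scU hx)); rewrite act_sc. Qed.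
Lemma cusp_e1 : cusp e1. Proof. by exists 1%g; rewrite act1. Qed.
Lemma cusp_lat b j : cusp (lat b j).
Proof. by exists (tr b j * swap)%g; rewrite actM (_ : act swap e1 = e3) ?act_tr_e3. Qed.

Lemma nbrC v w : nbr v w = nbr w v.
Proof. by rewrite /nbr hermC /is_unit enormJ. Qed.
Lemma nbrZl x v w : is_unit x -> nbr (vscale x v) w = nbr v w.
Proof. by rewrite /nbr /is_unit hermZl enormM => /eqP ->; rewrite mul1r. Qed.
Lemma nbr_act g v w : nbr (act g v) (act g w) = nbr v w.
Proof. by rewrite /nbr herm_act. Qed.
Lemma unitV x : is_unit x -> is_unit (econj x).
Proof. by rewrite /is_unit enormJ. Qed.
Lemma assocC v w : assoc v w -> assoc w v.
Proof.
move=> [x hx ->]; exists (econj x); first exact: unitV.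
by rewrite vscaleA mulrC mul_unitJ // vscale1.
Qed.
Lemma adjC v w : adj v w -> adj w v.
Proof. by case=> [|/assocC]; [rewrite nbrC; left|right]. Qed.

Lemma level_scale x v : is_unit x -> level (vscale x v) = level v.
Proof. by rewrite /level /= enormM => /eqP ->; rewrite mul1r. Qed.

(** The starting point is exempt from the conditions, so that a chain can begin at a cusp of the
    same level as [v]; every later point is a neighbour of [v] of level below [n]. *)
Inductive conn (v : vec O) (n : nat) : vec O -> vec O -> Prop :=
| conn_refl w : conn v n w w
| conn_step w w' w'' : adj w w' -> nbr v w' -> cusp w' -> (level w' < n)%N ->
    conn v n w' w'' -> conn v n w w''.

Lemma enorm3 (b : O) : enorm b = 3 -> exists b1 b2, [/\ b = b1 + b2,
  enorm b1 = 1, enorm b2 = 1 & (ere b1 * eom b2 - eom b1 * ere b2) ^+ 2 = 1].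
Proof.
case: b => m n; rewrite /enorm /= => e.
have [hm hn] : (-2 <= m <= 2) /\ (-2 <= n <= 2) by split; nia.
have : m \in [:: -2; -1; 0; 1; 2] by rewrite !inE; lia.
have : n \in [:: -2; -1; 0; 1; 2] by rewrite !inE; lia.
rewrite !inE => /or4P[|||/orP[]] /eqP hn'; rewrite {}hn' in e *;
move=> /or4P[|||/orP[]] /eqP hm'; rewrite {}hm' in e *; try by [].
- by exists (Eis 0 (-1)), (Eis (-1) (-1)).
- by exists (Eis (-1) 0), (Eis (-1) (-1)).
- by exists (Eis 1 0), (Eis 0 (-1)).
- by exists (Eis (-1) 0), (Eis 0 1).
- by exists (Eis 1 0), (Eis 1 1).
- by exists (Eis 0 1), (Eis 1 1).
Qed.

Lemma enorm2 (b : O) : enorm b = 2 -> False.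
Proof.
case: b => m n; rewrite /enorm /= => e.
have [hm hn] : (-1 <= m <= 1) /\ (-1 <= n <= 1) by split; nia.
have : m \in [:: -1; 0; 1] by rewrite !inE; lia.
have : n \in [:: -1; 0; 1] by rewrite !inE; lia.
by rewrite !inE => /or3P[] /eqP hn' /or3P[] /eqP hm'; move: e; rewrite hn' hm'.
Qed.

Lemma cyg_bound (x y t m n k : rat) : qf x y <= 1/3 -> cyg x y t m n k <= 4 -> qf m n < 4.
Proof.
rewrite /cyg => h1 h2.
have h3 : qf (x - m) (y - n) <= 2.
  have := sqr_ge0 (k - t + n * x - m * y) => h.
  by rewrite leNgt; apply/negP => h'; nra.
(* This square gives |b|^2 <= 7/5 |z - b|^2 + 7/2 |z|^2 <= 14/5 + 7/6 < 4, for z = x + y w and b = m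
   + n w; 5/2 is close to the optimal ratio sqrt 6 of the two radii. *)
have := qf_ge0 (x - m + 5/2 * x) (y - n + 5/2 * y).
by move: h1 h3; rewrite /qf; lra.
Qed.

Lemma qf_int (b : O) : qf (ere b)%:~R (eom b)%:~R = (enorm b)%:~R :> rat.
Proof. by rewrite /qf /enorm !(rmorphD, rmorphN, rmorphM, rmorphXn). Qed.

Lemma nbr_lat b j b' j' : enorm (b - b') = 1 ->
  (height b j - height b' j' + eom b * ere b' - ere b * eom b') ^+ 2 = 1 ->
  nbr (lat b j) (lat b' j').
Proof.
move=> h1 h2; have := enorm_lat b j b' j'; rewrite h1 h2 /nbr /is_unit.
by move: (enorm _) => a; lia.
Qed.

Section Chain.
Variables (g : U) (h : vec O) (x y t : rat).
Hypothesis hr : reduced h x y t.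
Hypothesis hg : act g h = e1.
Hypothesis h2 : h.2 != 0.
Let v := act g e1.
Let W b j := act g (lat b j).
Let n := level v.

Lemma chain_level : n = `|enorm h.2|%N.
Proof.
rewrite /n /level -herm_e1 -hg /v herm_act hermC enormJ; congr `|enorm _|%N.
exact: herm_e1.
Qed.

(** Since [g] takes [h] to [e1], the third coordinate of [W b j] is the product of [lat b j] with
    [h], and [n] is the norm of [h.2]; the factor 4 in [reduced] gives the threshold 4. *)
Lemma chain_lt b j : (level (W b j) < n)%N =
  (cyg x y t (ere b)%:~R (eom b)%:~R (height b j)%:~R < 4).
Proof.
have [_ _ /(_ b j) e] := hr; rewrite chain_level /level -herm_e1 -hg herm_act.
have D0 : 0 < (enorm h.2)%:~R :> rat by rewrite ltr0z lt_def enorm_eq0 h2 enorm_ge0.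
have := enorm_ge0 (herm (lat b j) h); have := enorm_ge0 h.2.
move: (cyg _ _ _ _ _ _) (enorm _) (enorm _) e D0 => c d a e D0 a0 d0.
rewrite -(ltr_pM2l D0) -e; have -> : (d%:~R * 4 : rat) = (4 * d)%:~R by rewrite intrM mulrC.
by rewrite ltr_int; lia.
Qed.

Lemma chain_le b j : (level (W b j) <= n)%N =
  (cyg x y t (ere b)%:~R (eom b)%:~R (height b j)%:~R <= 4).
Proof.
have [_ _ /(_ b j) e] := hr; rewrite chain_level /level -herm_e1 -hg herm_act.
have D0 : 0 < (enorm h.2)%:~R :> rat by rewrite ltr0z lt_def enorm_eq0 h2 enorm_ge0.
have := enorm_ge0 (herm (lat b j) h); have := enorm_ge0 h.2.
move: (cyg _ _ _ _ _ _) (enorm _) (enorm _) e D0 => c d a e D0 a0 d0.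
rewrite -(ler_pM2l D0) -e; have -> : (d%:~R * 4 : rat) = (4 * d)%:~R by rewrite intrM mulrC.
by rewrite ler_int; lia.
Qed.

Lemma chain_nbr b j : nbr v (W b j).
Proof. by rewrite nbr_act nbrC /nbr herm_e1. Qed.

Lemma chain_cusp b j : cusp (W b j).
Proof. exact/cusp_act/cusp_lat. Qed.

Lemma chain_step w b j w' : adj w (W b j) ->
  cyg x y t (ere b)%:~R (eom b)%:~R (height b j)%:~R < 4 ->
  conn v n (W b j) w' -> conn v n w w'.
Proof.
move=> hw hc; apply: conn_step => //; [exact: chain_nbr|exact: chain_cusp|].
by rewrite chain_lt.
Qed.

Lemma chain_center : (level (W 0%R 0%R) < n)%N.
Proof.
rewrite chain_lt; have [q1 q2 _] := hr.
have -> : cyg x y t 0 0 0 = qf x y ^+ 2 + 3 * t ^+ 2 by rewrite /cyg /qf; ring.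
by have := qf_ge0 x y; nra.
Qed.

Lemma adjZ u b j b' j' : is_unit u -> nbr (lat b j) (lat b' j') ->
  adj (vscale u (W b j)) (W b' j').
Proof. by move=> hu e; left; rewrite nbrZl // nbr_act. Qed.

(** Only the heights 0, 2 and -2 can occur. Points over 0 at distance 2 in height are not
    neighbours, but a point over 1 or -1 at the height halfway, which is odd, is a neighbour of
    both. *)
Lemma chain0 u j : is_unit u -> (level (W 0%R j) <= n)%N ->
  conn v n (vscale u (W 0 j)) (W 0 0).
Proof.
move=> hu; rewrite chain_le => hc; have [q1 q2 _] := hr.
have [->|j0] := eqVneq j 0.
  apply: (@chain_step _ 0 0); last exact: conn_refl.
    by right; apply: assocC; exists u.
  by rewrite -chain_lt chain_center.
have hh : height 0 j = 2 * j by rewrite /height (_ : enorm 0 = 0) // addr0.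
rewrite hh intrM in hc.
have hj : j ^+ 2 = 1.
  move: hc; rewrite /cyg => hc.
  have : (2 * j%:~R - t) ^+ 2 <= 4/3.
    have := sqr_ge0 (qf (x - 0) (y - 0)); move: hc; rewrite !mul0r subr0 addr0.
    rewrite (_ : 2%:~R = 2) //; lra.
  have [t1 t2] : -1 <= t /\ t <= 1 by split; rewrite leNgt; apply/negP => ?; nra.
  move=> h3.
  have [j1 j2] : (-2 < j%:~R :> rat) /\ (j%:~R < 2 :> rat).
    by split; rewrite ltNge; apply/negP => ?; nra.
  have {}j1 : -2 < j by rewrite -(ltr_int rat).
  have {}j2 : j < 2 by rewrite -(ltr_int rat).
  by have /orP[/eqP->|/eqP->] : (j == 1) || (j == -1) by lia.
have hjr : (j%:~R : rat) ^+ 2 = 1 by rewrite -rmorphXn hj.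
have [j1 hj1] : exists j1, 2 * j1 + 1 = j.
  by exists ((j - 1) %/ 2)%Z; move: hj; rewrite expr2; nia.
have [hs|hs] := step_vert q1 q2 hjr hc.
  have hk : height 1 j1 = j by rewrite -hj1.
  apply: (@chain_step _ 1 j1).
  - by apply: adjZ => //; apply: nbr_lat; rewrite ?hk ?hh //; apply: etrans hj; rewrite /=; ring.
  - by rewrite hk.
  rewrite -[W 1 j1]vscale1; apply: (@chain_step _ 0 0); last exact: conn_refl.
    by apply: adjZ => //; apply: nbr_lat; rewrite ?hk //; apply: etrans hj; rewrite /height /enorm /=; ring.
  by rewrite -chain_lt chain_center.
have hk : height (-1) j1 = j by rewrite -hj1.
apply: (@chain_step _ (-1) j1).
- by apply: adjZ => //; apply: nbr_lat; rewrite ?hk ?hh //; apply: etrans hj; rewrite /=; ring.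
- by rewrite hk.
rewrite -[W (-1) j1]vscale1; apply: (@chain_step _ 0 0); last exact: conn_refl.
  by apply: adjZ => //; apply: nbr_lat; rewrite ?hk //; apply: etrans hj; rewrite /height /enorm /=; ring.
by rewrite -chain_lt chain_center.
Qed.

Lemma chain1 u b j : is_unit u -> enorm b = 1 -> (level (W b j) <= n)%N ->
  conn v n (vscale u (W b j)) (W 0 0).
Proof.
move=> hu hb; rewrite chain_le => hc; have [q1 q2 _] := hr.
have qb : qf (ere b)%:~R (eom b)%:~R = 1 :> rat by rewrite qf_int hb.
have step j' : (height b j - height 0 j') ^+ 2 = 1 ->
    cyg x y t 0 0 (height 0 j')%:~R < 4 -> conn v n (vscale u (W b j)) (W 0 0).
  move=> e hc'; apply: (@chain_step _ 0 j') => //.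
    by apply: adjZ => //; apply: nbr_lat; rewrite ?subr0 //; apply: etrans e; rewrite /=; ring.
  rewrite -[W 0 j']vscale1; apply: chain0 => //.
  by apply: ltnW; rewrite chain_lt.
have h0 j' : height 0 j' = 2 * j' by rewrite /height (_ : enorm 0 = 0) // addr0.
have hbj : height b j = 2 * j + 1 by rewrite /height hb.
rewrite hbj in hc step; have [hs|hs] := step_unit q1 qb hc.
  apply: (step j); rewrite h0; first by ring.
  by move: hs; rewrite intrD addrK.
apply: (step (j + 1)); rewrite h0; first by ring.
have -> : 2 * (j + 1) = 2 * j + 1 + 1 by ring.
by rewrite [in X in cyg _ _ _ _ _ X]intrD.
Qed.

Lemma chain3 u b j : is_unit u -> enorm b = 3 -> (level (W b j) <= n)%N ->
  conn v n (vscale u (W b j)) (W 0 0).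
Proof.
move=> hu hb; rewrite chain_le => hc; have [q1 q2 _] := hr.
have [b1 [b2 [eb hb1 hb2 hdet]]] := enorm3 hb.
have qb1 : qf (ere b1)%:~R (eom b1)%:~R = 1 :> rat by rewrite qf_int hb1.
have qb2 : qf (ere b2)%:~R (eom b2)%:~R = 1 :> rat by rewrite qf_int hb2.
have eR : (ere b)%:~R = (ere b1)%:~R + (ere b2)%:~R :> rat by rewrite eb ereD intrD.
have eI : (eom b)%:~R = (eom b1)%:~R + (eom b2)%:~R :> rat by rewrite eb eomD intrD.
have qb : qf ((ere b1)%:~R + (ere b2)%:~R) ((eom b1)%:~R + (eom b2)%:~R) = 3 :> rat.
  by rewrite -eR -eI qf_int hb.
have step c k : enorm (b - c) = 1 -> enorm c = 1 ->
    (height b j - k + eom b * ere c - ere b * eom c) ^+ 2 = 1 ->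
    (exists j', 2 * j' + 1 = k) ->
    cyg x y t (ere c)%:~R (eom c)%:~R k%:~R < 4 -> conn v n (vscale u (W b j)) (W 0 0).
  move=> hbc hc1 e [j' hj'] hc'; have hk : height c j' = k by rewrite /height hc1.
  apply: (@chain_step _ c j'); rewrite ?hk //.
    by apply: adjZ => //; apply: nbr_lat; rewrite ?hk.
  rewrite -[W c j']vscale1; apply: chain1 => //.
  by apply: ltnW; rewrite chain_lt hk.
have bb1 : enorm (b - b1) = 1 by rewrite eb addrC addKr.
have bb2 : enorm (b - b2) = 1 by rewrite eb addrK.
pose c := ere b1 * eom b2 - eom b1 * ere b2.
have hc1 : (c == 1) || (c == -1) by rewrite -eqf_sqr expr1n -hdet.
have odd1 e : (e == 1) || (e == -1) -> exists j', 2 * j' + 1 = height b j + c + e.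
  move=> he; exists ((height b j + c + e - 1) %/ 2)%Z; rewrite /height hb.
  by case/orP: he => /eqP ->; case/orP: hc1 => /eqP ->; lia.
have odd2 e : (e == 1) || (e == -1) -> exists j', 2 * j' + 1 = height b j - c + e.
  move=> he; exists ((height b j - c + e - 1) %/ 2)%Z; rewrite /height hb.
  by case/orP: he => /eqP ->; case/orP: hc1 => /eqP ->; lia.
have cR : (ere b1)%:~R * (eom b2)%:~R - (eom b1)%:~R * (ere b2)%:~R = c%:~R :> rat.
  by rewrite /c rmorphB !rmorphM.
rewrite eR eI in hc.
have := step_far q1 qb1 qb2 qb hc; rewrite /= cR => -[] hs.
- apply: (step b1 (height b j + c - 1)) => //; last by rewrite intrD rmorphN (intrD _ (height b j) c).
    by rewrite eb /c !eisE; ring.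
  exact: odd1.
- apply: (step b1 (height b j + c + 1)) => //; last by rewrite intrD (intrD _ (height b j) c).
    by rewrite eb /c !eisE; ring.
  exact: odd1.
- apply: (step b2 (height b j - c - 1)) => //; last by rewrite intrD rmorphN (intrD _ (height b j) (- c)) rmorphN.
    by rewrite eb /c !eisE; ring.
  exact: odd2.
apply: (step b2 (height b j - c + 1)) => //; last by rewrite intrD (intrD _ (height b j) (- c)) rmorphN.
  by rewrite eb /c !eisE; ring.
exact: odd2.
Qed.

(** A neighbour of level at most [n] lies over some b with |b|^2 < 4, hence 0, 1 or 3, as 2 is not a
    norm. A vector associated to [v] steps directly to the centre. *)
Lemma chain_all w : cusp w -> adj v w -> (level w <= n)%N -> conn v n w (W 0 0).
Proof.
move=> cw [hw|[u hu ->]] hl; last first.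
  apply: (@chain_step _ 0 0); last exact: conn_refl.
    by left; rewrite nbrZl // chain_nbr.
  by rewrite -chain_lt chain_center.
have ew : w = act g (act g^-1%g w) by rewrite actVK.
have hu : is_unit (act g^-1%g w).2.
  by rewrite -herm_e1 act_adj invgK -/v; rewrite nbrC in hw.
have n0 : herm (act g^-1%g w) (act g^-1%g w) = 0 by rewrite herm_act cusp_null.
have [b [j e]] := null_lat n0 hu.
rewrite ew e act_scale -/(W b j); rewrite ew e act_scale -/(W b j) level_scale // in hl.
have := hl; rewrite chain_le => hc; have [q1 q2 _] := hr.
have := cyg_bound q1 hc; rewrite qf_int (_ : 4 = 4%:~R) // ltr_int => hb.
have [b0|b0] := eqVneq b 0; first by rewrite b0 in hl *; exact: chain0.
have : enorm b != 0 by rewrite enorm_eq0.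
have := enorm_ge0 b => h0 h0'.
have : (enorm b == 1) || (enorm b == 2) || (enorm b == 3) by lia.
case/orP=> [/orP[]|] /eqP eb; [exact: chain1| |exact: chain3].
by case: (enorm2 eb).
Qed.
End Chain.

(** For the filtration of the cusps by level, the descending link of [v] is nonempty and connected.
    Together with additivity on triangles this makes a cocycle a coboundary. *)
Lemma chain v : cusp v -> (0 < level v)%N -> exists w0,
  [/\ cusp w0, nbr v w0, (level w0 < level v)%N & forall w, cusp w -> adj v w ->
      (level w <= level v)%N -> conn v (level v) w w0].
Proof.
move=> [g ->] lv; pose h := act g^-1%g e1.
have hl : (act g e1).2 = econj h.2.
  by rewrite -!herm_e1 -hermC act_adj.
have h0 : h.2 != 0.
  by apply/eqP => e; move: lv; rewrite /level hl e rmorph0.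
have hn : herm h h = 0 by rewrite herm_act herm_e1.
have [b [j [x [y [t r]]]]] := reduce hn h0.
pose g' := (g * tr b j)%g.
have eg : act g e1 = act g' e1 by rewrite actM act_tr_e1.
have h0' : (act (tr b j)^-1%g h).2 != 0.
  by rewrite -herm_e1 act_adj invgK act_tr_e1 herm_e1.
have hg : act g' (act (tr b j)^-1%g h) = e1 by rewrite actM actVK actVK.
exists (act g' (lat 0 0)); rewrite eg; split.
- exact: chain_cusp.
- exact: chain_nbr.
- exact: (chain_center r hg h0').
- exact: (chain_all r hg h0').
Qed.

(** * The cocycle on adjacent cusps *)

Notation O3 := (eis F3).

Definition vred3 (v : vec O) : vec O3 := vmap red3 v.
Definition mred3 (a : mat O) : mat O3 := vmap (vmap red3) a.
Definition unit3 (x : O3) : bool := enorm x == 1.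
(* The third coordinate is divisible by sqrt(-3). *)
Definition ramified3 (x : vec O3) : bool := enorm x.2 == 0.
(* This is v2 / v3 when v3 is a unit, as a unit times its conjugate is 1. *)
Definition coord3 (x : vec O3) : O3 := x.1.2 * econj x.2.
(** The cube in characteristic 3 is the residue of [x.1.1] modulo sqrt(-3), a sign when [x.1.1] is a
    unit, and [x.2] is a multiple of sqrt(-3) when [x] is ramified; the difference is then a unit.
    It is the factor that turns a determinant into a difference of [coord3], see
    [check_ram_triangle]. *)
Definition eps3 (x : vec O3) : O3 := x.1.1 ^+ 3 - x.2.

Definition null3 (x : vec O3) : bool := herm x x == 0.
Definition unram_reps : seq (vec O3) :=
  [seq x <- [seq (a, b, 1) | a <- E3s, b <- E3s] | null3 x].
(** Unlike [unram_reps], this list is not normalized by units, because [eps3] depends on the vector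
    and not only on its line. *)
Definition ram_reps : seq (vec O3) :=
  [seq x <- [seq (ab, c) | ab <- [seq (a, b) | a <- E3s, b <- E3s], c <- E3s]
   | null3 x && ramified3 x && unit3 x.1.1].

Lemma vred3_mv a v : vred3 (mv a v) = mv (mred3 a) (vred3 v).
Proof. by apply: vec_eq; rewrite /dotp !rmorphD !rmorphM. Qed.
Lemma vred3_herm v w : herm (vred3 v) (vred3 w) = red3 (herm v w).
Proof. exact: herm_map. Qed.
Lemma vred3_scale x v : vred3 (vscale x v) = vscale (red3 x) (vred3 v).
Proof. by apply: vec_eq; rewrite /= rmorphM. Qed.
Lemma vred3_det u v w : det3 (vred3 u) (vred3 v) (vred3 w) = red3 (det3 u v w).
Proof. by rewrite /det3 !(rmorphD, rmorphN, rmorphM). Qed.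

Lemma enorm_red3 x : enorm (red3 x) = (enorm x)%:~R.
Proof. exact: enorm_map. Qed.
Lemma unit3_red x : is_unit x -> unit3 (red3 x).
Proof. by rewrite /unit3 enorm_red3 => /eqP ->. Qed.
Lemma unit3V x : unit3 x -> x * econj x = 1.
Proof. by move=> /eqP e; rewrite mul_econj e. Qed.

Lemma enorm3_cases (x : O3) : enorm x = 0 \/ enorm x = 1.
Proof.
have : (enorm x == 0) || (enorm x == 1).
  by move: x; apply: all_E3s; vm_compute.
by case/orP=> /eqP; [left|right].
Qed.

Lemma red3_lift3 x : unit3 x -> red3 (lift3 x) = x.
Proof.
have : unit3 x ==> (red3 (lift3 x) == x) by move: x; apply: all_E3s; vm_compute.
by move=> /implyP h /h /eqP.
Qed.
Lemma unit_lift3 x : unit3 x -> is_unit (lift3 x).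
Proof.
have : unit3 x ==> is_unit (lift3 x) by move: x; apply: all_E3s; vm_compute.
by move=> /implyP.
Qed.
Lemma lift3N x : lift3 (- x) = - lift3 x.
Proof. by apply/eqP; move: x; apply: all_E3s; vm_compute. Qed.
Lemma lift30 : lift3 0 = 0. Proof. by apply/eqP; vm_compute. Qed.

Lemma unit_eq3 x y : is_unit x -> is_unit y -> red3 x = red3 y -> x = y.
Proof. by move=> hx hy e; rewrite -(lift3K hx) e lift3K. Qed.

Lemma unram_reps_norm (x : vec O3) : null3 x -> unit3 x.2 ->
  exists2 y, y \in unram_reps & x = vscale x.2 y.
Proof.
case: x => [[a b] c]; rewrite /null3 /= => h0 hc.
have hc' := unit3V hc.
have e : (a, b, c) = vscale c (a * econj c, b * econj c, 1) :> vec O3.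
  by apply: vec_eq => /=; rewrite ?mulr1 // mulrCA hc' mulr1.
exists (a * econj c, b * econj c, 1) => //.
rewrite mem_filter /null3; apply/andP; split.
  move: h0; rewrite e hermZl hermZr mulrA hc' mul1r; exact.
by apply: (allpairs_f (fun a b : O3 => (a, b, 1))); exact: mem_E3s.
Qed.

Lemma mem_ram_reps (x : vec O3) : null3 x -> ramified3 x -> unit3 x.1.1 -> x \in ram_reps.
Proof.
case: x => [[a b] c] h1 h2 h3; rewrite mem_filter h1 h2 h3 andTb.
apply: (allpairs_f (fun (ab : O3 * O3) (c : O3) => (ab, c))); last exact: mem_E3s.
by apply: (allpairs_f (fun a b : O3 => (a, b))); exact: mem_E3s.
Qed.

Lemma coord3_scale c x : unit3 c -> coord3 (vscale c x) = coord3 x.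
Proof.
by move=> hc; rewrite /coord3 /= rmorphM mulrACA unit3V // mul1r.
Qed.

Definition omega3 : O3 := Eis 0 1.
(** The condition on p is supplied over O by [gram_unit]. Modulo 3 alone, the Gram relation would
    also allow p = 1, whose trace 2 is congruent to -1. *)
Lemma check_unram_triangle : all (fun v => all (fun w => unit3 (herm v w) ==>
  all (fun x =>
  let p := herm v w * herm w x * herm x v in
  (unit3 (herm w x) && unit3 (herm x v) && ((p == omega3) || (p == econj omega3))) ==>
  (lift3 (coord3 w - coord3 v) + lift3 (coord3 x - coord3 w) + lift3 (coord3 v - coord3 x) == 0)) unram_reps) unram_reps) unram_reps.
Proof. vm_cast_no_check (erefl true). Qed.

Lemma check_ram_triangle : all (fun u => all (fun w => all (fun x =>
  (unit3 (herm w u) && unit3 (herm x u) && unit3 (herm w x)) ==>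
  (coord3 x - coord3 w == - eps3 u * det3 u w x * econj (herm w u * herm x u))) unram_reps) unram_reps) ram_reps.
Proof. vm_cast_no_check (erefl true). Qed.

Lemma check_eps : all (fun u => unit3 (eps3 u)) ram_reps.
Proof. vm_cast_no_check (erefl true). Qed.

Lemma check_eps_scale : all (fun l => unit3 l ==> all (fun u => 
  eps3 (vscale l u) == l ^+ 3 * eps3 u) ram_reps) E3s.
Proof. vm_cast_no_check (erefl true). Qed.

(** The residue condition under which a unitary matrix preserves [cc_unram] and [cc_via], and so
    shifts the potential by a constant. It is wider than congruence to 1: the three reflections,
    [transl1] and the scalars satisfy it. *)
Definition inv3 (m : mat O3) : bool :=
  [&& all (fun v => ~~ ramified3 (mv m v)) unram_reps,
      all (fun v => all (fun w => unit3 (herm v w) ==>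
         (coord3 (mv m w) - coord3 (mv m v) == coord3 w - coord3 v)) unram_reps) unram_reps
    & all (fun u => ramified3 (mv m u) &&
         (eps3 (mv m u) * det3 m.1.1 m.1.2 m.2 == eps3 u)) ram_reps].

Lemma enorm3_0D (x y : O3) : enorm x = 0 -> enorm y = 0 -> enorm (x + y) = 0.
Proof.
have : (enorm x == 0) ==> (enorm y == 0) ==> (enorm (x + y) == 0).
  move: y; apply: all_E3s; move: x; apply: all_E3s.
  by vm_compute.
by move=> /implyP h /eqP/h/implyP h' /eqP/h'/eqP.
Qed.
Lemma enorm3_0Mr (x y : O3) : enorm y = 0 -> enorm (x * y) = 0.
Proof. by rewrite enormM => ->; rewrite mulr0. Qed.

Lemma enorm3_0_trace (x : O3) : enorm x = 0 -> x + econj x = 0.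
Proof.
have : (enorm x == 0) ==> (x + econj x == 0) by move: x; apply: all_E3s; vm_compute.
by move=> /implyP h /eqP/h/eqP.
Qed.

Lemma null3_ramified (x : vec O3) : null3 x -> ramified3 x -> enorm x.1.2 = 0.
Proof.
case: x => [[a b] c]; rewrite /null3 /ramified3 /herm /= => /eqP h /eqP hc.
have : a * econj c + econj (a * econj c) = 0.
  by apply: enorm3_0_trace; apply: enorm3_0Mr; rewrite enormJ.
move: h; rewrite rmorphM /= econjK mul_econj => h h'.
have : ofF (enorm b) = 0 by rewrite -[RHS]h -[LHS]add0r -h'; ring.
by case.
Qed.

Lemma ramified3_unit (u w : vec O3) : null3 u -> ramified3 u -> unit3 (herm w u) ->
  unit3 u.1.1 /\ unit3 w.2.
Proof.
move=> hu h4 hw; have h2 := null3_ramified hu h4.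
have : enorm (w.2 * econj u.1.1) <> 0.
  move=> e; move: hw; rewrite /unit3 /herm enorm3_0D //; apply: enorm3_0D.
    by apply: enorm3_0Mr; rewrite enormJ; apply/eqP.
  by apply: enorm3_0Mr; rewrite enormJ.
rewrite enormM enormJ /unit3.
by case: (enorm3_cases u.1.1) => ->; case: (enorm3_cases w.2) => ->.
Qed.

Lemma red3_conj (x : O) : red3 (econj x) = econj (red3 x).
Proof. exact: emap_conj. Qed.

Section Cocycle.
Implicit Types u v w : vec O.

Definition unramified v : bool := ~~ ramified3 (vred3 v).
Lemma null_vred3 v : herm v v = 0 -> null3 (vred3 v).
Proof. by rewrite /null3 vred3_herm => ->; rewrite rmorph0. Qed.
Lemma unramified_unit v : unramified v -> unit3 (vred3 v).2.
Proof. by rewrite /unramified /ramified3 /unit3; case: (enorm3_cases (vred3 v).2) => ->. Qed.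
Lemma nbr_vred3 v w : nbr v w -> unit3 (herm (vred3 v) (vred3 w)).
Proof. by move=> h; rewrite vred3_herm unit3_red. Qed.

(** In particular two ramified cusps are never neighbours, so a triangle of neighbours has at most
    one ramified vertex. *)
Lemma nbr_ramified u w : herm u u = 0 -> ~~ unramified u -> nbr w u ->
  vred3 u \in ram_reps /\ unramified w.
Proof.
move=> hu /negPn h4 /nbr_vred3 hw; have [h1 h2] := ramified3_unit (null_vred3 hu) h4 hw.
split; first by apply: mem_ram_reps => //; exact: null_vred3.
by rewrite /unramified /ramified3; move: h2; rewrite /unit3 => /eqP ->.
Qed.

Lemma unramified_scale x v : is_unit x -> unramified (vscale x v) = unramified v.
Proof.
move=> /unit3_red /eqP h; rewrite /unramified vred3_scale /ramified3 /= enormM; rewrite h mul1r //.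
Qed.

Definition cc_unram v w : O := lift3 (coord3 (vred3 w) - coord3 (vred3 v)).
Definition eps u : O := lift3 (eps3 (vred3 u)).
(* The increment of the potential between two neighbours v, w of a ramified cusp u.
   It is additive by linear algebra, and agrees with [cc_unram v w] modulo 3. *)
Definition cc_via u v w : O := - eps u * det3 u v w * econj (herm v u * herm w u).

Lemma cc_via_add u v w (x : vec O) : herm u u = 0 -> nbr v u -> nbr w u -> nbr x u ->
  cc_via u v w + cc_via u w x = cc_via u v x.
Proof.
move=> hu; rewrite /nbr; move=> hv hw hx.
(* Cramer's relation between the four vectors u, v, w, x, paired with the null vector u. *)
have key : herm x u * det3 u v w + herm v u * det3 u w x - herm w u * det3 u v x = 0.
  have -> : herm x u * det3 u v w + herm v u * det3 u w x - herm w u * det3 u v x =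
    det3 v w x * herm u u by rewrite /herm /det3; ring.
  by rewrite hu mulr0.
apply/eqP; rewrite -subr_eq0; apply/eqP.
have := mul_unitJ hv; have := mul_unitJ hw; have := mul_unitJ hx.
rewrite /cc_via !rmorphM.
move: (herm v u) (herm w u) (herm x u) (det3 u v w) (det3 u w x) (det3 u v x) key.
move=> p q r A B C key hr hq hp.
transitivity (- eps u * econj p * econj q * econj r * (r * A + p * B - q * C)
  + (1 - r * econj r) * (- eps u * A * econj p * econj q)
  + (1 - p * econj p) * (- eps u * B * econj q * econj r)
  - (1 - q * econj q) * (- eps u * C * econj p * econj r)); first by ring.
rewrite key hp hq hr; ring.
Qed.

Lemma cc_via_scaler u v w x : is_unit x -> cc_via u v (vscale x w) = cc_via u v w.
Proof.
move=> hx; rewrite /cc_via hermZl !rmorphM.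
have -> : det3 u v (vscale x w) = x * det3 u v w by rewrite /det3 /=; ring.
have := mul_unitJ hx => e.
transitivity (- eps u * det3 u v w * (econj (herm v u) * econj (herm w u)) * (x * econj x)).
  by ring.
by rewrite e mulr1.
Qed.

Lemma eps_unit u : vred3 u \in ram_reps -> is_unit (eps u).
Proof. by move=> hu; apply: unit_lift3; exact: (allP check_eps). Qed.

Lemma eps_scale u x : is_unit x -> vred3 u \in ram_reps -> vred3 (vscale x u) \in ram_reps ->
  eps (vscale x u) = x ^+ 3 * eps u.
Proof.
move=> hx hu hxu; apply: unit_eq3; first exact: eps_unit.
  by rewrite /is_unit enormM (eqP (eps_unit hu)) mulr1 !exprS expr0 !enormM (eqP hx) enorm1 !mulr1.
have -> : red3 (x ^+ 3 * eps u) = red3 x ^+ 3 * red3 (eps u) by rewrite rmorphM rmorphXn.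
rewrite !red3_lift3 ?(allP check_eps) //.
have := allP check_eps_scale (red3 x) (mem_E3s _); rewrite unit3_red //.
by move/allP/(_ _ hu)/eqP; rewrite vred3_scale.
Qed.

Lemma cc_via_scale u v w x : is_unit x -> herm u u = 0 -> ~~ unramified u -> nbr v u ->
  cc_via (vscale x u) v w = cc_via u v w.
Proof.
move=> hx hu h4 hv.
have [h1 _] := nbr_ramified hu h4 hv.
have [h2 _] : vred3 (vscale x u) \in ram_reps /\ unramified v.
  apply: nbr_ramified; rewrite ?unramified_scale //; last by rewrite nbrC nbrZl // nbrC.
  by rewrite hermZl hermZr hu !mulr0.
rewrite /cc_via eps_scale // det3_scale !hermZr !rmorphM /= !econjK.
(* The factor [eps] contributes x^3, the determinant x, and each of the two products one more x. *)
have : x ^+ 6 = 1.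
  by move: hx => /unitsP; rewrite !inE => /or4P[|||/or3P[||]] /eqP ->.
move=> e; transitivity (x ^+ 6 * (- eps u * det3 u v w * (econj (herm v u) * econj (herm w u)))).
  by ring.
by rewrite e mul1r.
Qed.

(** The trace of the unit p is 1, -1, 2 or -2, and by [gram_null] it is minus the norm of the
    determinant. As 2 is not a norm, the trace is -1. *)
Lemma gram_unit u v w : herm u u = 0 -> herm v v = 0 -> herm w w = 0 ->
  nbr u v -> nbr v w -> nbr w u ->
  enorm (det3 u v w) = 1 /\
  let p := herm u v * herm v w * herm w u in (p == omega) || (p == econj omega).
Proof.
move=> hu hv hw huv hvw hwu; have := gram_null hu hv hw.
have : is_unit (herm u v * herm v w * herm w u).
  by rewrite /is_unit !enormM (eqP huv) (eqP hvw) (eqP hwu).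
have := @enorm2 (det3 u v w); have := enorm_ge0 (det3 u v w).
rewrite /= mul_econj.
move: (_ * _ * _) (enorm (det3 u v w)) => p n n0 n2 /unitsP; rewrite !inE.
by move=> /or4P[|||/or3P[||]] /eqP -> /(congr1 (@ere _)) /= e;
  first [by exfalso; lia | by exfalso; apply: n2; lia | split=> //; lia].
Qed.

Lemma unramified_norm v : herm v v = 0 -> unramified v ->
  exists2 y, y \in unram_reps & vred3 v = vscale (vred3 v).2 y.
Proof. by move=> hv h4; apply: unram_reps_norm; [exact: null_vred3|exact: unramified_unit]. Qed.

(** By [gram_unit] the determinant in [cc_via u v w] is a unit, so [cc_via u v w] is a unit and is
    recovered by [lift3] from its residue, which [check_ram_triangle] computes. *)
Lemma cc_unram_via u v w : herm u u = 0 -> herm v v = 0 -> herm w w = 0 ->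
  ~~ unramified u -> nbr v u -> nbr w u -> nbr v w -> cc_via u v w = cc_unram v w.
Proof.
move=> hu hv hw h4 vu wu vw.
have [Yu Xv] := nbr_ramified hu h4 vu; have [_ Xw] := nbr_ramified hu h4 wu.
have [y yX ey] := unramified_norm hv Xv; have [z zX ez] := unramified_norm hw Xw.
have uy := unramified_unit Xv; have uz := unramified_unit Xw.
move: (nbr_vred3 vu) (nbr_vred3 wu) (nbr_vred3 vw); rewrite ey ez !hermZl hermZr.
rewrite /unit3 !enormM enormJ (eqP uy) (eqP uz) !mul1r => yu zu yz.
have e : coord3 (vred3 w) - coord3 (vred3 v) = red3 (cc_via u v w).
  rewrite ey ez !coord3_scale //.
  have := allP (allP (allP check_ram_triangle _ Yu) _ yX) _ zX.
  rewrite /unit3 yu zu yz /= => /eqP ->.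
  have -> : red3 (cc_via u v w) = - red3 (eps u) * red3 (det3 u v w) *
      econj (red3 (herm v u) * red3 (herm w u)).
    by rewrite /cc_via -rmorphN -!rmorphM -red3_conj -!rmorphM.
  rewrite -vred3_det -!vred3_herm red3_lift3; last exact: (allP check_eps).
  rewrite ey ez !hermZl.
  have -> : det3 (vred3 u) (vscale (vred3 v).2 y) (vscale (vred3 w).2 z) =
     (vred3 v).2 * (vred3 w).2 * det3 (vred3 u) y z by rewrite /det3 /=; ring.
  rewrite !rmorphM.
  have := unit3V uy; have := unit3V uz; move: (vred3 v).2 (vred3 w).2 => p q hq hp.
  transitivity ((p * econj p) * (q * econj q) * (- eps3 (vred3 u) * det3 (vred3 u) y z *
     (econj (herm y (vred3 u)) * econj (herm z (vred3 u))))).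
    by rewrite hp hq !mul1r.
  by ring.
rewrite /cc_unram e lift3K // /is_unit /cc_via !enormM enormN enormJ enormM.
have [-> _] := gram_unit hu hv hw (etrans (nbrC _ _) vu) vw wu.
by rewrite (eqP (eps_unit Yu)) (eqP vu) (eqP wu).
Qed.

Lemma cc_unram_triangle u v w : herm u u = 0 -> herm v v = 0 -> herm w w = 0 ->
  unramified u -> unramified v -> unramified w -> nbr u v -> nbr v w -> nbr w u ->
  cc_unram u v + cc_unram v w + cc_unram w u = 0.
Proof.
move=> hu hv hw Xu Xv Xw uv vw wu.
have [_ hp] := gram_unit hu hv hw uv vw wu.
have [x xX ex] := unramified_norm hu Xu; have [y yX ey] := unramified_norm hv Xv.
have [z zX ez] := unramified_norm hw Xw.
have ux := unramified_unit Xu; have uy := unramified_unit Xv; have uz := unramified_unit Xw.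
move: (nbr_vred3 uv) (nbr_vred3 vw) (nbr_vred3 wu).
have : (herm (vred3 u) (vred3 v) * herm (vred3 v) (vred3 w) * herm (vred3 w) (vred3 u) == omega3) ||
       (herm (vred3 u) (vred3 v) * herm (vred3 v) (vred3 w) * herm (vred3 w) (vred3 u) == econj omega3).
  by rewrite !vred3_herm -!rmorphM /=; case/orP: hp => /eqP ->; rewrite ?red3_conj eqxx ?orbT.
rewrite /cc_unram ex ey ez !coord3_scale // !hermZl !hermZr /unit3 !enormM !enormJ.
rewrite (eqP ux) (eqP uy) (eqP uz) !mul1r => hp' h1 h2 h3.
have /implyP/(_ h1)/allP h := allP (allP check_unram_triangle _ xX) _ yX.
have := h _ zX; rewrite /unit3 h2 h3 !andTb.
have -> : herm x y * herm y z * herm z x =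
  (vred3 u).2 * (econj (vred3 v).2 * herm x y) * ((vred3 v).2 * (econj (vred3 w).2 * herm y z)) *
  ((vred3 w).2 * (econj (vred3 u).2 * herm z x)).
  have := unit3V ux; have := unit3V uy; have := unit3V uz.
  move: (vred3 u).2 (vred3 v).2 (vred3 w).2 => p q r hr hq hp1.
  transitivity ((p * econj p) * (q * econj q) * (r * econj r) *
     (herm x y * herm y z * herm z x)); first by rewrite hp1 hq hr !mul1r.
  by ring.
by rewrite hp' /= => /eqP.
Qed.

Lemma cc_unram_scaler v w x : is_unit x -> cc_unram v (vscale x w) = cc_unram v w.
Proof. by move=> hx; rewrite /cc_unram vred3_scale coord3_scale // unit3_red. Qed.
Lemma cc_unram_anti v w : cc_unram w v = - cc_unram v w.
Proof. by rewrite /cc_unram -lift3N opprB. Qed.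
Lemma cc_unram_same v : cc_unram v v = 0.
Proof. by rewrite /cc_unram subrr lift30. Qed.

(* A neighbour of [u], depending only on the line through [u]. *)
Definition base u : vec O :=
  xget 0 [set w | is_true ((herm w w == 0) && nbr w u)].

Lemma base_scale u x : is_unit x -> base (vscale x u) = base u.
Proof.
move=> hx; rewrite /base; congr xget; apply/funext => w; congr is_true.
by rewrite (nbrC w (vscale x u)) nbrZl // (nbrC u).
Qed.

Lemma baseP u : cusp u -> herm (base u) (base u) = 0 /\ nbr (base u) u.
Proof.
move=> [g eg]; rewrite /base; case: xgetP => [w _ /andP[/eqP]//|/(_ (act g e3))].
case; rewrite /= herm_act eg nbr_act.
by apply/andP; split; [apply/eqP|].
Qed.

(* The potential of a ramified cusp is normalized to that of its neighbour [base]. *)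
Definition cc v w : O :=
  if unramified v then if unramified w then cc_unram v w else - cc_via w (base w) v
  else if unramified w then cc_via v (base v) w else 0.

Lemma cc_anti v w : cc w v = - cc v w.
Proof.
rewrite /cc; case: (unramified v); case: (unramified w); rewrite ?opprK ?oppr0 //.
exact: cc_unram_anti.
Qed.

Lemma cc_assoc u v w : cusp u -> cusp w -> adj v u -> assoc v w ->
  cusp v -> cc u v = cc u w.
Proof.
move=> cu cw vu [x hx ->] cv; rewrite /cc unramified_scale //.
case Xu: (unramified u); case Xv: (unramified v) => //.
- by rewrite cc_unram_scaler.
- congr (- _); rewrite base_scale // cc_via_scale ?cusp_null ?Xv //.
  by have [] := baseP cv.
by rewrite cc_via_scaler.
Qed.

Lemma cc_same_line v w : assoc v w -> cc v w = 0.
Proof.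
move=> [x hx ->]; rewrite /cc unramified_scale //; case: (unramified v) => //.
by rewrite cc_unram_scaler // cc_unram_same.
Qed.

(** An edge between associated vectors collapses the triangle by [cc_assoc]. Otherwise a ramified
    vertex, if there is one, is rotated into first place, where [cc_via_add] applies. *)
Lemma cc_triangle u v w : cusp u -> cusp v -> cusp w ->
  adj u v -> adj v w -> adj w u -> cc u v + cc v w + cc w u = 0.
Proof.
suff main u' v' w' : cusp u' -> cusp v' -> cusp w' ->
    adj u' v' -> nbr v' w' -> adj w' u' -> cc u' v' + cc v' w' + cc w' u' = 0.
  move=> cu cv cw uv [vw|vw] wu; first exact: main.
  have e : cc u v = cc u w by apply: cc_assoc => //; exact: adjC.
  by rewrite (cc_same_line vw) e addr0 (cc_anti u w) addrN.
move: u' v' w' => {}u {}v {}w cu cv cw uv vw wu.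
case: uv => [uv|uv]; last first.
  have e : cc w u = cc w v.
    apply: esym; apply: cc_assoc => //; [by left|exact: assocC].
  by rewrite (cc_same_line uv) e add0r (cc_anti w v) addNr.
case: wu => [wu|wu]; last first.
  have e : cc v w = cc v u.
    by apply: cc_assoc => //; left; rewrite nbrC.
  by rewrite (cc_same_line wu) e addr0 (cc_anti u v) addrN.
have hu := cusp_null cu; have hv := cusp_null cv; have hw := cusp_null cw.
have tri u' v' w' : cusp u' -> cusp v' -> cusp w' -> ~~ unramified u' ->
    nbr u' v' -> nbr v' w' -> nbr w' u' -> cc u' v' + cc v' w' + cc w' u' = 0.
  move=> cu' cv' cw' X4 h1 h2 h3; rewrite nbrC in h1.
  have hu' := cusp_null cu'; have hv' := cusp_null cv'; have hw' := cusp_null cw'.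
  have [_ Xv] := nbr_ramified hu' X4 h1; have [_ Xw] := nbr_ramified hu' X4 h3.
  rewrite /cc (negbTE X4) Xv Xw -(cc_unram_via hu' hv' hw') //.
  have [b1 b2] := baseP cu'.
  by rewrite cc_via_add // addrN.
have [Xu|X4] := boolP (unramified u); last exact: tri.
have [Xv|X4] := boolP (unramified v); last by rewrite -addrA addrC; apply: tri.
have [Xw|X4] := boolP (unramified w); last by rewrite addrC addrA; apply: tri.
by rewrite /cc Xu Xv Xw; exact: cc_unram_triangle.
Qed.
End Cocycle.

(** * The potential *)

Lemma level0_e1 v : cusp v -> level v = 0%N -> assoc v e1.
Proof.
move=> cv lv; have h3 : v.2 = 0.
  by apply/eqP; rewrite -enorm_eq0; move: lv; rewrite /level; have := enorm_ge0 v.2; lia.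
have [g eg] := cv; have h := stab_e1; have : (act g e1).2 = 0 by rewrite -eg.
move=> /h [x [hx [y [hy [b [j e]]]]]].
apply: assocC; exists x => //; rewrite eg e actM (_ : act (rotU hy) e1 = e1) //.
  by rewrite actM act_tr_e1 act_sc.
by apply: vec_eq; rewrite /dotp /=; ring.
Qed.

Lemma parents : exists par : vec O -> vec O, forall v, cusp v -> (0 < level v)%N ->
  [/\ cusp (par v), nbr v (par v) & (level (par v) < level v)%N].
Proof.
have : forall v, exists w, cusp v -> (0 < level v)%N ->
    [/\ cusp w, nbr v w & (level w < level v)%N].
  move=> v; have [[cv lv]|n] := pselect (cusp v /\ (0 < level v)%N).
    by have [w [? ? ? _]] := chain cv lv; exists w.
  by exists v => cv lv; case: n.
by move=> /choice[par h]; exists par.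
Qed.

Lemma conn_first v n w w0 : conn v n w w0 -> w = w0 \/
  exists w', [/\ adj w w', nbr v w', cusp w' & (level w' < n)%N].
Proof. by case=> [|x w' ? ? ? ? ? _]; [left|right; exists w'; split]. Qed.

Lemma potential : exists F : vec O -> O, forall v w, cusp v -> cusp w -> adj v w ->
  F w - F v = cc v w.
Proof.
have [par hpar] := parents.
(* The potential is summed along the path of chosen parents; the first argument is fuel, and any
   value above the level gives the same result. *)
pose Fn := fix Fn (n : nat) (v : vec O) : O :=
  if n is n'.+1 then (if level v == 0%N then 0 else Fn n' (par v) + cc (par v) v) else 0.
have stable n m v : cusp v -> (level v < n)%N -> (level v < m)%N -> Fn n v = Fn m v.
  elim: n m v => // n IH [//|m] v cv lv lv' /=; case: eqP => // /eqP; rewrite -lt0n => l0.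
  have [cw _ lw] := hpar v cv l0; congr (_ + _); apply: IH => //.
    exact: leq_trans lw _.
  exact: leq_trans lw _.
pose F v := Fn (level v).+1 v.
have F0 v : level v = 0%N -> F v = 0 by rewrite /F /= => ->.
have FS v : cusp v -> (0 < level v)%N -> F v = F (par v) + cc (par v) v.
  move=> cv l0; have [cw _ lw] := hpar v cv l0.
  rewrite {1}/F /= (gtn_eqF l0); congr (_ + _); exact: stable.
move: (F) F0 FS => {stable Fn} {}F F0 FS.
exists F.
suff main n v w : cusp v -> cusp w -> adj v w -> (level v <= n)%N -> (level w <= n)%N ->
    F w - F v = cc v w.
  by move=> v w cv cw vw; apply: (main (maxn (level v) (level w))); rewrite ?leq_maxl ?leq_maxr.
elim/ltn_ind: n v w => n IH v w.
wlog lwv : v w / (level w <= level v)%N.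
  move=> h cv cw vw lv lw; case/orP: (leq_total (level w) (level v)) => l; first exact: h.
  by rewrite -[LHS]opprB (h w v l cw cv (adjC vw) lw lv) -cc_anti.
move=> cv cw vw lv lw.
have low k a b : (k < n)%N -> cusp a -> cusp b -> adj a b -> (level a <= k)%N ->
    (level b <= k)%N -> F b - F a = cc a b by move=> hk ca cb ab la lb; exact: (IH k).
have [l0|l0] := posnP (level v).
  have w0 : level w = 0%N by apply/eqP; rewrite -leqn0 -l0.
  have va := level0_e1 cv l0; have wa := level0_e1 cw w0.
  have a : assoc v w.
    have [x hx ->] := assocC wa; have [y hy ->] := va; exists (x * y).
      by rewrite /is_unit enormM (eqP hx) (eqP hy).
    by rewrite vscaleA.
  by rewrite !F0 // subr0 cc_same_line.
(* All parents of [a] give the same value. *)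
have indep a : cusp a -> (0 < level a)%N -> (level a <= n)%N -> forall b, cusp b -> nbr a b ->
    (level b < level a)%N -> F a = F b + cc b a.
  move=> ca la lan; have [w0 [cw0 nw0 lw0 hw0]] := chain ca la.
  have step b : cusp b -> nbr a b -> (level b < level a)%N -> F b + cc b a = F w0 + cc w0 a.
    move=> cb nb lb; have := hw0 b cb (or_introl nb) (ltnW lb).
    move=> h; elim: h cb nb lb => // {b} b b' b'' bb' nb' cb' lb' _ IHc cb nb lb.
    rewrite -IHc //.
    have hk : ((level a).-1 < n)%N by rewrite prednK.
    have e : F b' - F b = cc b b' by apply: (low (level a).-1) => //; rewrite -ltnS prednK.
    have t := cc_triangle cb cb' ca bb' (or_introl (etrans (nbrC _ _) nb')) (or_introl nb).
    have -> : F b' = F b + cc b b' by rewrite -e addrC subrK.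
    have -> : cc b a = cc b b' + cc b' a.
      by apply/eqP; rewrite eq_sym -subr_eq0 -t (cc_anti b a) .
    by rewrite addrA.
  move=> b cb nb lb; have [cp np lp] := hpar a ca la.
  by rewrite FS // (step _ cp np lp) (step _ cb nb lb).
have vn : (level v <= n)%N := lv.
case: (ltngtP (level w) (level v)) lwv => // [lt|eq] _.
  case: vw => [nb|[x hx ew]]; last by rewrite ew level_scale // ltnn in lt.
  by rewrite (indep v cv l0 vn w) // (cc_anti v w) opprB addrC subrK.
(* At equal levels, the first step of the chain from [w] is a common neighbour of [v] and [w] of
   smaller level, and both potentials are computed from it. *)
have [w0 [_ _ lw0 hw0]] := chain cv l0.
have := conn_first (hw0 w cw vw (eq_leq eq)) => -[ew|[w' [ww' nb' cb' lb']]].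
  by rewrite -ew eq ltnn in lw0.
have nw : nbr w w'.
  by case: ww' => // -[x hx ew]; rewrite ew level_scale // eq ltnn in lb'.
rewrite (indep v cv l0 vn w') // (indep w cw _ lw w') ?eq //.
have t := cc_triangle cb' cv cw (or_introl (etrans (nbrC _ _) nb')) vw (or_introl nw).
rewrite opprD addrACA subrr add0r; apply/eqP; rewrite -subr_eq0 -oppr_eq0 -t (cc_anti w' w).
by apply/eqP; ring.
Qed.

(** * The shift of the potential under the group *)

Section Shift.
Variable F : vec O -> O.
Hypothesis hF : forall v w, cusp v -> cusp w -> adj v w -> F w - F v = cc v w.

Lemma F_cc_via u v w : cusp u -> cusp v -> cusp w -> ~~ unramified u -> nbr v u -> nbr w u ->
  F w - F v = cc_via u v w.
Proof.
move=> cu cv cw hu hv hw; have n0 := cusp_null cu.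
have [b1 b2] := baseP cu.
have [_ Xv] := nbr_ramified n0 hu hv; have [_ Xw] := nbr_ramified n0 hu hw.
have ev : F v - F u = cc_via u (base u) v.
  by rewrite hF //; [rewrite /cc (negbTE hu) Xv|left; rewrite nbrC].
have ew : F w - F u = cc_via u (base u) w.
  by rewrite hF //; [rewrite /cc (negbTE hu) Xw|left; rewrite nbrC].
have e := cc_via_add n0 b2 hv hw; rewrite -ev -ew in e.
by apply: (addrI (F v - F u)); rewrite e; ring.
Qed.

Lemma ramified_e1 : ~~ unramified e1. Proof. by []. Qed.
Lemma nbr_lat_e1 b j : nbr (lat b j) e1.
Proof. by rewrite /nbr herm_e1. Qed.

(** All the [lat b j] are neighbours of the ramified cusp [e1], around which the increment is a
    determinant, here b itself. Hence a translation over b shifts the potential by b. *)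
Lemma F_lat b j : F (lat b j) = F e3 + b.
Proof.
have := F_cc_via cusp_e1 (cusp_lat 0 0) (cusp_lat b j) ramified_e1 (nbr_lat_e1 _ _) (nbr_lat_e1 _ _).
rewrite (_ : lat 0 0 = e3) // /cc_via !herm_e1 /= => /eqP; rewrite subr_eq => /eqP ->.
rewrite (_ : eps e1 = 1); last by apply/eqP; vm_compute.
by rewrite /det3 /= mulr1 rmorph1; ring.
Qed.

(** Restricted to unramified cusps: at a ramified one the value of [F] depends on the choice of
    [base], which the group does not respect. *)
Definition potential_shift (g : U) (t : O) : Prop := forall v, cusp v ->
  unramified (act g v) = unramified v /\ (unramified v -> F (act g v) = F v + t).

Lemma potential_shift1 : potential_shift 1%g 0.
Proof. by move=> v cv; rewrite act1 addr0. Qed.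
Lemma potential_shiftM g h s t : potential_shift g s -> potential_shift h t -> potential_shift (g * h)%g (s + t).
Proof.
move=> hg hh v cv; rewrite actM.
have [h1 h2] := hh v cv; have [g1 g2] := hg _ (cusp_act h cv).
split=> [|Xv]; first by rewrite g1.
by rewrite g2 ?h1 // h2 // (addrC s) addrA.
Qed.
Lemma potential_shiftV g s : potential_shift g s -> potential_shift g^-1%g (- s).
Proof.
move=> hg v cv; have [h1 h2] := hg _ (cusp_act g^-1%g cv); rewrite actVK in h1 h2.
split=> [//|Xv].
by rewrite h2 ?addrK // -h1.
Qed.
Lemma cusp_e3 : cusp e3. Proof. exact: (cusp_lat 0 0). Qed.
Lemma potential_shift_uniq g s t : potential_shift g s -> potential_shift g t -> s = t.
Proof.
move=> h1 h2; have [_ /(_ isT) e1] := h1 _ cusp_e3; have [_ /(_ isT) e2] := h2 _ cusp_e3.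
by apply: (addrI (F e3)); rewrite -e1 -e2.
Qed.

Definition inv_mod3 (g : U) : Prop := inv3 (mred3 (val g)).

Lemma det_unit (g : U) : is_unit (det3 (val g).1.1 (val g).1.2 (val g).2).
Proof.
pose e2 : vec O := (0, 1, 0).
have := det3_mv (val g) (act g^-1%g e1) (act g^-1%g e2) (act g^-1%g e3).
rewrite -!/(act g _) !actVK (_ : det3 e1 e2 e3 = 1); last by rewrite /det3 /=; ring.
by move=> /esym; exact: unit_adjM.
Qed.

Section Inv.
Variable g : U.
Hypothesis hg : inv_mod3 g.

Lemma inv_act v : vred3 (act g v) = mv (mred3 (val g)) (vred3 v).
Proof. exact: vred3_mv. Qed.

Lemma inv_unramified v : cusp v -> unramified v -> unramified (act g v).
Proof.
move=> cv Xv; have /and3P[/allP h _ _] := hg.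
have [y yX ey] := unramified_norm (cusp_null cv) Xv.
rewrite /unramified inv_act ey mv_scale /ramified3 /= enormM (eqP (unramified_unit Xv)) mul1r.
exact: h.
Qed.

Lemma inv_cc_unram v w : cusp v -> cusp w -> unramified v -> unramified w -> nbr v w ->
  cc_unram (act g v) (act g w) = cc_unram v w.
Proof.
move=> cv cw Xv Xw vw; have /and3P[_ h _] := hg.
have [y yX ey] := unramified_norm (cusp_null cv) Xv; have [z zX ez] := unramified_norm (cusp_null cw) Xw.
have uy := unramified_unit Xv; have uz := unramified_unit Xw.
rewrite /cc_unram !inv_act ey ez !mv_scale !coord3_scale //; congr lift3.
have := allP (allP h _ yX) _ zX => /implyP h'; apply/eqP; apply: h'.
move: (nbr_vred3 vw); rewrite ey ez hermZl hermZr /unit3 !enormM enormJ.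
by rewrite (eqP uy) (eqP uz) !mul1r.
Qed.

Lemma cusp_ram_reps u : cusp u -> ~~ unramified u -> vred3 u \in ram_reps.
Proof.
move=> cu h4; have [b1 b2] := baseP cu.
by have [] := nbr_ramified (cusp_null cu) h4 b2.
Qed.

Lemma inv_ramified u : cusp u -> ~~ unramified u -> ~~ unramified (act g u).
Proof.
move=> cu h4; have /and3P[_ _ /allP h] := hg.
by rewrite negbK inv_act; have /andP[] := h _ (cusp_ram_reps cu h4).
Qed.

Lemma inv_cc_via u v w : cusp u -> ~~ unramified u ->
  cc_via (act g u) (act g v) (act g w) = cc_via u v w.
Proof.
move=> cu h4; have /and3P[_ _ /allP h] := hg.
have /andP[_ /eqP e] := h _ (cusp_ram_reps cu h4).
have Y1 := cusp_ram_reps cu h4; have Y2 := cusp_ram_reps (cusp_act g cu) (inv_ramified cu h4).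
rewrite /cc_via !herm_act det3_mv.
have {}e : eps (act g u) * det3 (val g).1.1 (val g).1.2 (val g).2 = eps u.
  apply: unit_eq3; last 1 first.
  - have -> : red3 (eps (act g u) * det3 (val g).1.1 (val g).1.2 (val g).2) =
      red3 (eps (act g u)) * red3 (det3 (val g).1.1 (val g).1.2 (val g).2) by rewrite rmorphM.
    rewrite -vred3_det !red3_lift3 ?(allP check_eps) //.
    by rewrite inv_act.
  - by rewrite /is_unit enormM (eqP (eps_unit Y2)) (eqP (det_unit g)).
  - exact: eps_unit.
rewrite -e; ring.
Qed.

(** The shift is propagated from [e3] by induction on the level. A ramified cusp carries the
    statement about all its neighbours in place of its own value. *)
Lemma inv_shift : potential_shift g (F (act g e3) - F e3).
Proof.
set t := F _ - F _.
have main v : cusp v -> if unramified v then F (act g v) = F v + t else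
    forall w, cusp w -> nbr w v -> F (act g w) = F w + t.
  have [n] := ubnP (level v); elim: n v => // n IH v /ltnSE lv cv.
  have Xfrom u w0 : cusp u -> ~~ unramified u -> cusp w0 -> nbr w0 u -> F (act g w0) = F w0 + t ->
      forall w, cusp w -> nbr w u -> F (act g w) = F w + t.
    move=> cu h4 cw0 n0 e w cw nw.
    have e1 := F_cc_via cu cw0 cw h4 n0 nw.
    have e2 := F_cc_via (cusp_act g cu) (cusp_act g cw0) (cusp_act g cw) (inv_ramified cu h4)
       (etrans (nbr_act _ _ _) n0) (etrans (nbr_act _ _ _) nw).
    rewrite inv_cc_via // -e1 e in e2; apply: (addIr (- (F w0 + t))); rewrite e2; ring.
  have [l0|l0] := posnP (level v).
    have [x hx e] := level0_e1 cv l0.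
    have ve : assoc e1 v by apply: assocC; exists x.
    have [y hy ev] := ve.
    have h4 : ~~ unramified v by rewrite ev unramified_scale.
    rewrite (negbTE h4); apply: (Xfrom _ e3) => //; first exact: cusp_e3.
      by rewrite nbrC ev nbrZl.
    by rewrite /t addrC subrK.
  have [w0 [cw0 nw0 lw0 _]] := chain cv l0.
  have := IH w0 (leq_trans lw0 lv) cw0.
  have [Xv|Xv] := boolP (unramified v); have [Xw|Xw] := boolP (unramified w0) => e.
  - have e1 := hF cw0 cv (or_introl (etrans (nbrC _ _) nw0)).
    have e2 := hF (cusp_act g cw0) (cusp_act g cv)
      (or_introl (etrans (nbr_act _ _ _) (etrans (nbrC _ _) nw0))).
    move: e1 e2; rewrite /cc Xv Xw !inv_unramified // inv_cc_unram //; last by rewrite nbrC.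
    by move=> <- /eqP; rewrite e subr_eq => /eqP ->; ring.
  - exact: e.
  - by apply: (Xfrom _ w0) => //; rewrite nbrC.
  - have [_] := nbr_ramified (cusp_null cw0) Xw nw0.
    by rewrite (negbTE Xv).
move=> v cv; split.
  have [Xv|Xv] := boolP (unramified v); first exact: inv_unramified.
  by apply/negbTE; exact: inv_ramified.
by move=> Xv; have := main v cv; rewrite Xv.
Qed.
End Inv.
End Shift.

(** * Finite generation of the kernel *)

(** This and the next two are complex reflections of order 3: each differs from the identity by a
    matrix of rank one and has eigenvalue omega. The inverse of their product is, up to a scalar,
    the vertical translation [tr 0 1]. *)
Definition refl_a : U := @mkU
  ((Eis 2 2, Eis 0 0, Eis (-1) 1), (Eis 0 0, Eis 1 0, Eis 0 0),
   (Eis (-1) 1, Eis 0 0, Eis (-1) (-1))) erefl.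
Definition refl_b : U := @mkU
  ((Eis 1 0, Eis 0 0, Eis 0 0), (Eis (-1) 1, Eis 0 1, Eis 0 0),
   (Eis (-1) 1, Eis (-1) 1, Eis 1 0)) erefl.
Definition refl_c : U := @mkU
  ((Eis 1 0, Eis 0 0, Eis 0 0), (Eis (-2) (-1), Eis 0 1, Eis 0 0),
   (Eis (-1) 1, Eis 1 2, Eis 1 0)) erefl.
Definition transl1 : U := tr 1 0.
Definition rot_gen : U := @rotU (Eis 0 (-1)) erefl.
Definition scal_gen : U := @scU (Eis 0 (-1)) erefl.

Local Open Scope group_scope.

Section Gen.
Variable G : groupType.
Implicit Types (S K : G -> Prop).
Inductive gen S : G -> Prop :=
| gen_in x : S x -> gen S x
| gen_one : gen S 1
| gen_mul x y : gen S x -> gen S y -> gen S (x * y)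
| gen_inv x : gen S x -> gen S x^-1.
Lemma gen_exp S x n : gen S x -> gen S (x ^+ n).
Proof.
move=> h; elim: n => [|n IH]; first by rewrite expg0; exact: gen_one.
by rewrite expgS; exact: gen_mul.
Qed.
Lemma gen_sub S K : (forall x, S x -> gen K x) -> forall x, gen S x -> gen K x.
Proof.
move=> h x; elim=> {x} [x /h//| |x y _ h1 _ h2|x _ h1].
- exact: gen_one.
- exact: gen_mul.
- exact: gen_inv.
Qed.
Lemma gen_norm S q : (forall x, S x -> gen S (q * x * q^-1)) ->
  forall n, gen S n -> gen S (q * n * q^-1).
Proof.
move=> h n; elim=> {n} [x /h//| |x y _ hx _ hy|x _ hx].
- by rewrite mulg1 mulgV; exact: gen_one.
- rewrite (_ : q * (x * y) * q^-1 = (q * x * q^-1) * (q * y * q^-1)); first exact: gen_mul.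
  by rewrite !mulgA mulgVK.
- rewrite (_ : q * x^-1 * q^-1 = (q * x * q^-1)^-1); first exact: gen_inv.
  by rewrite !invgM invgK mulgA.
Qed.
Lemma conjM (g h n : G) : g * h * n * (g * h)^-1 = g * (h * n * h^-1) * g^-1.
Proof. by rewrite invgM !mulgA. Qed.
Lemma invgM3 (g h n : G) : (g * h * n)^-1 = n^-1 * h^-1 * g^-1.
Proof. by rewrite !invgM mulgA. Qed.
Lemma split_coset (n g c : G) : g = n * (n^-1 * g * c^-1) * c.
Proof. by rewrite mulgA mulVKg mulgVK. Qed.
Lemma push_coset (n p c n' p' c' s : G) : c * s = n' * p' * c' ->
  n * p * c * s = n * (p * n' * p^-1) * (p * p') * c'.
Proof. by move=> e; rewrite -mulgA e !mulgA mulgVK. Qed.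
End Gen.

Ltac Ueq := apply: val_inj; apply/eqP; vm_compute; reflexivity.

Definition is_refl (g : U) : Prop := [\/ g = refl_a, g = refl_b | g = refl_c].
Notation N0 := (gen is_refl).
Lemma N0_refl_a : N0 refl_a. Proof. by apply: gen_in; constructor 1. Qed.
Lemma N0_refl_b : N0 refl_b. Proof. by apply: gen_in; constructor 2. Qed.
Lemma N0_refl_c : N0 refl_c. Proof. by apply: gen_in; constructor 3. Qed.
Ltac genN := repeat match goal with
  | |- gen _ (_ * _) => apply: gen_mul
  | |- gen _ (_^-1) => apply: gen_inv
  | |- gen _ 1 => exact: gen_one
  | |- gen _ refl_a => exact N0_refl_a
  | |- gen _ refl_b => exact N0_refl_b
  | |- gen _ refl_c => exact N0_refl_c
  end.

Lemma sc_comm x (hx : is_unit x) g : scU hx * g = g * scU hx.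
Proof.
apply: val_inj; case: g => -[[[[a1 a2] a3] [[b1 b2] b3]] [[c1 c2] c3]] hg.
by congr (_, _, _); apply: vec_eq; rewrite /=; ring.
Qed.

Lemma unit_pow x : is_unit x -> exists n, x = (Eis 0 (-1) ^+ n)%R.
Proof.
move=> /unitsP; rewrite !inE => /or4P[|||/or3P[||]] /eqP ->.
- by exists 0%N. - by exists 4%N. - by exists 2%N.
- by exists 3%N. - by exists 1%N. - by exists 5%N.
Qed.

Lemma rot_pow x (hx : is_unit x) : exists n, rotU hx = rot_gen ^+ n.
Proof.
have [n e] := unit_pow hx; exists n; subst x; elim: n hx => [|n IH] hx.
  by rewrite expg0; apply: val_inj; rewrite /= expr0.
have hn : is_unit (Eis 0 (-1) ^+ n)%R.
  by move: hx; rewrite /is_unit exprS enormM (_ : enorm _ = 1%R) ?mul1r.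
rewrite expgS -(IH hn); apply: val_inj; rewrite /= exprS.
by congr (_, _, _); apply: vec_eq; rewrite /=; ring.
Qed.

Lemma sc_pow x (hx : is_unit x) : exists n, scU hx = scal_gen ^+ n.
Proof.
have [n e] := unit_pow hx; exists n; subst x; elim: n hx => [|n IH] hx.
  by rewrite expg0; apply: val_inj; rewrite /= expr0.
have hn : is_unit (Eis 0 (-1) ^+ n)%R.
  by move: hx; rewrite /is_unit exprS enormM (_ : enorm _ = 1%R) ?mul1r.
rewrite expgS -(IH hn); apply: val_inj; rewrite /= exprS.
by congr (_, _, _); apply: vec_eq; rewrite /=; ring.
Qed.

Lemma tr_mul b j b' j' : exists j'', tr b j * tr b' j' = tr (b + b') j''.
Proof.
have [j'' [e _]] := act_tr_lat b j b' j'; exists j''.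
apply: val_inj.
have h : (Eis j' (height b' j') - econj b * b' + Eis j (height b j) = Eis j'' (height (b + b') j''))%R.
  have : (act (tr b j) (lat b' j')).1.1 = Eis j'' (height (b + b') j'') by rewrite e.
  by move=> <-; rewrite /act /mv /dotp /=; ring.
by congr (_, _, _); apply: vec_eq; rewrite /= ?rmorphD -?h; ring.
Qed.

Lemma tr_conj_rot x (hx : is_unit x) b j : exists j',
  rotU hx * tr b j * (rotU hx)^-1 = tr (x * b)%R j'.
Proof.
exists j; apply: val_inj; have e := mul_unitJ hx.
have hn : height (x * b)%R j = height b j by rewrite /height enormM (eqP hx) mul1r.
congr (_, _, _); apply: vec_eq; rewrite /= ?hn ?rmorphM ?rmorph0 ?rmorph1 /=; try ring.
by rewrite -[RHS]e; ring.
Qed.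

Lemma tr0_add j k : tr 0 j * tr 0 k = tr 0 (j + k)%R.
Proof.
apply: val_inj; congr (_, _, _); apply: vec_eq; rewrite /= ?rmorph0; try ring.
by apply: eis_eq; rewrite /= /height /enorm /=; ring.
Qed.

(** Made for predicates closed under products only, such as preserving factorizations under right
    multiplication. The unit -w has order 6, so scalars and rotations bring their inverses along,
    and only [transl1] comes with its own. *)
Lemma parabolic_gen (K : U -> Prop) : (forall g h, K g -> K h -> K (g * h)) ->
  (forall x (hx : is_unit x), K (scU hx)) -> K rot_gen -> K transl1 -> K transl1^-1 ->
  forall p, (act p e1).2 = 0%R -> K p.
Proof.
move=> KM Ks Kr K1 K1V.
have Krot x (hx : is_unit x) : K (rotU hx).
  have [n ->] := rot_pow hx; elim: n => [|n IH]; last by rewrite expgS; exact: (KM).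
  have e : is_unit (1%R : O) by [].
  by rewrite expg0 (_ : 1 = scU e) //; apply: val_inj.
have KrotV x (hx : is_unit x) : K (rotU hx)^-1.
  by rewrite (_ : (rotU hx)^-1 = rotU (unitV hx)) //; apply: val_inj; rewrite /= /adjm /= !rmorph0 !rmorph1.
(* The conjugates of [transl1] by rotations are translations over w and w^2; as 1 + w + w^2 = 0, the
   product of the three is vertical. *)
have KT : K (tr 0 1).
  have -> : tr 0 1 = transl1 * (rot_gen * rot_gen * rot_gen * rot_gen * transl1 * rot_gen * rot_gen) * (rot_gen * rot_gen * transl1 * rot_gen * rot_gen * rot_gen * rot_gen) by Ueq.
  by repeat first [assumption | apply KM].
have KTV : K (tr 0 (-1)%R).
  have -> : tr 0 (-1)%R = (rot_gen * rot_gen * transl1^-1 * rot_gen * rot_gen * rot_gen * rot_gen) * (rot_gen * rot_gen * rot_gen * rot_gen * transl1^-1 * rot_gen * rot_gen) * transl1^-1 by Ueq.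
  by repeat first [assumption | apply KM].
have K0 j : K (tr 0 j).
  have K00 : K (tr 0 0).
    have -> : tr 0 0 = transl1 * transl1^-1 by rewrite mulgV; Ueq.
    exact: (KM _ _ K1 K1V).
  case: j => n.
    elim: n => // n IH; rewrite -addn1 PoszD -tr0_add; exact: (KM _ _ IH KT).
  rewrite NegzE; elim: n => // n IH.
  by rewrite -addn1 PoszD opprD -tr0_add; exact: (KM _ _ IH KTV).
have Kany b j j' : K (tr b j) -> K (tr b j').
  move=> h; have -> : tr b j' = tr 0 (j' - j)%R * tr b j; last exact: (KM).
  apply: val_inj; congr (_, _, _); apply: vec_eq; rewrite /= ?rmorph0; try ring.
  by apply: eis_eq; rewrite /= /height /enorm /=; ring.
have KD b b' : (forall j, K (tr b j)) -> (forall j, K (tr b' j)) -> forall j, K (tr (b + b') j).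
  move=> h h' j; have [j'' e] := tr_mul b 0%R b' 0%R.
  by apply: (Kany _ j''); rewrite -e; exact: (KM).
have Ku x : is_unit x -> forall j, K (tr x j).
  move=> hx j; have [j' e] := tr_conj_rot hx 1%R 0%R; rewrite mulr1 in e.
  by apply: (Kany _ j'); rewrite -e; apply: (KM) => //; exact: (KM).
have Kmul x n : is_unit x -> forall j, K (tr (x *~ n) j).
  move=> hx; case: n => n.
    elim: n => [|n IH]; first exact: K0.
    by rewrite -pmulrn mulrS; apply: (KD) => //; exact: Ku.
  have hx' : is_unit (- x)%R by rewrite /is_unit enormN.
  rewrite NegzE mulrNz -mulNrz; elim: n.+1 => [|{}n IH]; first exact: K0.
  by rewrite -pmulrn mulrS; apply: (KD) => //; exact: Ku.
move=> p /stab_e1[x [hx [y [hy [b [j ->]]]]]].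
apply: (KM) => //; apply: (KM) => //.
have ofz (z : O) n : (z *~ n = Eis (ere z * n) (eom z * n))%R.
  have ofn k : (z *+ k = Eis (ere z * k) (eom z * k))%R.
    elim: k => [|k IH]; first by apply: eis_eq; rewrite /= mulr0.
    by rewrite mulrS IH; apply: eis_eq; rewrite /= -addn1 PoszD; ring.
  case: n => n; first exact: ofn.
  by rewrite NegzE mulrNz -pmulrn ofn; apply: eis_eq; rewrite /= mulrN.
have -> : b = (1 *~ ere b + omega *~ eom b)%R.
  by rewrite !ofz; apply: eis_eq; rewrite /= !mul1r !mul0r ?addr0 ?add0r.
by apply: (KD) => j'; exact: Kmul.
Qed.

Lemma translation_gen (K : U -> Prop) : (forall g h, K g -> K h -> K (g * h)) ->
  (forall g, K g -> K g^-1) -> K 1 -> K transl1 -> K (tr 0 1) ->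
  forall (m : int) j, K (tr (Eis m 0) j).
Proof.
move=> KM KV K1 Kt KT.
have K0 j : K (tr 0 j).
  have e0 : tr 0 0 = 1 by Ueq.
  have pos n : K (tr 0 (n : nat)).
    elim: n => [|n IH]; first by rewrite e0.
    by rewrite -addn1 PoszD -tr0_add; exact: (KM).
  case: j => n //; rewrite NegzE.
  have -> : tr 0 (- n.+1%:Z)%R = (tr 0 n.+1)^-1; last exact: (KV).
  by apply: (mulIg (tr 0 n.+1)); rewrite mulVg tr0_add addNr e0.
have Kany b j j' : K (tr b j) -> K (tr b j').
  move=> h; have -> : tr b j' = tr 0 (j' - j)%R * tr b j; last exact: (KM).
  apply: val_inj; congr (_, _, _); apply: vec_eq; rewrite /= ?rmorph0; try ring.
  by apply: eis_eq; rewrite /= /height /enorm /=; ring.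
have pos (n : nat) j : K (tr (Eis n%:Z 0) j).
  elim: n j => [|n IH] j; first exact: K0.
  have [j'' e] := tr_mul (Eis n%:Z 0) 0 1%R 0.
  have -> : Eis n.+1%:Z 0 = (Eis n%:Z 0 + 1)%R.
    by apply: eis_eq; [rewrite /= -addn1 PoszD|rewrite /= addr0].
  by apply: (Kany _ j''); rewrite -e; exact: (KM).
move=> [n|n] j; first exact: pos.
have [j'' e] := tr_mul (Eis n.+1%:Z 0) 0 (Eis (Negz n) 0) j.
have z : (Eis n.+1%:Z 0 + Eis (Negz n) 0 = 0)%R.
  by apply: eis_eq; rewrite /= ?addr0 // NegzE subrr.
rewrite z in e.
have -> : tr (Eis (Negz n) 0) j = (tr (Eis n.+1%:Z 0) 0)^-1 * tr 0 j''.
  by rewrite -e mulKg.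
by apply: (KM) => //; apply: (KV).
Qed.

Notation parab p := ((act p e1).2 = 0%R).

Lemma parabE p : parab p -> exists2 x, is_unit x & act p e1 = vscale x e1.
Proof.
move=> /stab_e1[x [hx [y [hy [b [j ->]]]]]]; exists x => //.
rewrite actM (_ : act (rotU hy) e1 = e1); last first.
  by apply: vec_eq; rewrite /dotp /=; ring.
by rewrite actM act_tr_e1 act_sc.
Qed.
Lemma vscale2 (x : O) v : (vscale x v).2 = (x * v.2)%R. Proof. by []. Qed.
Lemma parabM p q : parab p -> parab q -> parab (p * q).
Proof.
move=> hp /parabE[x hx e]; by rewrite actM e act_scale vscale2 hp mulr0.
Qed.

(** For each generator of the stabilizer, the conjugates of the three reflections are explicit words
    in them, verified by computation. *)
Lemma N0_norm p n : parab p -> N0 n -> N0 (p * n * p^-1).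
Proof.
move=> hp; pose K p := forall n, N0 n -> N0 (p * n * p^-1).
suff: K p by apply.
clear n; have Kgen q : N0 (q * refl_a * q^-1) -> N0 (q * refl_b * q^-1) -> N0 (q * refl_c * q^-1) -> K q.
  by move=> h1 h2 h3; apply: gen_norm => x [->|->|->]; [exact: h1|exact: h2|exact: h3].
move: p hp; apply: parabolic_gen.
- by move=> g h hg hh n hn; rewrite conjM; apply: hg; apply: hh.
- by move=> x hx n hn; rewrite sc_comm mulgK.
- apply: Kgen.
  + have -> : rot_gen * refl_a * rot_gen^-1 = refl_a by Ueq.
    genN.
  + have -> : rot_gen * refl_b * rot_gen^-1 = refl_b * refl_c * refl_b^-1 by Ueq.
    genN.
  + have -> : rot_gen * refl_c * rot_gen^-1 = refl_b by Ueq.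
    genN.
- apply: Kgen.
  + have -> : transl1 * refl_a * transl1^-1 = refl_b by Ueq.
    genN.
  + have -> : transl1 * refl_b * transl1^-1 = refl_b^-1 * refl_a * refl_b * refl_c * refl_b^-1 * refl_a^-1 * refl_b by Ueq.
    genN.
  + have -> : transl1 * refl_c * transl1^-1 = refl_b^-1 * refl_a * refl_b by Ueq.
    genN.
- apply: Kgen; rewrite ?invgK.
  + have -> : transl1^-1 * refl_a * transl1 = refl_a * refl_c * refl_a^-1 by Ueq.
    genN.
  + have -> : transl1^-1 * refl_b * transl1 = refl_a by Ueq.
    genN.
  + have -> : transl1^-1 * refl_c * transl1 = refl_c^-1 * refl_b * refl_c by Ueq.
    genN.
Qed.

Definition cosets : seq U := [:: 1; swap; swap * transl1; swap * transl1^-1].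

Definition factored (g : U) : Prop := exists n p c,
  [/\ N0 n, parab p, c \in cosets & g = n * p * c].

Lemma factored_intro n c g : N0 n -> c \in cosets -> parab (n^-1 * g * c^-1) -> factored g.
Proof.
move=> hn hc hp; exists n, (n^-1 * g * c^-1), c; split=> //.
exact: split_coset.
Qed.

(** Because parabolics normalize [N0], the factors of c s can be absorbed into those of g; so right
    multiplication by s amounts to one column of a coset table with four rows. *)
Lemma factored_mul g s : factored g -> (forall c, c \in cosets -> factored (c * s)) -> factored (g * s).
Proof.
move=> [n [p [c [hn hp hc ->]]]] /(_ c hc) [n' [p' [c' [hn' hp' hc' e]]]].
exists (n * (p * n' * p^-1)), (p * p'), c'; split=> //.
- by apply: gen_mul => //; exact: N0_norm.
- exact: parabM.
exact: push_coset.
Qed.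

Ltac factored_tac n c := apply: (@factored_intro n c); [genN | by rewrite !inE eqxx ?orbT | vm_compute; reflexivity].

Lemma factored_swap g : factored g -> factored (g * swap).
Proof.
move=> h; apply: factored_mul => // c; rewrite !inE => /or4P[] /eqP ->.
- factored_tac (1 : U) swap.
- factored_tac (1 : U) (1 : U).
- factored_tac (refl_b^-1) (swap * transl1^-1).
- factored_tac (refl_c^-1 * refl_b^-1 * refl_c * refl_a^-1) (swap * transl1).
Qed.

Lemma factored_parab g p : parab p -> factored g -> factored (g * p).
Proof.
move=> hp; pose K p := forall g, factored g -> factored (g * p).
suff: K p by apply.
move: p hp; apply: parabolic_gen.
- by move=> p q hp hq g0 /hp/hq; rewrite mulgA.
- move=> x hx g0 [n [p [c [hn hp hc ->]]]].
  exists n, (scU hx * p), c; split=> //; last by rewrite -sc_comm !mulgA sc_comm.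
  by rewrite actM act_sc vscale2 hp mulr0.
- move=> g0 h; apply: factored_mul => // c; rewrite !inE => /or4P[] /eqP ->.
  + factored_tac (1 : U) (1 : U).
  + factored_tac (1 : U) swap.
  + factored_tac (refl_b * refl_a^-1) (swap * transl1^-1).
  + factored_tac (refl_c^-1 * refl_b * refl_a^-1) (swap * transl1).
- move=> g0 h; apply: factored_mul => // c; rewrite !inE => /or4P[] /eqP ->.
  + factored_tac (1 : U) (1 : U).
  + factored_tac (1 : U) (swap * transl1).
  + factored_tac (refl_b^-1 * refl_c^-1 * refl_a^-1) (swap * transl1^-1).
  + factored_tac (1 : U) swap.
- move=> g0 h; apply: factored_mul => // c; rewrite !inE => /or4P[] /eqP ->.
  + factored_tac (1 : U) (1 : U).
  + factored_tac (1 : U) (swap * transl1^-1).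
  + factored_tac (1 : U) swap.
  + factored_tac (refl_c^-1 * refl_b^-1 * refl_c * refl_b) (swap * transl1).
Qed.

Lemma factored_all g : factored g.
Proof.
(* [U_ind] builds elements from the left while factorizations are extended on the right, hence the
   induction on the inverse. *)
rewrite -(invgK g); elim/U_ind: g^-1 => {}g.
  move=> hg; apply: (@factored_intro 1 1); [exact: gen_one|by rewrite !inE eqxx|].
  have [x hx e] := parabE hg.
  rewrite invg1 mulg1 mul1g -herm_e1 act_adj invgK e hermZr herm_e1 mulr0 //.
move=> j h IH; rewrite invgM3; apply: factored_parab.
  have e : act (tr g j) e1 = e1 by exact: act_tr_e1.
  by rewrite -{1}e actK.
have -> : swap^-1 = swap by Ueq.
exact: factored_swap.
Qed.

Notation gens s := (gen (fun x => is_true (x \in s))).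

Section Schreier.
Variables (G : groupType) (T : eqType) (k : G -> T) (l : seq T) (S : seq G).
Hypothesis kl : forall x, k x \in l.
Hypothesis kM : forall x y s, k x = k y -> k (x * s) = k (y * s).

Lemma schreier : exists Y : seq G, forall x,
  (gens S x /\ k x = k 1) <-> gens Y x.
Proof.
have /choice[r hr] : forall t, exists r, gens S r /\
    forall x, gens S x -> k x = t -> k r = t.
  move=> t.
  have [[x [hx e]]|n] := pselect (exists x, gens S x /\ k x = t); first by exists x.
  exists 1; split=> [|x hx e]; first exact: gen_one.
  by case: n; exists x.
have rK x : gens S x -> k (r (k x)) = k x by move=> hx; exact: (hr (k x)).2 x hx erefl.
pose S' := S ++ [seq x^-1 | x <- S].
(* The representative [r (k 1)] of the trivial coset need not be 1, so it joins the Schreier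
   generators. Inverses are put into [S'] to treat words letter by letter. *)
pose Y := r (k 1) :: [seq r t * s * (r (k (r t * s)))^-1 | t <- l, s <- S'].
exists Y.
have kV x : k x = k 1 -> k x^-1 = k 1.
  by move=> /(kM (x^-1)); rewrite mulgV mul1g => ->.
have hS' s : s \in S' -> gens S s.
  rewrite mem_cat => /orP[|/mapP[y hy ->]]; first exact: gen_in.
  by apply: gen_inv; exact: gen_in.
have hY y : y \in Y -> gens S y /\ k y = k 1.
  rewrite inE => /orP[/eqP ->|/allpairsP[[t s] /= [_ hs ->]]].
    by split; [exact: (hr _).1|apply: rK; exact: gen_one].
  have g1 : gens S (r t * s) by apply: gen_mul; [exact: (hr _).1|exact: hS'].
  split; first by apply: gen_mul => //; apply: gen_inv; exact: (hr _).1.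
  by rewrite -(kM _ (rK _ g1)) mulgV.
have key g : gens S g -> gens S g /\ (forall x, gens S x ->
    (gens Y (x * (r (k x))^-1) -> gens Y (x * g * (r (k (x * g)))^-1)) /\
    (gens Y (x * (r (k x))^-1) -> gens Y (x * g^-1 * (r (k (x * g^-1)))^-1))).
  have step s x : s \in S' -> gens S x ->
      gens Y (x * (r (k x))^-1) -> gens Y (x * s * (r (k (x * s)))^-1).
    move=> hs hx h; rewrite (kM s (esym (rK x hx))).
    have -> : x * s * (r (k (r (k x) * s)))^-1 =
        x * (r (k x))^-1 * (r (k x) * s * (r (k (r (k x) * s)))^-1).
      by rewrite !mulgA mulgVK.
    apply: gen_mul => //; apply: gen_in; rewrite inE; apply/orP; right.
    by apply: (allpairs_f (fun t s => r t * s * (r (k (r t * s)))^-1)).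
  elim=> {g} [s hs| |g h hg [_ IHg] hh [_ IHh]|g hg [_ IHg]].
  - split=> [|x hx]; first exact: gen_in.
    split; apply: step => //; rewrite mem_cat ?hs //; apply/orP; right.
    exact: map_f.
  - split=> [|x hx]; first exact: gen_one.
    by rewrite invg1 mulg1.
  - split=> [|x hx]; first exact: gen_mul.
    have hxg : gens S (x * g) by exact: gen_mul.
    have hxh : gens S (x * h^-1) by apply: gen_mul => //; exact: gen_inv.
    split=> h0.
      by rewrite mulgA; apply: (IHh _ hxg).1; apply: (IHg _ hx).1.
    by rewrite invgM mulgA; apply: (IHg _ hxh).2; apply: (IHh _ hx).2.
  - split=> [|x hx]; first exact: gen_inv.
    by rewrite invgK; split; [exact: (IHg x hx).2|exact: (IHg x hx).1].
move=> x; split=> [[hx e]|].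
  have [_ /(_ 1 (gen_one _))[h _]] := key x hx.
  move: h; rewrite !mul1g e => h.
  have r1Y : gens Y (r (k 1)) by apply: gen_in; rewrite inE eqxx.
  by rewrite -(mulgVK (r (k 1)) x); apply: gen_mul => //; apply: h; exact: gen_inv.
elim=> {x} [y /hY//| |x y _ [hx ex] _ [hy ey]|x _ [hx ex]].
- by split=> //; exact: gen_one.
- by split; [exact: gen_mul|rewrite (kM y ex) mul1g].
- by split; [exact: gen_inv|exact: kV].
Qed.
End Schreier.

(** * The congruence subgroup of level 3 and the kernel *)

Definition Gamma3 (g : U) : Prop := mred3 (val g) = I3 _.

Lemma mred3_mm a b : mred3 (mm a b) = mm (mred3 a) (mred3 b).
Proof.
by congr (_, _, _); apply: vec_eq; rewrite /= !rmorphD !rmorphM.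
Qed.

Definition V3s : seq (vec O3) := [seq (ab, c) | ab <- [seq (a, b) | a <- E3s, b <- E3s], c <- E3s].
(** A list of 9^9 matrices that is never evaluated; it only expresses that there are finitely many
    residues. *)
Definition M3s : seq (mat O3) := [seq (ab, c) | ab <- [seq (a, b) | a <- V3s, b <- V3s], c <- V3s].
Lemma mem_V3s v : v \in V3s.
Proof.
case: v => [[a b] c]; apply: (allpairs_f (fun (ab : O3 * O3) (c : O3) => (ab, c))); last exact: mem_E3s.
by apply: (allpairs_f (fun a b : O3 => (a, b))); exact: mem_E3s.
Qed.
Lemma mem_M3s v : v \in M3s.
Proof.
case: v => [[a b] c]; apply: (allpairs_f (fun (ab : vec O3 * vec O3) (c : vec O3) => (ab, c))); last exact: mem_V3s.
by apply: (allpairs_f (fun a b : vec O3 => (a, b))); exact: mem_V3s.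
Qed.

Lemma U_schreier (S : seq U) : exists Y : seq U, forall x,
  (gens S x /\ Gamma3 x) <-> gens Y x.
Proof.
have := @schreier U (mat O3) (fun g => mred3 (val g)) M3s S (fun _ => mem_M3s _).
case=> [x y s e|Y hY]; first by rewrite /= !mred3_mm e.
have e1 : mred3 (val (1 : U)) = I3 _ by apply/eqP; vm_compute.
by exists Y => x; rewrite -hY e1.
Qed.

Lemma inv_refl_a : inv_mod3 refl_a. Proof. by rewrite /inv_mod3; vm_compute. Qed.
Lemma inv_refl_b : inv_mod3 refl_b. Proof. by rewrite /inv_mod3; vm_compute. Qed.
Lemma inv_refl_c : inv_mod3 refl_c. Proof. by rewrite /inv_mod3; vm_compute. Qed.
Lemma inv_transl1 : inv_mod3 transl1. Proof. by rewrite /inv_mod3; vm_compute. Qed.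
Lemma inv_scal_gen : inv_mod3 scal_gen. Proof. by rewrite /inv_mod3; vm_compute. Qed.
Lemma inv_Gamma3 g : Gamma3 g -> inv_mod3 g.
Proof. by rewrite /inv_mod3 => ->; vm_compute. Qed.

(** Adding [transl1], which shifts the potential by 1, and the scalars to the reflections stays
    among the elements whose shift has omega-coordinate 0; [kernel_N1] is the converse inside
    [Gamma3]. *)
Definition N1s : seq U := [:: refl_a; refl_b; refl_c; transl1; scal_gen].

Section Kernel.
Variable F : vec O -> O.
Hypothesis hF : forall v w, cusp v -> cusp w -> adj v w -> (F w - F v = cc v w)%R.

(** Associated cusps have the same potential, so fixing one unramified line forces the constant to
    be 0. *)
Lemma shift_fix g v : inv_mod3 g -> cusp v -> unramified v -> assoc v (act g v) -> potential_shift F g 0.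
Proof.
move=> hg cv Xv a; have h := inv_shift hF hg; set t := (X in potential_shift F g X) in h *.
have [_ /(_ Xv) e] := h v cv.
have e' := hF cv (cusp_act g cv) (or_intror a); rewrite cc_same_line // in e'.
have -> : 0%R = t; last exact: h.
move/eqP: e'; rewrite subr_eq0 => /eqP e'.
by apply: (addrI (F v)); rewrite -e addr0 e'.
Qed.

Lemma shift_refl_a : potential_shift F refl_a 0.
Proof.
apply: (shift_fix inv_refl_a (cusp_lat 1%R (-1)%R)); first by vm_compute.
by exists 1%R => //; apply/eqP; vm_compute.
Qed.
Lemma shift_refl_b : potential_shift F refl_b 0.
Proof.
apply: (shift_fix inv_refl_b (cusp_lat (Eis 0 (-1)) 0%R)); first by vm_compute.
by exists 1%R => //; apply/eqP; vm_compute.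
Qed.
Lemma shift_refl_c : potential_shift F refl_c 0.
Proof.
apply: (shift_fix inv_refl_c (cusp_lat 1%R 0%R)); first by vm_compute.
by exists 1%R => //; apply/eqP; vm_compute.
Qed.
Lemma shift_scal_gen : potential_shift F scal_gen 0.
Proof.
apply: (shift_fix inv_scal_gen cusp_e3); first by [].
by exists (Eis 0 (-1)) => //; rewrite act_sc.
Qed.
Lemma shift_transl1 : potential_shift F transl1 1%R.
Proof.
have := inv_shift hF inv_transl1; rewrite act_tr_e3 (F_lat hF).
by rewrite addrC addKr.
Qed.

Lemma shift_N0 n : N0 n -> potential_shift F n 0.
Proof.
elim=> {n} [x [->|->|->]| |x y _ hx _ hy|x _ hx].
- exact: shift_refl_a. - exact: shift_refl_b. - exact: shift_refl_c.
- exact: potential_shift1.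
- by rewrite -(addr0 0%R); exact: potential_shiftM.
- by rewrite -oppr0; exact: potential_shiftV.
Qed.

Lemma shift_N1 n : gens N1s n -> exists2 t, eom t = 0%R & potential_shift F n t.
Proof.
elim=> {n} [x| |x y _ [s hs hx] _ [t ht hy]|x _ [s hs hx]].
- rewrite !inE => /or4P[/eqP ->|/eqP ->|/eqP ->|/orP[]/eqP ->].
  + by exists 0%R => //; exact: shift_refl_a.
  + by exists 0%R => //; exact: shift_refl_b.
  + by exists 0%R => //; exact: shift_refl_c.
  + by exists 1%R => //; exact: shift_transl1.
  + by exists 0%R => //; exact: shift_scal_gen.
- by exists 0%R => //; exact: potential_shift1.
- by exists (s + t)%R; [rewrite eomD hs ht addr0|exact: potential_shiftM].
- by exists (- s)%R; [rewrite eomN hs oppr0|exact: potential_shiftV].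
Qed.

Lemma F_scale x v : is_unit x -> cusp v -> F (vscale x v) = F v.
Proof.
move=> hx cv; have a : assoc v (vscale x v) by exists x.
have := hF cv (cusp_scale hx cv) (or_intror a); rewrite cc_same_line // => e.
by rewrite -(subrK (F v) (F _)) e add0r.
Qed.

Lemma sc_N1 x (hx : is_unit x) : gens N1s (scU hx).
Proof. by have [n ->] := sc_pow hx; apply: gen_exp; apply: gen_in; rewrite !inE eqxx ?orbT. Qed.

Lemma N0_N1 n : N0 n -> gens N1s n.
Proof.
by apply: gen_sub => x [] ->; apply: gen_in; rewrite !inE eqxx ?orbT.
Qed.

Lemma tr01_N1 : gens N1s (tr 0 1).
Proof.
have h : is_unit (Eis (-1) (-1) : O) by [].
have -> : tr 0 1 = (refl_a * refl_b * refl_c)^-1 * scU h by Ueq.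
apply: gen_mul; last exact: sc_N1.
by apply: N0_N1; genN.
Qed.

(** In g = n p c the factor n does not shift the potential, so the shift t is that of the parabolic
    p, read off on the cusps [lat b' 0]: its translation part is t and its rotation trivial. As t is
    in Z, p is a word in [transl1], vertical translations and scalars. *)
Lemma kernel_N1 g t : Gamma3 g -> potential_shift F g t -> eom t = 0%R -> gens N1s g.
Proof.
move=> g3 hg ht; have [n [p [c [hn hp hc eg]]]] := factored_all g.
have hsn := shift_N0 hn.
have [x hx ex] := parabE hp.
have p2 v : unramified (act p v) = unramified v.
  have pV : act p^-1 e1 = vscale (econj x) e1.
    by rewrite -{1}(vscale1 e1) -(mul_unitJ hx) mulrC -vscaleA act_scale -ex actK.
  have e : (act p v).2 = (x * v.2)%R.
    by rewrite -!herm_e1 act_adj pV hermZr econjK.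
  rewrite /unramified /ramified3.
  have r2E w : (vred3 w).2 = red3 w.2 by [].
  by rewrite !r2E e rmorphM enormM (eqP (unit3_red hx)) mul1r.
(* The three other representatives send [e1] to the unramified cusp [e3], whereas g, n and p all
   preserve ramification. *)
have c1 : c = 1.
  have : ~~ unramified (act g e1) by have [-> _] := hg _ cusp_e1.
  rewrite eg !actM; have [-> _] := hsn _ (cusp_act p (cusp_act c cusp_e1)).
  rewrite p2; move: hc; rewrite !inE => /or4P[] /eqP -> //.
rewrite {}c1 mulg1 in eg; have [x' [hx' [y [hy [b [j ep]]]]]] := stab_e1 hp.
have Fg (b' : O) : (F e3 + (b + y * b') = F e3 + b' + t)%R.
  have [_ /(_ isT) e] := hg _ (cusp_lat b' 0).
  rewrite (F_lat hF) in e; rewrite -e eg actM.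
  have [_ ->] := hsn _ (cusp_act p (cusp_lat b' 0)); last by rewrite p2.
  rewrite addr0 ep actM (actM (scU hx')) act_sc F_scale //; last exact/cusp_act/cusp_act/cusp_lat.
  have -> : act (rotU hy) (lat b' 0) = lat (y * b')%R 0.
    apply: vec_eq; rewrite /dotp /=; try ring.
    rewrite /height enormM (eqP hy) mul1r; ring.
  have [j' [-> _]] := act_tr_lat b j (y * b')%R 0.
  by rewrite (F_lat hF).
have bt : b = t.
  by have := Fg 0%R; rewrite mulr0 !addr0 => /addrI.
have y1 : y = 1%R.
  by have := Fg 1%R; rewrite bt mulr1 -addrA (addrC t) => /addrI/addIr.
rewrite eg ep; subst y.
have -> : rotU hy = 1 by apply: val_inj.
rewrite mulg1; apply: gen_mul; first exact: N0_N1.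
apply: gen_mul; first exact: sc_N1.
have -> : b = Eis (ere t) 0 by rewrite bt; case: (t) ht => m k /= ->.
apply: translation_gen.
- exact: gen_mul.
- exact: gen_inv.
- exact: gen_one.
- by apply: gen_in; rewrite !inE eqxx ?orbT.
- exact: tr01_N1.
Qed.
End Kernel.

Local Close Scope group_scope.

Lemma Gamma3_1 : Gamma3 1%g. Proof. by apply/eqP; vm_compute. Qed.
Lemma Gamma3M g h : Gamma3 g -> Gamma3 h -> Gamma3 (g * h)%g.
Proof. by rewrite /Gamma3 => hg hh; rewrite [val _]/(mm (val g) (val h)) mred3_mm hg hh mm1. Qed.
Lemma Gamma3V g : Gamma3 g -> Gamma3 g^-1%g.
Proof.
move=> hg; have := Gamma3_1; rewrite -(mulgV g) /Gamma3 [val _]/(mm (val g) (val g^-1%g)).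
by rewrite mred3_mm hg mm1.
Qed.

Section IntImage.
Variables (G : groupType) (H : G -> Prop) (f : G -> int).
Hypotheses (H1 : H 1%g) (HM : forall x y, H x -> H y -> H (x * y)%g)
  (HV : forall x, H x -> H x^-1%g).
Hypothesis fM : forall x y, H x -> H y -> f (x * y)%g = f x + f y.
Variable x0 : G.
Hypotheses (Hx0 : H x0) (fx0 : f x0 != 0).

Lemma int_image : exists m : int, [/\ m != 0, forall x, H x -> exists k, f x = k * m
  & exists2 x, H x & f x = m].
Proof.
have f1 : f 1%g = 0.
  by have := fM H1 H1; rewrite mulg1 => /eqP; rewrite -subr_eq0 opprD addNKr oppr_eq0 => /eqP.
have fV x : H x -> f x^-1%g = - f x.
  move=> hx; have := fM hx (HV hx); rewrite mulgV f1 => /eqP.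
  by rewrite eq_sym addrC addr_eq0 => /eqP.
have fX x (n : nat) : H x -> H (x ^+ n)%g /\ f (x ^+ n)%g = n%:Z * f x.
  move=> hx; elim: n => [|n [IH1 IH2]]; first by rewrite expg0 mul0r.
  rewrite expgS; split; first exact: HM.
  by rewrite fM // IH2 -add1n PoszD mulrDl mul1r.
pose P := fun n : nat => `[< exists2 x, H x & f x = n.+1%:Z >].
have exP : exists n, P n.
  exists `|f x0|%N.-1; apply/asboolP.
  have -> : `|f x0|%N.-1.+1%:Z = `|f x0|%N%:Z by rewrite prednK // absz_gt0.
  case/orP: (le_total 0 (f x0)) => h; first by exists x0 => //; lia.
  by exists (x0^-1)%g; [exact: HV|rewrite fV //; lia].
case: (ex_minnP exP) => n /asboolP[x hx fx] minn.
exists n.+1; split=> //; last by exists x.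
move=> y hy; exists (f y %/ n.+1)%Z.
set q := (f y %/ n.+1)%Z; have e := divz_eq (f y) n.+1; rewrite -/q in e.
have [r0 r1] : 0 <= (f y %% n.+1)%Z /\ (f y %% n.+1)%Z < n.+1.
  by split; [rewrite modz_ge0|rewrite ltz_pmod].
have [z hz fz] : exists2 z, H z & f z = (f y %% n.+1)%Z.
  have [a1 a2] := fX x `|q|%N hx.
  case/orP: (le_total 0 q) => hq.
    exists (y * (x ^+ `|q|%N)^-1)%g; first by apply: HM => //; exact: HV.
    by rewrite fM ?fV //; [rewrite a2 fx gez0_abs // {1}e; ring|exact: HV].
  exists (y * x ^+ `|q|%N)%g; first exact: HM.
  by rewrite fM // a2 fx lez0_abs // {1}e; ring.
have [z0|z0] := eqVneq (f y %% n.+1)%Z 0; first by rewrite {1}e z0 addr0.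
have : P `|(f y %% n.+1)%Z|%N.-1.
  apply/asboolP; exists z => //; rewrite fz prednK ?absz_gt0 // gez0_abs //.
by move=> /minn; lia.
Qed.
End IntImage.

Theorem Gamma3_fibration : exists rho : U -> int,
  [/\ forall g h, Gamma3 g -> Gamma3 h -> rho (g * h)%g = rho g + rho h,
      exists2 g, Gamma3 g & rho g = 1
    & exists Y : seq U, forall g, (Gamma3 g /\ rho g = 0) <-> gens Y g].
Proof.
have [F hF] := potential.
pose f g := eom (F (act g e3) - F e3).
have hs g : Gamma3 g -> potential_shift F g (F (act g e3) - F e3) by move=> /inv_Gamma3/(inv_shift hF).
have fM g h : Gamma3 g -> Gamma3 h -> f (g * h)%g = f g + f h.
  move=> hg hh; rewrite /f -eomD; congr eom.
  apply: (potential_shift_uniq (hs _ (Gamma3M hg hh))); apply: potential_shiftM; exact: hs.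
(* The translation over 3 w has shift 3 w, so the omega-coordinate is not identically zero on
   [Gamma3]; dividing by the generator m of its image makes the homomorphism surjective. *)
have ht : Gamma3 (tr (Eis 0 3) 0) by apply/eqP; vm_compute.
have ft : f (tr (Eis 0 3) 0) != 0 by rewrite /f act_tr_e3 (F_lat hF) addrC addKr.
have [m [m0 fm [x hx fx]]] := int_image Gamma3_1 Gamma3M Gamma3V fM ht ft.
have fK g : Gamma3 g -> (f g %/ m)%Z * m = f g.
  by move=> /fm[k ->]; rewrite mulzK.
exists (fun g => (f g %/ m)%Z); split.
- move=> g h hg hh; apply: (mulIf m0); rewrite mulrDl !fK //; last exact: Gamma3M.
  exact: fM.
- by exists x => //; rewrite fx divzz m0.
have [Y hY] := U_schreier N1s; exists Y => g; rewrite -hY; split=> [[hg e]|[hg h3]].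
  split=> //; apply: (kernel_N1 hF hg (hs g hg)).
  by rewrite -/(f g) -(fK g hg) e mul0r.
split=> //; have [t ht0 st] := shift_N1 hF hg.
by rewrite /f (potential_shift_uniq (hs g h3) st) ht0 div0z.
Qed.

(** * Torsion *)

Section Torsion.
Notation V := (O * O * O)%type.
Variable g : U.
Notation A := (act g : V -> V).

Lemma actD v w : A (v + w : V) = A v + A w.
Proof.
case: v w => [[v1 v2] v3] [[w1 w2] w3].
by apply: vec_eq; rewrite /dotp /= /dotp /=; ring.
Qed.
Lemma act_natmul v n : A (v *+ n : V) = A v *+ n.
Proof.
elim: n => [|n IH]; last by rewrite !mulrS actD IH.
by apply: vec_eq; rewrite /dotp /=; ring.
Qed.

Lemma O_natmul (z : O) n : z *+ n = Eis (ere z * n%:Z) (eom z * n%:Z).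
Proof.
elim: n => [|n IH]; first by apply: eis_eq; rewrite /= mulr0.
by rewrite mulrS IH; apply: eis_eq; rewrite /= -add1n PoszD; ring.
Qed.
Lemma V_natmul (v : V) n : v *+ n = (v.1.1 *+ n, v.1.2 *+ n, v.2 *+ n).
Proof. by elim: n => [|n IH] //; rewrite !mulrS IH. Qed.
Lemma O_torsion (z : O) n : (0 < n)%N -> z *+ n = 0 -> z = 0.
Proof.
move=> n0; rewrite O_natmul => -[/eqP]; rewrite !mulf_eq0.
have -> : (n%:Z == 0) = false by lia.
rewrite orbF => /eqP h1 /eqP; rewrite mulf_eq0; have -> : (n%:Z == 0) = false by lia.
by rewrite orbF => /eqP h2; apply: eis_eq.
Qed.
Lemma V_torsion (v : V) n : (0 < n)%N -> v *+ n = 0 -> v = 0.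
Proof.
move=> n0; rewrite V_natmul => -[h1 h2 h3]; case: v h1 h2 h3 => [[a b] c] /= h1 h2 h3.
by rewrite (O_torsion n0 h1) (O_torsion n0 h2) (O_torsion n0 h3).
Qed.

Definition close (m : nat) : Prop := forall v : V, exists w : V, A v = v + w *+ 3 ^ m.

Lemma close_all : (forall m, close m) -> forall v, A v = v.
Proof.
move=> h v; apply/eqP; rewrite -subr_eq0; apply/eqP.
have hz (z : int) : (forall m : nat, exists k, z = k * (3 ^ m)%N%:Z) -> z = 0.
  move=> /(_ `|z|%N)[k e]; apply/eqP; apply: contraT => z0.
  have := ltn_expl `|z|%N (isT : 1 < 3)%N.
  have k0 : k != 0 by apply: contraNneq z0 => k0; rewrite e k0 mul0r.
  rewrite {1}e abszM /= => /leq_trans/(_ (leqnn _)).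
  by rewrite ltnNge leq_pmull // absz_gt0.
have hO (z : O) : (forall m : nat, exists k : O, z = k *+ 3 ^ m) -> z = 0.
  move=> hk; apply: eis_eq; apply: hz => m; have [k ->] := hk m; rewrite O_natmul.
    by exists (ere k).
  by exists (eom k).
have hv m : exists w : V, A v - v = w *+ 3 ^ m.
  by have [w ->] := h m v; exists w; rewrite addrC addKr.
case: (A v - v) hv => [[a b] c] hv.
by congr (_, _, _); apply: hO => m; have [w] := hv m; rewrite V_natmul => -[? ? ?];
  [exists w.1.1|exists w.1.2|exists w.2].
Qed.

Lemma close_exp m i : close m -> forall v : V, exists w : V, act (g ^+ i)%g v = v + w *+ 3 ^ m.
Proof.
move=> h; elim: i => [|i IH] v.
  by exists 0; rewrite expg0 act1 mul0rn addr0.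
have [w e] := IH v; have [w' e'] := h v; have [w'' e''] := h w.
exists (w + w' + w'' *+ 3 ^ m).
by rewrite expgS actM e actD e' act_natmul e'' !mulrnDl -!addrA; congr (_ + _); rewrite addrCA.
Qed.

Lemma orbit_sum p (v w : V) m : A v = v + w *+ 3 ^ m ->
  act (g ^+ p)%g v = v + (\sum_(i < p) act (g ^+ i)%g w) *+ 3 ^ m.
Proof.
move=> e; elim: p => [|p IH]; first by rewrite expg0 act1 big_ord0 mul0rn addr0.
have actXD q (x y : V) : act (g ^+ q)%g (x + y : V) = act (g ^+ q)%g x + act (g ^+ q)%g y :> V.
  elim: q => [|q IHq]; first by rewrite expg0 !act1.
  by rewrite expgS !actM IHq actD.
have actXn q (x : V) k : act (g ^+ q)%g (x *+ k : V) = act (g ^+ q)%g x *+ k :> V.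
  elim: q => [|q IHq]; first by rewrite expg0 !act1.
  by rewrite expgS !actM IHq act_natmul.
by rewrite expgSr actM e actXD IH actXn big_ord_recr /= mulrnDl addrA.
Qed.

(* Minkowski: if g v = v + 3^m w and g^p = 1, the sum of the g^i w over i < p is 0;
   it is p w modulo 3, which settles p <> 3, and p = 3 takes one more order. *)
Lemma close_step p m : prime p -> (g ^+ p = 1)%g -> (0 < m)%N -> close m -> close m.+1.
Proof.
move=> pp gp m0 h v; have [w e] := h v.
have s0 : \sum_(i < p) act (g ^+ i)%g w = 0 :> V.
  have := orbit_sum p e; rewrite gp act1 -[LHS]addr0 => /addrI/esym.
  by apply: V_torsion; rewrite expn_gt0.
suff [z ez] : exists z : V, w = z *+ 3.
  by exists z; rewrite e ez -mulrnA -expnS.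
case: m m0 h e => // m _ h e.
have ring3 (x y z : V) N : x + (x + y *+ (3 * N)) +
    (x + y *+ (3 * N) + (y + z *+ (3 * N)) *+ (3 * N)) =
    (x + y *+ (3 * N) + z *+ (3 * N * N)) *+ 3.
  have e3 (t : V) : t *+ 3 = t + t + t by rewrite !mulrS mulr0n addr0 addrA.
  rewrite mulrnDl e3; have -> : z *+ (3 * N) *+ (3 * N) =
     z *+ (3 * N * N) + z *+ (3 * N * N) + z *+ (3 * N * N).
    by rewrite -e3 -!mulrnA; congr (_ *+ _); lia.
  move: (y *+ _) (z *+ _) => a c.
  case: x a c => [[x1 x2] x3] [[a1 a2] a3] [[c1 c2] c3].
  by apply: vec_eq; rewrite /=; ring.
have lin (x : V) (a b : nat) : x *+ a *+ b = x *+ (a * b) by rewrite mulrnA.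
have [p3|p3] := eqVneq p 3.
  move: s0; rewrite p3 !big_ord_recr big_ord0 /= add0r expg0 act1 expg1.
  have [w1 e1] := h w; have [w2 e2] := h w1.
  rewrite expgS expg1 actM e1 actD e1 act_natmul e2 expnS ring3.
  move=> /(@V_torsion _ 3 isT) /eqP; rewrite -addrA addr_eq0 => /eqP ->.
  exists (- (w1 *+ 3 ^ m + w2 *+ (3 ^ m * 3 ^ m))).
  by rewrite mulNrn mulrnDl !lin; congr (- (_ + _)); congr (_ *+ _); rewrite [RHS]mulnC ?mulnA.
have [z ez] : exists z : V, \sum_(i < p) act (g ^+ i)%g w = w *+ p + z *+ 3.
  elim: (p) => [|q [z ez]]; first by exists 0; rewrite big_ord0 mulr0n mul0rn addr0.
  have [y ey] := close_exp q h w; exists (z + y *+ 3 ^ m).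
  by rewrite big_ord_recr /= ez ey mulrnDl lin -expnSr (mulrS w q) addrACA (addrC (w *+ q)).
rewrite ez in s0; have p0 : (p %% 3)%N != 0%N.
  apply: contraNneq p3 => /eqP d; rewrite eq_sym -dvdn_prime2 //.
move: s0; rewrite (divn_eq p 3); move: (p %/ 3)%N (p %% 3)%N p0 (ltn_pmod p (isT : 0 < 3)%N).
move=> k r r0 rlt; have : r \in [:: 1%N; 2%N] by rewrite !inE; lia.
rewrite !inE => /orP[] /eqP -> s0; rewrite mulrnDr in s0.
  exists (- (w *+ k + z)); apply/eqP; rewrite mulNrn mulrnDl lin -addr_eq0; apply/eqP.
  by rewrite -[RHS]s0 mulr1n addrA (addrC w).
exists (w + w *+ k + z); rewrite !mulrnDl lin (mulrS w 2) -[LHS]addr0 -s0 -!addrA.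
by congr (_ + _); rewrite addrCA; congr (_ + _); rewrite addrCA.
Qed.
End Torsion.

Lemma val_act_inj (g : U) : (forall v, act g v = v) -> g = 1%g.
Proof.
move=> h; apply: val_inj; have := h e1; have := h (0, 1, 0); have := h e3.
rewrite /act; case: (val g) => [[[[a1 a2] a3] [[b1 b2] b3]] [[c1 c2] c3]].
rewrite /mv /dotp /=; rewrite !(mulr0, mulr1, add0r, addr0).
by move=> [-> -> ->] [-> -> ->] [-> -> ->].
Qed.

Lemma Gamma3_close g : Gamma3 g -> close g 1.
Proof.
move=> h [[x y] z].
have e : vred3 (act g (x, y, z)) = vred3 (x, y, z).
  by rewrite vred3_mv h mv1.
have q (a b : O) : red3 a = red3 b -> exists k, a = b + k *+ 3.
  by move=> /red3P[k ->]; exists k; rewrite mulr_natl.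
case: (act g _) e => [[x' y'] z'] e.
have /q [a ->] : red3 x' = red3 x := congr1 (fun v => v.1.1) e.
have /q [b ->] : red3 y' = red3 y := congr1 (fun v => v.1.2) e.
have /q [c ->] : red3 z' = red3 z := congr1 (fun v => v.2) e.
by exists (a, b, c).
Qed.

Theorem Gamma3_torsion_free g n : Gamma3 g -> (0 < n)%N -> (g ^+ n = 1)%g -> g = 1%g.
Proof.
elim/ltn_ind: n => n IH g3 n0 gn.
have [n1|n1] := eqVneq n 1%N; first by rewrite n1 expg1 in gn.
have n2 : (1 < n)%N by rewrite ltn_neqAle eq_sym n1.
(* Minkowski's step is for prime order: it shows that g^(n/p), whose p-th power is 1, is trivial,
   and the induction continues with n/p. *)
have pp := pdiv_prime n2; set p := pdiv n in pp *.
have np : n = (n %/ p * p)%N by rewrite divnK // pdiv_dvd.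
have m0 : (0 < n %/ p)%N by rewrite divn_gt0 ?prime_gt0 // pdiv_leq.
apply: (IH (n %/ p)%N) => //; first by rewrite ltn_Pdiv // prime_gt1.
set h := (g ^+ _)%g.
have hp : (h ^+ p = 1)%g by rewrite /h -expgnA -np.
have h3 : Gamma3 h.
  by rewrite /h; elim: (n %/ p)%N => [|k IHk]; [exact: Gamma3_1|rewrite expgS; exact: Gamma3M].
apply: val_act_inj; apply: close_all => m.
have c1 := Gamma3_close h3; case: m => [|m].
  by move=> v; have [w ->] := c1 v; exists (w *+ 3); rewrite expn0 mulr1n expn1.
by elim: m => // m IHm; apply: (close_step pp hp).
Qed.

(** * The action on the ball *)

Section QuadraticRemainder.
Variables (K : numFieldType) (V W : normedModType K).

(** Suited to fractional linear maps, whose remainder is the explicit product of [frac_diff]. *)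
Lemma diff_quadratic (f : V -> W) (x : V) (L : {linear V -> W}) (c e : K) :
  0 < e -> 0 <= c -> (forall h, `|L h| <= c * `|h|) ->
  (forall h, `|h| < e -> `|f (h + x) - f x - L h| <= c * `|h| * `|h|) ->
  differentiable f x /\ 'd f x = L :> (V -> W).
Proof.
move=> e0 c0 hL hf.
have Lc : continuous L.
  apply: bounded_linear_continuous; apply/linear_boundedP.
  exists c; split; first exact: ger0_real.
  by move=> y cy h; apply: le_trans (hL h) _; rewrite ler_wpM2r // ltW.
have key : f \o shift x = cst (f x) + L +o_ (0 : V) id.
  apply/(@eqaddoP K V W V) => d d0.
  have p1 : 0 < c + 1 by rewrite ltr_wpDl.
  near=> h.
  rewrite /= !fctE /= opprD addrA; apply: le_trans (hf h _) _.
    near: h; apply/nbhs_norm0P; exists e => //.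
  rewrite ler_wpM2r // (@le_trans _ _ ((c + 1) * `|h|)) //.
    by rewrite ler_wpM2r // lerDl.
  rewrite mulrC -ler_pdivlMr // ltW //.
  near: h; apply/nbhs_norm0P; exists (d / (c + 1)) => //=.
  exact: divr_gt0.
have E : 'd f x = L :> (V -> W) by exact: diff_unique.
by split=> //; apply/diff_locallyP; rewrite E.
Unshelve. all: by end_near.
Qed.
End QuadraticRemainder.

Section Embedding.
Variable R : realType.
Notation C := R[i].

Definition emb (x : O) : C :=
  (((ere x)%:~R - (eom x)%:~R / 2) +i* ((eom x)%:~R * (Num.sqrt 3 / 2)))%C.

Lemma complex_eq (x y : C) :
  complex.Re x = complex.Re y -> complex.Im x = complex.Im y -> x = y.
Proof. by case: x y => [a b] [c d] /= -> ->. Qed.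

Let embB : {morph emb : x y / x - y}.
Proof. by move=> x y; apply: complex_eq; rewrite /= ?eisE ?rmorphB /=; ring. Qed.
Let embM : monoid_morphism emb.
Proof.
split=> [|x y]; apply: complex_eq; rewrite /= ?eisE ?(rmorphB, rmorphD, rmorphM) /=.
- by rewrite mul0r subr0.
- by rewrite mul0r.
- have := @sqr_sqrtr R 3 (ler0n _ _); rewrite expr2.
  set s := Num.sqrt 3; set a := (ere x)%:~R; set b := (eom x)%:~R.
  set c := (ere y)%:~R; set d := (eom y)%:~R => s3.
  have -> : (b * (s / 2)) * (d * (s / 2)) = b * d * (s * s) / 4 :> R by field.
  by rewrite s3; field.
- by field.
Qed.
HB.instance Definition _ := GRing.isZmodMorphism.Build O C emb embB.
HB.instance Definition _ := GRing.isMonoidMorphism.Build O C emb embM.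

Lemma emb_conj x : emb (econj x) = (emb x)^*.
Proof. by apply: complex_eq; rewrite /= ?rmorphB ?rmorphN /=; field. Qed.

Lemma emb_inj : injective emb.
Proof.
apply: raddf_inj => x [].
have s0 : Num.sqrt 3 / 2 != 0 :> R by rewrite mulf_neq0 ?invr_neq0 ?gt_eqF ?sqrtr_gt0 ?ltr0n.
move=> h1 h2; have /eqP := h2; rewrite mulf_eq0 (negPf s0) orbF intr_eq0 => /eqP e.
move: h1; rewrite e mul0r subr0 => /eqP; rewrite intr_eq0 => /eqP d.
exact: eis_eq.
Qed.

Definition vemb (v : vec O) : vec C := (emb v.1.1, emb v.1.2, emb v.2).
Definition memb (a : mat O) : mat C := (vemb a.1.1, vemb a.1.2, vemb a.2).

Lemma vemb_mv a v : vemb (mv a v) = mv (memb a) (vemb v).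
Proof. by rewrite /vemb /mv /dotp /= !rmorphD !rmorphM. Qed.
Lemma memb_mm a b : memb (mm a b) = mm (memb a) (memb b).
Proof. by rewrite /memb /mm /vm /vadd /vscale /vemb /= !rmorphD !rmorphM. Qed.
Lemma memb1 : memb (I3 _) = I3 _.
Proof. by rewrite /memb /vemb /I3 /= !rmorph0 !rmorph1. Qed.
Lemma vemb_inj : injective vemb.
Proof.
move=> [[x y] z] [[x' y'] z']; rewrite /vemb /=.
by move=> /pair_equal_spec[/pair_equal_spec[/emb_inj -> /emb_inj ->] /emb_inj ->].
Qed.
Lemma memb_inj : injective memb.
Proof.
move=> [[x y] z] [[x' y'] z']; rewrite /memb /=.
by move=> /pair_equal_spec[/pair_equal_spec[/vemb_inj -> /vemb_inj ->] /vemb_inj ->].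
Qed.

Definition ballform (v w : vec C) : C :=
  v.1.1 * w.1.1^* + v.1.2 * w.1.2^* - v.2 * w.2^*.
Definition pres (a : mat C) := forall v w, ballform (mv a v) (mv a w) = ballform v w.

Definition homog (z : 'rV[C]_2) : vec C := (z 0 0, z 0 1, 1).
Definition tangent (z : 'rV[C]_2) : vec C := (z 0 0, z 0 1, 0).

Lemma ballform_homog z : ballform (homog z) (homog z) = sqnorm z - 1.
Proof.
rewrite /ballform /homog /= /sqnorm big_ord_recl big_ord1 !normCK conjC1 mulr1.
by rewrite (_ : lift ord0 ord0 = 1) //; apply: val_inj.
Qed.

Lemma in_B2 z : B2 R z <-> ballform (homog z) (homog z) < 0.
Proof. by rewrite ballform_homog subr_lt0. Qed.

(* The right-hand side does not change when multiples of [homog z] are added to the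
   tangent vectors, so its invariance under projective maps follows from that of
   the form. *)
Lemma bergman_ballform z v w : bergman z v w =
  3 * (ballform (tangent v) (homog z) * ballform (homog z) (tangent w)
       - ballform (homog z) (homog z) * ballform (tangent v) (tangent w)) / ballform (homog z) (homog z) ^+ 2.
Proof.
rewrite ballform_homog /bergman /bergman_mx !big_ord_recl !big_ord0 !mxE /=.
rewrite (_ : lift ord0 ord0 = 1); last exact: val_inj.
rewrite -[(sqnorm z - 1) ^+ 2]sqrrN opprB.
set s := 1 - sqnorm z; rewrite /ballform /tangent /homog /= -[sqnorm z - 1]opprB -/s.
rewrite conjC1 conjC0.
ring.
Qed.

Section Mobius.
Variable a : mat C.
Hypothesis pa : pres a.

Definition den (z : 'rV[C]_2) : C := (mv a (homog z)).2.
Definition frac (z : 'rV[C]_2) : 'rV[C]_2 :=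
  \row_j ((if j == 0 then (mv a (homog z)).1.1 else (mv a (homog z)).1.2) / den z).

Lemma ballform_neg_neq0 v : ballform v v < 0 -> v.2 != 0.
Proof.
move=> h; apply/eqP => v2; move: h; rewrite /ballform v2 mul0r subr0.
rewrite -!normCK => /lt_geF/negP; apply.
by rewrite addr_ge0 // exprn_ge0.
Qed.

Lemma den_neq0 z : B2 R z -> den z != 0.
Proof. by move=> /in_B2; rewrite -pa => /ballform_neg_neq0. Qed.

Lemma mv_homog z : den z != 0 -> mv a (homog z) = vscale (den z) (homog (frac z)).
Proof.
move=> d0; rewrite [LHS]surjective_pairing [in LHS](surjective_pairing (mv a _).1).
rewrite /vscale /homog !mxE /= mulr1; apply: vec_eq => //.
  by rewrite mulrC divfK.
by rewrite mulrC divfK.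
Qed.

Lemma ballformZ (x y : C) v w : ballform (vscale x v) (vscale y w) = x * y^* * ballform v w.
Proof. by rewrite /ballform /vscale /= !rmorphM; ring. Qed.

Lemma ballform_frac z : den z != 0 ->
  ballform (homog z) (homog z) = `|den z| ^+ 2 * ballform (homog (frac z)) (homog (frac z)).
Proof. by move=> d0; rewrite -{1}pa mv_homog // ballformZ normCK. Qed.

Lemma frac_B2 z : B2 R z -> B2 R (frac z).
Proof.
move=> zB; have d0 := den_neq0 zB; have /in_B2 := zB; rewrite ballform_frac // => h.
by apply/in_B2; rewrite pmulr_rlt0 // exprn_gt0 ?normr_gt0 in h.
Qed.

Definition dfrac (z h : 'rV[C]_2) : 'rV[C]_2 := 
  \row_j (((if j == 0 then (mv a (tangent h)).1.1 else (mv a (tangent h)).1.2)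
           - frac z 0 j * (mv a (tangent h)).2) / den z).

Lemma mv_tangent z h : den z != 0 ->
  mv a (tangent h) = vadd (vscale (den z) (tangent (dfrac z h)))
                      (vscale (mv a (tangent h)).2 (homog (frac z))).
Proof.
move=> d0; rewrite [LHS]surjective_pairing [in LHS](surjective_pairing (mv a _).1).
rewrite {1}/vadd /vscale /tangent /homog /=; apply: vec_eq.
- by rewrite [dfrac z h 0 0]mxE /= mulrC divfK //; ring.
- by rewrite [dfrac z h 0 1]mxE /= mulrC divfK //; ring.
- by rewrite mulr0 mulr1 add0r.
Qed.

Lemma bergman_frac z v w : B2 R z ->
  bergman (frac z) (dfrac z v) (dfrac z w) = bergman z v w.
Proof.
move=> zB; have d0 := den_neq0 zB; have /in_B2/lt_eqF n0 := zB.
rewrite !bergman_ballform -(pa (tangent v) (homog z)) -(pa (homog z) (tangent w)) -(pa (tangent v) (tangent w)).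
rewrite (mv_tangent v d0) (mv_tangent w d0) (mv_homog d0) (ballform_frac d0).
have {n0} : ballform (homog (frac z)) (homog (frac z)) != 0.
  by apply: contraFN n0 => /eqP h; rewrite (ballform_frac d0) h mulr0 eqxx.
rewrite normCK.
have : (den z)^* != 0 by rewrite fmorph_eq0.
move: (den z) d0 (homog (frac z)) (tangent (dfrac z v)) (tangent (dfrac z w)) ((mv a (tangent v)).2) ((mv a (tangent w)).2).
move=> D D0 Z V W x y D0' Z0.
have bil (p q r s : C) (A B E F : vec C) :
  ballform (vadd (vscale p A) (vscale q B)) (vadd (vscale r E) (vscale s F)) =
  p * r^* * ballform A E + p * s^* * ballform A F + q * r^* * ballform B E + q * s^* * ballform B F.
  by rewrite /ballform /vadd /vscale /= !(rmorphD, rmorphM) /=; ring.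
have bil1 (p q r : C) (A B E : vec C) :
  ballform (vadd (vscale p A) (vscale q B)) (vscale r E) = 
  p * r^* * ballform A E + q * r^* * ballform B E.
  by rewrite /ballform /vadd /vscale /= !(rmorphD, rmorphM) /=; ring.
have bil2 (p q r : C) (A B E : vec C) :
  ballform (vscale r E) (vadd (vscale p A) (vscale q B)) =
  r * p^* * ballform E A + r * q^* * ballform E B.
  by rewrite /ballform /vadd /vscale /= !(rmorphD, rmorphM) /=; ring.
rewrite bil bil1 bil2.
move: (ballform Z Z) (ballform V Z) (ballform Z W) (ballform V W) Z0 D^* x^* y^* D0' => z0 vz zw vw Z0 D' x' y' D0'.
by field; rewrite Z0 D0 D0'.
Qed.

End Mobius.
End Embedding.

Section MobiusDiff.
Variable R : realType.
Notation C := R[i].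
Implicit Types z h : 'rV[C]_2.

Lemma row2P (u v : 'rV[C]_2) : u 0 0 = v 0 0 -> u 0 1 = v 0 1 -> u = v.
Proof.
move=> e0 e1; apply/rowP => j; case: j => [[|[|//]] ?].
  by rewrite (_ : Ordinal _ = 0) //; apply: val_inj.
by rewrite (_ : Ordinal _ = 1) //; apply: val_inj.
Qed.

Lemma norm_coord h j : `|h 0 j| <= `|h|.
Proof.
rewrite [X in _ <= X]/Num.norm /= mx_normE -[leLHS]nngE num_le.
exact: (le_bigmax _ (fun i : 'I_1 * 'I_2 => `|h i.1 i.2|%:nng) (0, j)).
Qed.

Lemma norm_row_le h (c : C) : 0 <= c -> `|h 0 0| <= c -> `|h 0 1| <= c -> `|h| <= c.
Proof.
move=> c0 h0 h1; rewrite [X in X <= _]/Num.norm /=.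
have [->//|/mx_norm_neq0[[i j] /= ->]] := eqVneq (mx_norm h) 0.
rewrite (ord1 i); case: j => [[|[|//]] ?].
  by rewrite (_ : Ordinal _ = 0) //; apply: val_inj.
by rewrite (_ : Ordinal _ = 1) //; apply: val_inj.
Qed.

Lemma sqnorm2 z : sqnorm z = `|z 0 0| ^+ 2 + `|z 0 1| ^+ 2.
Proof.
rewrite /sqnorm big_ord_recl big_ord1.
by rewrite (_ : lift ord0 ord0 = 1) //; apply: val_inj.
Qed.

Lemma sqnorm_near z : B2 R z -> exists2 e : C, 0 < e &
  forall h, `|h| < e -> (1 - sqnorm z) / 2 < 1 - sqnorm (h + z).
Proof.
move=> zB; pose d := 1 - sqnorm z.
have d0 : 0 < d by rewrite subr_gt0.
have d1 : d <= 1 by rewrite lerBlDr lerDl sqnorm2 addr_ge0 // exprn_ge0.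
(* Each of the two squared moduli grows by at most 3 |h|, and 6 d / 12 = d / 2. *)
exists (d / 12) => [|h hd]; first by rewrite divr_gt0.
have h1 : `|h| <= 1 by apply: (le_trans (ltW hd)); rewrite ler_pdivrMr // mul1r (le_trans d1) // ler1n.
have z1 j : `|z 0 j| <= 1.
  rewrite -(@expr_le1 _ 2) //; apply: ltW; apply: le_lt_trans zB.
  rewrite sqnorm2; case: j => [[|[|//]] ?].
    by rewrite (_ : Ordinal _ = 0) ?lerDl ?exprn_ge0 //; apply: val_inj.
  by rewrite (_ : Ordinal _ = 1) ?lerDr ?exprn_ge0 //; apply: val_inj.
have key j : `|(h + z) 0 j| ^+ 2 <= `|z 0 j| ^+ 2 + 3 * `|h|.
  rewrite mxE; apply: (@le_trans _ _ ((`|h 0 j| + `|z 0 j|) ^+ 2)).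
    by rewrite lerXn2r ?nnegrE ?ler_normD.
  have hj := norm_coord h j.
  rewrite sqrrD [X in _ <= X]addrC lerD2r.
  rewrite expr2 -mulr_natr -mulrA -mulrDr mulrC; apply: ler_pM => //.
  rewrite (_ : 3 = 1 + 1 * 2%:R); last by ring.
  by rewrite lerD ?ler_wpM2r // (le_trans hj).
rewrite ltrBrDr -ltrBrDl -/d sqnorm2; apply: le_lt_trans (lerD (key 0) (key 1)) _.
rewrite addrACA -sqnorm2 -mulrDl (_ : _ + _ * _ = 1 - d + 12 * `|h| / 2); last first.
  by rewrite /d; field.
rewrite (_ : 1 - d / 2 = 1 - d + d / 2); last by field.
by rewrite ltrD2l ltr_pM2r ?invr_gt0 ?ltr0n // mulrC -ltr_pdivlMr.
Qed.

Lemma B2_nbhs z : B2 R z -> exists2 e : C, 0 < e & forall h, `|h| < e -> B2 R (h + z).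
Proof.
move=> zB; have [e e0 he] := sqnorm_near zB; exists e => // h /he h1.
by rewrite /B2 /= -subr_gt0 (le_lt_trans _ h1) // divr_ge0 // subr_ge0 ltW.
Qed.

Lemma extend_eq (f : B2 R -> B2 R) (F : 'rV[C]_2 -> 'rV[C]_2) z :
  (forall z : B2 R, \val (f z) = F (\val z)) -> B2 R z -> extend f z = F z.
Proof.
move=> fF zB; have zB' : z \in B2 R by rewrite inE.
by rewrite /extend insubT.
Qed.

Section Mob.
Variables (a : mat C) (z : 'rV[C]_2).
Hypotheses (pa : pres a) (zB : B2 R z).

Lemma dfrac_linear : linear (dfrac a z).
Proof.
move=> k u v; apply/rowP => j; rewrite !mxE /mv /dotp /tangent /= !mxE.
by case: (j == 0); ring.
Qed.
HB.instance Definition _ :=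
  GRing.isLinear.Build C 'rV[C]_2 'rV[C]_2 *:%R (dfrac a z) dfrac_linear.

Lemma frac_diff h : den a (h + z) != 0 ->
  frac a (h + z) - frac a z - dfrac a z h =
  (- (mv a (tangent h)).2 / den a (h + z)) *: dfrac a z h.
Proof.
have d0 := den_neq0 pa zB => d1.
have eD : den a (h + z) = den a z + (mv a (tangent h)).2.
  by rewrite /den /mv /dotp /homog /tangent /= !mxE; ring.
move: d1; rewrite eD => d1.
apply/rowP => j; rewrite !mxE eD.
have e1 : (mv a (homog (h + z))).1.1 = (mv a (homog z)).1.1 + (mv a (tangent h)).1.1.
  by rewrite /mv /dotp /homog /tangent /= !mxE; ring.
have e2 : (mv a (homog (h + z))).1.2 = (mv a (homog z)).1.2 + (mv a (tangent h)).1.2.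
  by rewrite /mv /dotp /homog /tangent /= !mxE; ring.
rewrite e1 e2.
move: (den a z) d0 (mv a (homog z)) (mv a (tangent h)) d1 => D d0 u v d1.
by case: (j == 0); field; rewrite d0 d1.
Qed.

Lemma norm_mv_tangent : exists2 c : C, 0 <= c & forall h,
  [/\ `|(mv a (tangent h)).1.1| <= c * `|h|, `|(mv a (tangent h)).1.2| <= c * `|h|
     & `|(mv a (tangent h)).2| <= c * `|h|].
Proof.
pose s (v : vec C) := `|v.1.1| + `|v.1.2|.
have key (v : vec C) k : `|dotp v (tangent k)| <= s v * `|k|.
  rewrite /dotp /tangent /= mulr0 addr0 (le_trans (ler_normD _ _)) // !normrM mulrDl.
  by rewrite lerD // ler_wpM2l // norm_coord.
have s0 v : 0 <= s v by rewrite addr_ge0.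
exists (s a.1.1 + s a.1.2 + s a.2) => [|k]; first by rewrite !addr_ge0.
split; apply: (le_trans (key _ _)); rewrite ler_wpM2r //.
- by rewrite -addrA lerDl addr_ge0.
- by rewrite addrAC lerDr addr_ge0.
- by rewrite lerDr addr_ge0.
Qed.

Lemma mobius_differentiable (f : B2 R -> B2 R) :
  (forall z : B2 R, \val (f z) = frac a (\val z)) ->
  differentiable (extend f) z /\ 'd (extend f) z = dfrac a z :> ('rV[C]_2 -> 'rV[C]_2).
Proof.
move=> fF.
have [c c0 hc] := norm_mv_tangent.
have [e e0 he] := B2_nbhs zB.
have d0 := den_neq0 pa zB.
pose D := `|den a z|; have D0 : 0 < D by rewrite normr_gt0.
pose m := `|frac a z|.
pose c1 := c * (1 + m) / D.
have m0 : 0 <= 1 + m by rewrite addr_ge0 // normr_ge0.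
have c10 : 0 <= c1 by rewrite divr_ge0 ?mulr_ge0 // ltW.
have L h : `|dfrac a z h| <= c1 * `|h|.
  have [h1 h2 h3] := hc h.
  have B (x y : C) : `|x| <= c * `|h| -> `|y| <= m -> `|(x - y * (mv a (tangent h)).2) / den a z| <= c1 * `|h|.
    move=> hx hy; rewrite normrM normfV -/D.
    rewrite (_ : c1 * `|h| = (c * `|h| + m * (c * `|h|)) / D); last by rewrite /c1; ring.
    rewrite ler_wpM2r ?invr_ge0 ?(ltW D0) // (le_trans (ler_normB _ _)) // lerD //.
    by rewrite normrM ler_pM.
  apply: norm_row_le; first by rewrite mulr_ge0.
    by rewrite mxE; apply: B => //; apply: norm_coord.
  by rewrite mxE; apply: B => //; apply: norm_coord.
have c20 : 0 <= c * (2 / D) by rewrite mulr_ge0 // divr_ge0 // ltW.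
pose c2 := c1 * (1 + c * (2 / D)).
have p1 : 0 < c + 1 by rewrite ltr_wpDl // ltr01.
have [q q0 eq] : exists2 q, 0 < q & q = D / 2 / (c + 1).
  by exists (D / 2 / (c + 1)); rewrite // !divr_gt0 // ltr0n.
(* A positive number below both e and q; the order of [R[i]] is only partial, so this stands in for
   their minimum. *)
pose e' := e * q / (e + q).
have eq0 : 0 < e + q by rewrite addr_gt0.
have e'0 : 0 < e' by rewrite divr_gt0 // mulr_gt0.
have e'1 : e' <= e by rewrite /e' ler_pdivrMr // ler_pM2l // lerDr ltW.
have e'2 : e' <= q.
  by rewrite /e' ler_pdivrMr // mulrC ler_pM2l // lerDl ltW.
apply: (@diff_quadratic _ _ _ _ _ (dfrac a z) c2 e' e'0).
- by rewrite mulr_ge0 // addr_ge0.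
- by move=> h; apply: (le_trans (L h)); rewrite ler_wpM2r // ler_peMr // lerDl.
move=> h hlt.
have hB := he h (lt_le_trans hlt e'1).
rewrite !(extend_eq fF) //.
have d1 := den_neq0 pa hB.
rewrite frac_diff // normrZ normrM normrN normfV.
have eD : den a (h + z) = den a z + (mv a (tangent h)).2.
  by rewrite /den /mv /dotp /homog /tangent /= !mxE; ring.
have [_ _ h3] := hc h.
have hN : `|(mv a (tangent h)).2| <= D / 2.
  apply: (le_trans h3); apply: (@le_trans _ _ ((c + 1) * `|h|)).
    by rewrite ler_wpM2r // lerDl.
  by rewrite mulrC -ler_pdivlMr // -eq (le_trans (ltW hlt)).
have hD : D / 2 <= `|den a (h + z)|.
  rewrite eD; apply: le_trans (lerB_normD _ _).
  by rewrite -/D lerBrDl (le_trans (lerD hN (lexx _))) // (_ : D / 2 + D / 2 = D) //; field.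
apply: (@le_trans _ _ ((c * `|h| * (2 / D)) * (c1 * `|h|))).
  apply: ler_pM => //.
  apply: ler_pM => //.
  by rewrite -[2 / D]invf_div lef_pV2 ?posrE ?normr_gt0 // divr_gt0.
rewrite (_ : _ * _ = c1 * (c * (2 / D)) * `|h| * `|h|); last ring.
by rewrite !ler_wpM2r // ler_wpM2l // lerDr.
Qed.

End Mob.

Lemma den_mm (a b : mat C) z : den b z != 0 ->
  den (mm a b) z = den b z * den a (frac b z).
Proof. by move=> d0; rewrite {1}/den mv_mm (mv_homog d0) mv_scale. Qed.

Lemma frac_mm (a b : mat C) z : den b z != 0 ->
  frac (mm a b) z = frac a (frac b z).
Proof.
move=> d0; apply/rowP => j; rewrite [LHS]mxE [RHS]mxE den_mm // mv_mm (mv_homog d0) mv_scale.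
by case: (j == 0); rewrite /vscale [X in X / _]/= invfM mulrACA divff // mul1r.
Qed.

Lemma frac1 z : frac (I3 C) z = z.
Proof. by apply: row2P; rewrite mxE /den !mv1 /= divr1. Qed.

Section MobIso.
Variables (a b : mat C).
Hypotheses (pa : pres a) (pb : pres b) (ab : mm a b = I3 _) (ba : mm b a = I3 _).

Definition mobius (c : mat C) (pc : pres c) (z : B2 R) : B2 R :=
  SigSub (mem_set (frac_B2 pc (set_mem (valP z)))).

Lemma mobius_isometry : holomorphic_isometry (mobius pa).
Proof.
have zB (z : B2 R) : B2 R (\val z) := set_mem (valP z).
split.
- by move=> z; have [] := mobius_differentiable pa (zB z) (f := mobius pa) (fun=> erefl).
- move=> z v w; have [_ ->] := mobius_differentiable pa (zB z) (f := mobius pa) (fun=> erefl).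
  exact: bergman_frac.
- exists (mobius pb); split.
  + by move=> z; have [] := mobius_differentiable pb (zB z) (f := mobius pb) (fun=> erefl).
  + by move=> z; apply: val_inj; apply: etrans (esym (frac_mm b (den_neq0 pa (zB z)))) _; rewrite ba frac1.
  + by move=> z; apply: val_inj; apply: etrans (esym (frac_mm a (den_neq0 pb (zB z)))) _; rewrite ab frac1.
Qed.
End MobIso.

End MobiusDiff.

Section Action.
Variable R : realType.
Notation C := R[i].
Notation emb := (@emb R).
Notation vemb := (@vemb R).
Notation memb := (@memb R).

(* cayley maps the form [herm] to diag(1, 1, -1); the entries of both cayley and its
   inverse cayleyV are Eisenstein integers. *)
Definition cayley : mat O := ((1, 0, Eis 1 1), (0, 1, 0), (1, 0, Eis 0 1)).
Definition cayleyV : mat O := ((Eis 0 (-1), 0, Eis 1 1), (0, 1, 0), (1, 0, -1)).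

Lemma cayleyK : mm cayley cayleyV = I3 _. Proof. by []. Qed.
Lemma cayleyVK : mm cayleyV cayley = I3 _. Proof. by []. Qed.

Definition siegelform (v w : vec C) : C :=
  v.1.1 * w.2^* + v.1.2 * w.1.2^* + v.2 * w.1.1^*.

Lemma siegelform_vemb v w : siegelform (vemb v) (vemb w) = emb (herm v w).
Proof. by rewrite /siegelform /herm !rmorphD !rmorphM /= !emb_conj. Qed.

Lemma siegelform_adjm a v w : siegelform (mv (memb a) v) w = siegelform v (mv (memb (adjm a)) w).
Proof.
rewrite /siegelform /mv /dotp /= !emb_conj !(rmorphD, rmorphM) /= !conjCK; ring.
Qed.

Lemma ballform_Cm v w : ballform (mv (memb cayley) v) (mv (memb cayley) w) = siegelform v w.
Proof.
rewrite /ballform /siegelform /mv /dotp /= rmorph0 rmorph1 !mul1r !mul0r !addr0 !add0r.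
have e1 : emb (Eis 1 1) = 1 + emb (Eis 0 1) by rewrite -(rmorph1 emb) -rmorphD.
have e2 : (emb (Eis 0 1))^* = - 1 - emb (Eis 0 1).
  by rewrite -emb_conj -(rmorph1 emb) -rmorphN -rmorphB.
have e3 : (emb (Eis 0 1)) ^+ 2 = - 1 - emb (Eis 0 1).
  by rewrite expr2 -rmorphM -(rmorph1 emb) -rmorphN -rmorphB.
rewrite e1; move: (emb (Eis 0 1)) e2 e3 => o e2 e3.
rewrite !(rmorphD, rmorphM, rmorph1) /= e2; ring: e3.
Qed.

Definition ball_mx (g : U) : mat C := mm (memb cayley) (mm (memb (val g)) (memb cayleyV)).

Lemma siegelform_act (g : U) v w : siegelform (mv (memb (val g)) v) (mv (memb (val g)) w) = siegelform v w.
Proof.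
rewrite siegelform_adjm -mv_mm -memb_mm; have /andP[_ /eqP ->] := svalP g.
by rewrite memb1 mv1.
Qed.

Lemma ball_mx_pres g : pres (ball_mx g).
Proof.
move=> v w; rewrite /ball_mx !mv_mm ballform_Cm siegelform_act -ballform_Cm -!mv_mm -memb_mm cayleyK.
by rewrite memb1 !mv1.
Qed.

Lemma ball_mx1 : ball_mx 1%g = I3 _.
Proof. by rewrite /ball_mx -!memb_mm (_ : val (1%g : U) = I3 _) // mm1 cayleyK memb1. Qed.

Lemma ball_mxM g h : ball_mx (g * h)%g = mm (ball_mx g) (ball_mx h).
Proof.
by rewrite /ball_mx -!memb_mm -!mmA [mm cayleyV (mm cayley _)]mmA cayleyVK mm1 [mm _ (mm _ cayleyV)]mmA.
Qed.

Definition mob (g : U) : PU21 R.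
Proof.
apply: (MkPU21 (@mobius_isometry R (ball_mx g) (ball_mx g^-1%g) (ball_mx_pres g) (ball_mx_pres _) _ _)).
by rewrite -ball_mxM mulgV ball_mx1.
by rewrite -ball_mxM mulVg ball_mx1.
Defined.

Lemma mob_val g (z : B2 R) : \val (mob g z) = frac (ball_mx g) (\val z).
Proof. by []. Qed.

Lemma in_ball (z : B2 R) : B2 R (\val z).
Proof. exact: (set_mem (valP z)). Qed.

Lemma mobM g h : mob (g * h)%g = (mob g * mob h)%g.
Proof.
apply: PU21_eq => z; apply: val_inj; rewrite mob_val ball_mxM frac_mm //.
exact: (den_neq0 (ball_mx_pres h) (in_ball z)).
Qed.

Lemma mob1 : mob 1%g = 1%g.
Proof. by apply: PU21_eq => z; apply: val_inj; rewrite mob_val ball_mx1 frac1. Qed.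

Lemma mobV g : mob g^-1%g = (mob g)^-1%g.
Proof. by apply: (mulIg (mob g)); rewrite -mobM !mulVg mob1. Qed.

(** Fixing 0 and the points (1/2, 0), (-1/2, 0), (0, 1/2), (0, -1/2) is enough: comparing opposite
    points kills the off-diagonal entries and equates the diagonal ones. *)
Lemma scalar_of_fixing (a : mat C) : pres a ->
  (forall z, B2 R z -> frac a z = z) -> exists x, a = scal x.
Proof.
move=> pa h.
have key (x y : C) : `|x| ^+ 2 + `|y| ^+ 2 < 1 -> exists d, mv a (x, y, 1) = (d * x, d * y, d).
  move=> xy; pose z : 'rV[C]_2 := \row_j (if j == 0 then x else y).
  have zB : B2 R z by rewrite /B2 /= sqnorm2 !mxE.
  have ez : homog z = (x, y, 1) by rewrite /homog !mxE.
  exists (den a z); rewrite -ez (mv_homog (den_neq0 pa zB)) (h z zB) ez.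
  by rewrite /vscale /= mulr1.
pose h2 : C := 1 / 2.
have h20 : h2 != 0 by rewrite mulf_neq0 ?oner_eq0 ?invr_neq0 ?pnatr_eq0.
have half : `|h2| ^+ 2 < 1.
  by rewrite ger0_norm ?divr_ge0 // expr_lt1 ?divr_ge0 // ltr_pdivrMr // mul1r ltr1n.
have nhalf : `|- h2| ^+ 2 < 1 by rewrite normrN.
have zero : `|0 : C| ^+ 2 = 0 by rewrite normr0 expr0n.
have solve (p q d e e' : C) : q * h2 = e * h2 -> q * - h2 = e' * - h2 ->
    p * h2 + d = e -> p * - h2 + d = e' -> p = 0 /\ q = d.
  move=> /(mulIf h20) <-; rewrite !mulrN => /oppr_inj/(mulIf h20) <- h1 h3.
  have p0 : p = 0.
    have -> : p = (p * h2 + d) - (- (p * h2) + d) by rewrite /h2; field.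
    by rewrite h1 h3 subrr.
  by split=> //; rewrite -h1 p0 mul0r add0r.
have z0 x : x * h2 = 0 -> x = 0 by move/eqP; rewrite mulf_eq0 (negPf h20) orbF => /eqP.
have [|d0] := key 0 0; first by rewrite zero addr0.
have [|d1] := key h2 0; first by rewrite zero addr0.
have [|d2] := key (- h2) 0; first by rewrite zero addr0.
have [|d3] := key 0 h2; first by rewrite zero add0r.
have [|d4] := key 0 (- h2); first by rewrite zero add0r.
case: a {pa h key} => [[[[a1 a2] a3] [[b1 b2] b3]] [[c1 c2] c3]].
rewrite /mv /dotp /= !(mulr0, mulr1, addr0, add0r).
move=> [x1 x2 x3] [x4 x5 x6] [y1 y2 y3] [y4 y5 y6] -[w1 w2 _].
rewrite {}w1 {}w2 !addr0 in x1 x2 x4 x5 y1 y2 y4 y5 *.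
have [c1_0 a1_0] := solve _ _ _ _ _ y4 y1 y6 y3.
have [c2_0 b2_0] := solve _ _ _ _ _ x5 x2 x6 x3.
by exists c3; rewrite c1_0 a1_0 c2_0 b2_0 (z0 _ y5) (z0 _ x4).
Qed.

(** An element acting trivially is a scalar; the scalar is a unit congruent to 1 modulo 3, hence 1.
    So the congruence subgroup embeds in the projective group. *)
Lemma mob_inj1 g : Gamma3 g -> mob g = 1%g -> g = 1%g.
Proof.
move=> g3 e.
have [x ex] : exists x, ball_mx g = scal x.
  apply: scalar_of_fixing (ball_mx_pres g) _ => z zB.
  by have /(congr1 (fun f : PU21 R => \val (f (SigSub (mem_set zB))))) := e.
have {}ex : memb (val g) = scal x.
  have -> : memb (val g) = mm (memb cayleyV) (mm (ball_mx g) (memb cayley)).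
    by rewrite /ball_mx -!memb_mm -!mmA cayleyVK mmr1 mmA cayleyVK mm1.
  rewrite ex -[memb cayley]mm1 [mm (scal x) _]mmA.
  have -> : mm (scal x) (I3 _) = scal x by exact: mmr1.
  have cc (m : mat C) : mm (scal x) m = mm m (scal x).
    case: m => [[[[a1 a2] a3] [[b1 b2] b3]] [[c1 c2] c3]].
    by congr (_, _, _); apply: vec_eq; matE; ring.
  by rewrite cc mmA -memb_mm cayleyVK memb1 mm1.
have [y ey] : exists y, val g = scal y.
  have := ex; exists ((val g).1.1.1.1); apply: (@memb_inj R); rewrite ex.
  move: ex; case: (val g) => [[[[a1 a2] a3] [[b1 b2] b3]] [[c1 c2] c3]].
  rewrite /memb /vemb /scal /= rmorph0 => -[-> _ _ _ _ _ _ _ _]; done.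
have hy : is_unit y.
  have /andP[/eqP + _] := svalP g; rewrite -[sval g]/(val g) ey.
  by move=> /(congr1 (fun m => m.2.2)); rewrite /mm /vm /adjm /=; rewrite !(mul0r, add0r, addr0, mulr0) => /unit_adjM.
have y1 : y = 1.
  rewrite -(lift3K hy) (_ : red3 y = red3 1); first exact: (@lift3K 1).
  by move: g3; rewrite /Gamma3 ey => /(congr1 (fun m => m.2.2)) /=; rewrite rmorph1.
by apply: val_inj; rewrite ey y1.
Qed.

End Action.

(** * The image of the congruence subgroup among the isometries of the ball *)

Section GammaGroup.
Variable R : realType.
Notation mob := (@mob R).

Definition Gamma : set (PU21 R) := [set mob g | g in [set g | Gamma3 g]].

Lemma mob_inj g h : Gamma3 g -> Gamma3 h -> mob g = mob h -> g = h.
Proof.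
move=> g3 h3 e; apply/eqP; rewrite -[_ == _]divg_eq1; apply/eqP.
apply: (@mob_inj1 R); first exact/Gamma3M/Gamma3V.
by rewrite mobM mobV e mulgV.
Qed.

Lemma Gamma_subgroup : is_subgroup Gamma.
Proof.
split.
- by exists 1%g; [exact: Gamma3_1|exact: mob1].
- by move=> _ _ [g g3 <-] [h h3 <-]; exists (g * h)%g; [exact: Gamma3M|rewrite mobM].
- by move=> _ [g g3 <-]; exists g^-1%g; [exact: Gamma3V|rewrite mobV].
Qed.

Lemma mobX g n : mob (g ^+ n)%g = (mob g ^+ n)%g.
Proof. by elim: n => [|n IH]; rewrite ?mob1 // !expgS mobM IH. Qed.

Lemma Gamma_torsion_free : torsion_free Gamma.
Proof.
move=> _ n [g g3 <-] n0 gn; rewrite (@Gamma3_torsion_free g n) ?mob1 //.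
apply: (@mob_inj1 R); last by rewrite mobX.
by elim: n {n0 gn} => [|n IH]; [exact: Gamma3_1|rewrite expgS; exact: Gamma3M].
Qed.

Lemma gens_smallest (Y : seq U) :
  mob @` [set g | gens Y g] = smallest (@is_subgroup (PU21 R)) (mob @` [set` Y]).
Proof.
apply/seteqP; split=> [_ [g gY <-]|f].
  move=> H [[H1 HM HV] YH]; elim: gY => [x xY||x y _ Hx _ Hy|x _ Hx].
  - by apply: YH; exists x.
  - by rewrite mob1.
  - by rewrite mobM; exact: HM.
  - by rewrite mobV; exact: HV.
apply; split; last by move=> _ [g gY <-]; exists g => //; exact: gen_in.
split.
- by exists 1%g; [exact: gen_one|exact: mob1].
- move=> _ _ [x xY <-] [y yY <-]; exists (x * y)%g; [exact: gen_mul|exact: mobM].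
- by move=> _ [x xY <-]; exists x^-1%g; [exact: gen_inv|exact: mobV].
Qed.

Lemma Gamma_fibration : exists rho : PU21 R -> int,
  [/\ homomorphism_to_int Gamma rho, rho @` Gamma = [set: int]
    & finitely_generated (hom_kernel Gamma rho)].
Proof.
have [r [rM [g1 g13 rg1] [Y hY]]] := Gamma3_fibration.
pose rho (f : PU21 R) : int := 
  if pselect (exists2 g, Gamma3 g & mob g = f) is left e then r (s2val (cid2 e)) else 0.
have rhoE g : Gamma3 g -> rho (mob g) = r g.
  move=> g3; rewrite /rho; case: pselect => [e|[]]; last by exists g.
  by case: (cid2 e) => h h3 hg /=; congr r; apply: mob_inj.
have r1 : r 1%g = 0.
  by have := rM _ _ Gamma3_1 Gamma3_1; rewrite mul1g => /eqP; rewrite -subr_eq subrr eq_sym => /eqP.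
have rV g : Gamma3 g -> r g^-1%g = - r g.
  move=> g3; apply/eqP; rewrite -subr_eq0 opprK -rM //; last exact: Gamma3V.
  by rewrite mulVg r1.
exists rho; split.
- by move=> _ _ [g g3 <-] [h h3 <-]; rewrite -mobM !rhoE ?rM //; exact: Gamma3M.
- apply/seteqP; split=> // k _.
  have X (n : nat) : Gamma3 (g1 ^+ n)%g /\ r (g1 ^+ n)%g = n%:R.
    elim: n => [|n [h3 IH]]; first by split; [exact: Gamma3_1|].
    by rewrite expgS; split; [exact: Gamma3M|rewrite rM // rg1 IH -natr1 addrC].
  suff [g g3 e] : exists2 g, Gamma3 g & r g = k.
    by exists (mob g); [exists g|rewrite rhoE].
  case: k => n.
    by have [h3 e] := X n; exists (g1 ^+ n)%g => //; rewrite e natz.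
  have [h3 e] := X n.+1; exists (g1 ^+ n.+1)^-1%g; first exact: Gamma3V.
  by rewrite rV // e NegzE natz.
- exists (mob @` [set` Y]); first exact/finite_image/finite_seq.
  rewrite -gens_smallest; apply/seteqP; split=> [_ [[g g3 <-] /=]|_ [g /hY[g3 g0] <-]].
    by rewrite rhoE // => g0; exists g => //; apply/hY.
  by split; [exists g|rewrite /= rhoE].
Qed.
End GammaGroup.

(** * Discreteness *)

Section SquaredNorm.
Variable R : realType.
Notation C := R[i].
Implicit Types (x y : C) (z q : 'rV[C]_2).

(** The squared modulus as a real number, so that estimates take place in the ordered field [R]
    rather than in [R[i]]. *)
Definition normsq x : R := complex.Re x ^+ 2 + complex.Im x ^+ 2.

Lemma normsq_ge0 x : 0 <= normsq x. Proof. by rewrite addr_ge0 ?sqr_ge0. Qed.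
Lemma normsqE x : `|x| ^+ 2 = (normsq x)%:C%C.
Proof. by rewrite -add_Re2_Im2. Qed.
Lemma normsqM x y : normsq (x * y) = normsq x * normsq y.
Proof. by case: x y => [a b] [c d]; rewrite /normsq /=; ring. Qed.
Lemma normsqN x : normsq (- x) = normsq x.
Proof. by case: x => [a b]; rewrite /normsq /=; ring. Qed.
Lemma normsqJ x : normsq x^* = normsq x.
Proof. by case: x => [a b]; rewrite /normsq /=; ring. Qed.
Lemma normsq0 : normsq 0 = 0. Proof. by rewrite /normsq /=; ring. Qed.
Lemma normsq1 : normsq 1 = 1. Proof. by rewrite /normsq /=; ring. Qed.
Lemma normsq_eq0 x : normsq x = 0 -> x = 0.
Proof.
case: x => [a b]; rewrite /normsq /= => /eqP; rewrite paddr_eq0 ?sqr_ge0 // !sqrf_eq0.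
by move=> /andP[/eqP -> /eqP ->].
Qed.
Lemma normsq_gt0 x : x != 0 -> 0 < normsq x.
Proof. by move=> h; rewrite lt_def normsq_ge0 andbT; apply: contra h => /eqP/normsq_eq0 ->. Qed.
Lemma normsqV x : normsq x^-1 = (normsq x)^-1.
Proof.
have [->|x0] := eqVneq x 0; first by rewrite invr0 normsq0 invr0.
apply: (mulfI (lt0r_neq0 (normsq_gt0 x0))).
by rewrite -normsqM !divff ?normsq1 ?(lt0r_neq0 (normsq_gt0 x0)).
Qed.
Lemma normsqD_le x y e : 0 < e -> normsq (x + y) <= (1 + e^-1) * normsq x + (1 + e) * normsq y.
Proof.
move=> e0; rewrite -subr_ge0.
case: x y => [a b] [c d]; rewrite /normsq /=.
have -> : (1 + e^-1) * (a ^+ 2 + b ^+ 2) + (1 + e) * (c ^+ 2 + d ^+ 2) -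
  ((a + c) ^+ 2 + (b + d) ^+ 2) = e^-1 * ((a - e * c) ^+ 2 + (b - e * d) ^+ 2).
  by field; rewrite gt_eqF.
by rewrite mulr_ge0 ?invr_ge0 ?(ltW e0) // addr_ge0 ?sqr_ge0.
Qed.
Lemma normsq_dot (x y x' y' : C) :
  normsq (x * x' + y * y') <= (normsq x + normsq y) * (normsq x' + normsq y').
Proof.
rewrite -subr_ge0.
have -> : (normsq x + normsq y) * (normsq x' + normsq y') - normsq (x * x' + y * y') = normsq (x * y'^* - y * x'^*).
  by case: x y x' y' => [a b] [c d] [a' b'] [c' d']; rewrite /normsq /=; ring.
exact: normsq_ge0.
Qed.
Lemma normsq_emb (x : O) : normsq (@emb R x) = (enorm x)%:~R.
Proof.
have := @sqr_sqrtr R 3 (ler0n _ _).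
case: x => a b; rewrite /normsq /enorm /= !(rmorphD, rmorphN, rmorphXn, rmorphM) /=.
move: (Num.sqrt 3) => r r3.
have -> : (b%:~R * (r / 2)) ^+ 2 = b%:~R ^+ 2 * r ^+ 2 / 4 :> R by field.
by rewrite r3; field.
Qed.

Definition defect z : R := 1 - normsq (z 0 0) - normsq (z 0 1).

Lemma defect_sqnorm z : 1 - sqnorm z = (defect z)%:C%C.
Proof. by apply: complex_eq; rewrite sqnorm2 !normsqE /defect /=; ring. Qed.

Lemma B2_defect z : B2 R z <-> 0 < defect z.
Proof. by rewrite /B2 /= -subr_gt0 defect_sqnorm ltcR. Qed.

Lemma ballform_normsq (v : vec C) : ballform v v = (normsq v.1.1 + normsq v.1.2 - normsq v.2)%:C%C.
Proof. by apply: complex_eq; rewrite /ballform -!normCK !normsqE /=; ring. Qed.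

Lemma defect_frac (a : mat C) z : pres a -> den a z != 0 ->
  defect (frac a z) = defect z / normsq (den a z).
Proof.
move=> pa d0; have := ballform_frac pa d0.
rewrite !ballform_normsq normsqE /homog /=.
move=> /(congr1 (@complex.Re R)) /=; rewrite !normsq1 mul0r subr0 => e.
have d1 := lt0r_neq0 (normsq_gt0 d0).
by apply: (mulIf d1); rewrite divfK // /defect; apply: oppr_inj; rewrite -mulNr !opprB; lra.
Qed.

End SquaredNorm.
Lemma eis_finite (k : int) : exists L : seq O, forall x, enorm x <= k -> x \in L.
Proof.
pose K := `|k|%N.*2; pose r : seq int := [seq n%:Z - K%:Z | n <- iota 0 K.*2.+1].
have hr (m : int) : m ^+ 2 <= 2 * k -> m \in r.
  move=> h; apply/mapP; exists (absz (m + K%:Z)%R); last by rewrite /K in h *; nia.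
  by rewrite mem_iota /K in h *; nia.
exists [seq Eis a b | a <- r, b <- r] => -[a b] h.
by rewrite /enorm /= in h; apply: allpairs_f; apply: hr; nia.
Qed.

Section Finiteness.
Variable R : realType.
Notation C := R[i].
Notation ball_mx := (@ball_mx R).
Notation ball_mx_pres := (@ball_mx_pres R).

Lemma ball_mxE g : ball_mx g = memb R (mm cayley (mm (val g) cayleyV)).
Proof. by rewrite /ball_mx !memb_mm. Qed.

Lemma ball_mx_row (g : U) : normsq (ball_mx g).2.1.1 + normsq (ball_mx g).2.1.2 - normsq (ball_mx g).2.2 = -1.
Proof.
have K : mm (ball_mx g) (ball_mx g^-1%g) = I3 _ by rewrite -ball_mxM mulgV ball_mx1.
have key w : ballform (mv (ball_mx g^-1%g) (0, 0, 1)) w = - (mv (ball_mx g) w).2^*.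
  rewrite -(ball_mx_pres g) -mv_mm K mv1 /ballform /= !mul0r mul1r !add0r; done.
have := ball_mx_pres g^-1%g (0, 0, 1) (0, 0, 1); rewrite ballform_normsq.
have c1 := key (1, 0, 0); have c2 := key (0, 1, 0); have c3 := key (0, 0, 1).
move: c1 c2 c3; move: (mv _ (0, 0, 1)) => [[u1 u2] u3].
move: (ball_mx g) {K key} => m; rewrite /mv /dotp /ballform /= !(conjC0, conjC1, mulr0, mulr1, addr0, add0r, subr0).
move=> -> -> /eqP; rewrite eqr_opp => /eqP ->.
by move=> /(congr1 (@complex.Re R)) /=; rewrite !normsqN !normsqJ.
Qed.

Lemma ball_mx_col (g : U) : [/\ normsq (ball_mx g).1.1.1.1 + normsq (ball_mx g).1.2.1.1 = 1 + normsq (ball_mx g).2.1.1,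
  normsq (ball_mx g).1.1.1.2 + normsq (ball_mx g).1.2.1.2 = 1 + normsq (ball_mx g).2.1.2 &
  normsq (ball_mx g).1.1.2 + normsq (ball_mx g).1.2.2 = normsq (ball_mx g).2.2 - 1].
Proof.
have p := ball_mx_pres g.
have := p (1, 0, 0) (1, 0, 0); have := p (0, 1, 0) (0, 1, 0); have := p (0, 0, 1) (0, 0, 1).
move: (ball_mx g) {p} => m; rewrite !ballform_normsq /mv /dotp /= !(mulr0, mulr1, addr0, add0r).
move=> /(congr1 (@complex.Re R)) /= + /(congr1 (@complex.Re R)) /= + /(congr1 (@complex.Re R)) /=.
by rewrite !normsq0 !normsq1; split; lra.
Qed.

(* The function z |-> |p z1 + q z2 + r| is bounded below on compact subsets of
   the ball when |p|^2 + |q|^2 <= |r|^2, by Cauchy-Schwarz. *)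
Lemma affine_lower_bound (p q r : C) z : B2 R z -> normsq p + normsq q <= normsq r ->
  normsq r * defect z ^+ 3 <= 2 * normsq (p * z 0 0 + q * z 0 1 + r).
Proof.
move=> /B2_defect s0 e.
have s1 : defect z <= 1 by rewrite /defect; have := normsq_ge0 (z 0 0); have := normsq_ge0 (z 0 1); lra.
have cs := normsq_dot p q (z 0 0) (z 0 1).
have := normsqD_le (p * z 0 0 + q * z 0 1 + r) (- (p * z 0 0 + q * z 0 1)) s0.
rewrite normsqN addrAC subrr add0r.
have es : normsq (z 0 0) + normsq (z 0 1) = 1 - defect z by rewrite /defect; ring.
move: s0 s1 cs; rewrite es; set s := defect z; set d := normsq (_ + r); set u := normsq (_ + _).
have r0 := normsq_ge0 r; have d0 : 0 <= d := normsq_ge0 _.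
move=> s0 s1 cs h.
have h1 : (1 + s) * u <= (1 - s ^+ 2) * normsq r.
  rewrite (_ : (1 - s ^+ 2) * normsq r = (1 + s) * (normsq r * (1 - s))); last ring.
  rewrite ler_wpM2l //; first lra.
  by apply: le_trans cs _; rewrite ler_wpM2r //; lra.
have h2 : (1 + s^-1) * d * s = (s + 1) * d by field; rewrite gt_eqF.
have : normsq r * s ^+ 2 <= (1 + s^-1) * d by lra.
by move=> /(ler_wpM2r (ltW s0)); rewrite h2 -mulrA -exprSr; nra.
Qed.

Lemma den_bound (g : U) z : B2 R z ->
  normsq (ball_mx g).2.2 * defect z ^+ 3 <= 2 * normsq (den (ball_mx g) z).
Proof.
move=> zB; have := ball_mx_row g; rewrite /den; move: (ball_mx g) => [? [[p q] r]] /=.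
rewrite /mv /dotp /= mulr1 => e; apply: affine_lower_bound => //; lra.
Qed.

(** A bound on the denominator at z bounds the last entry of the matrix by [den_bound], and the
    relations of [ball_mx_row] and [ball_mx_col] then bound all the others, which are Eisenstein
    integers. *)
Lemma finite_den z (M : R) : B2 R z ->
  exists L : seq U, forall g, normsq (den (ball_mx g) z) <= M -> g \in L.
Proof.
move=> zB; have s0 := (B2_defect z).1 zB.
pose A := 2 * M / defect z ^+ 3; pose k := Num.ceil A.
have [Lx hLx] := eis_finite k.
pose Lv : seq (vec O) := [seq (ab, c) | ab <- [seq (a, b) | a <- Lx, b <- Lx], c <- Lx].
pose Lm : seq (mat O) := [seq (ab, c) | ab <- [seq (a, b) | a <- Lv, b <- Lv], c <- Lv].
exists (pmap insub [seq mm cayleyV (mm m cayley) | m <- Lm]) => g hg.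
rewrite mem_pmap_sub; apply/mapP; exists (mm cayley (mm (val g) cayleyV)); last first.
  by rewrite -!mmA cayleyVK mmr1 mmA cayleyVK mm1.
have hA : normsq (ball_mx g).2.2 <= A.
  rewrite /A ler_pdivlMr ?exprn_gt0 // (le_trans (den_bound g zB)) //.
  by rewrite ler_pM2l.
have [c1 c2 c3] := ball_mx_col g; have rw := ball_mx_row g.
move: hA c1 c2 c3 rw; rewrite ball_mxE; move: (mm cayley _) => m.
have N (x : O) : 0 <= normsq (emb R x) := normsq_ge0 _.
have X (x : O) : normsq (emb R x) <= A -> x \in Lx.
  move=> h; apply: hLx; rewrite -(ler_int R) -normsq_emb (le_trans h) //.
  exact: ceil_ge.
case: m => [[[[a1 a2] a3] [[b1 b2] b3]] [[d1 d2] d3]] /= h0 h1 h2 h3 h4.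
have P (T : eqType) (l : seq T) a b c : a \in l -> b \in l -> c \in l ->
    (a, b, c) \in [seq (ab, c) | ab <- [seq (a, b) | a <- l, b <- l], c <- l].
  by move=> ha hb hc; do 2?apply: allpairs_f.
have := (N a1, N a2, N a3, N b1, N b2, N b3, N d1, N d2, N d3).
move=> [[[[[[[[n1 n2'] n3] n4] n5] n6] n7] n8] n9].
by apply: (P); apply: (P); apply: X; lra.
Qed.

Lemma den_orbit (g : U) z w : frac (ball_mx g) z = w -> B2 R z ->
  normsq (den (ball_mx g) z) = defect z / defect w.
Proof.
move=> <- zB; have d0 := den_neq0 (ball_mx_pres g) zB.
have s0 := (B2_defect z).1 zB; rewrite defect_frac //; last exact: ball_mx_pres.
by field; rewrite !gt_eqF ?normsq_gt0.
Qed.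

(** All powers of g fix z, hence have denominator of modulus 1 there, so finitely many elements
    occur among them; two powers coincide and torsion-freeness concludes. *)
Lemma Gamma3_free g z : Gamma3 g -> B2 R z -> frac (ball_mx g) z = z -> g = 1%g.
Proof.
move=> g3 zB gz; have [L hL] := finite_den 1 zB.
have X n : frac (ball_mx (g ^+ n)%g) z = z.
  elim: n => [|n IH]; first by rewrite expg0 ball_mx1 frac1.
  by rewrite expgS ball_mxM frac_mm ?IH // (den_neq0 (ball_mx_pres _)).
have XL n : (g ^+ n)%g \in L.
  by apply: hL; rewrite (den_orbit (X n) zB) divff // gt_eqF //; apply/B2_defect.
have [u|/(uniqPn 1%g)[i [j [ij]]]] := boolP (uniq [seq (g ^+ n)%g | n <- iota 0 (size L).+1]).
  have := uniq_leq_size u (s2 := L); rewrite size_map size_iota ltnn => h.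
  by have : false by apply: h => _ /mapP[n _ ->].
rewrite size_map size_iota => jL; rewrite !(nth_map 0%N) ?size_iota //; last exact: ltn_trans ij jL.
rewrite !nth_iota // ?(ltn_trans ij jL) // !add0n => e.
apply: (@Gamma3_torsion_free g (j - i)) => //; first by rewrite subn_gt0.
by apply: (mulgI (g ^+ i)%g); rewrite -expgnDr subnKC ?(ltnW ij) // mulg1 e.
Qed.
End Finiteness.

Section Discrete.
Variable R : realType.
Notation C := R[i].
Notation mob := (@mob R).
Notation ball_mx := (@ball_mx R).

Lemma eval_open (p : B2 R) (A : set 'rV[C]_2) : open A ->
  open [set f : PU21 R | A (\val (f p))].
Proof.
move=> oA.
have oA' : open ((fun w : B2 R => \val w) @^-1` A) by exists A.
exists ([set f : {compact-open, B2 R -> B2 R} | f @` [set p] `<=` (fun w : B2 R => \val w) @^-1` A]).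
  exact: (@compact_open_open (B2 R) (B2 R) [set p] _ (@compact_set1 _ p) oA').
by apply/seteqP; split=> f /= h; [apply: h; exists p|move=> _ [_ -> <-]].
Qed.

Lemma B2_0 : B2 R 0.
Proof. by rewrite /B2 /= sqnorm2 !mxE normr0 expr0n addr0. Qed.

(** Evaluation at the origin confines a neighbourhood of f to finitely many elements by
    [finite_den]; each of them other than f is excluded by evaluation at a point where it differs
    from f. *)
Lemma Gamma_discrete : discrete_subgroup (Gamma (R := R)).
Proof.
move=> f Gf; split; first exact: mem_set.
pose o : B2 R := SigSub (mem_set B2_0).
pose w := \val (f o).
have wB : B2 R w := in_ball (f o).
have [e e0 he] := sqnorm_near wB.
have sw : 0 < defect w by apply/B2_defect.
have [L hL] := finite_den (2 / defect w) B2_0.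
pose V0 := [set h : PU21 R | ball w e (\val (h o))].
have V0L g : V0 (mob g) -> g \in L.
  move=> h; apply: hL; rewrite (den_orbit (w := \val (mob g o)) erefl B2_0).
  have : defect w / 2 < defect (\val (mob g o)).
    move: h; rewrite /V0 /= -ball_normE /= distrC => /he; rewrite subrK !defect_sqnorm.
    rewrite (_ : (defect w)%:C%C / 2 = (defect w / 2)%:C%C) ?ltcR //.
    by rewrite (rmorphM (real_complex R)) (fmorphV (real_complex R)) (rmorph_nat (real_complex R)).
  move=> h1; have -> : defect (0 : 'rV[C]_2) = 1 by rewrite /defect !mxE !normsq0 !subr0.
  have h2 : 0 < defect (\val (mob g o)) by apply: lt_trans h1; rewrite divr_gt0.
  by rewrite div1r -[2 / _]invf_div lef_pV2 ?posrE ?divr_gt0 // ltW.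
pose W (g : U) := [set h : PU21 R | mob g = f \/ exists2 p, f p <> mob g p & h p <> mob g p].
have Wn g : nbhs f (W g).
  have [E|/eqP N] := eqVneq (mob g) f.
    by apply: filterS (filterT) => h _; left.
  have [p hp] : exists p, f p <> mob g p.
    by apply: contrapT => /forallNP H; apply: N; apply: PU21_eq => p; have /contrapT := H p.
  have oA : open (~` [set \val (mob g p)]) by apply: closed_openC; apply: accessible_closed_set1; apply: hausdorff_accessible; exact: norm_hausdorff.
  apply: (@filterS _ _ _ [set h : PU21 R | (~` [set \val (mob g p)]) (\val (h p))]).
    by move=> h /= H; right; exists p => // E; apply: H; rewrite E.
  apply: open_nbhs_nbhs; split; first exact: eval_open.
  by move=> /= E; apply: hp; apply: val_inj.
exists (V0 `&` [set h | forall g, g \in L -> W g h]).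
  apply: filterI.
    apply: open_nbhs_nbhs; split; last exact: ballxx.
    by apply: eval_open; apply: ball_open.
  elim: L {hL V0L} => [|g L IH]; first by apply: filterS filterT.
  apply: filterS (filterI (Wn g) IH) => h [hg hL] k.
  by rewrite inE => /predU1P[->|/hL].
apply/seteqP; split=> [h [[h0 hLh] [g g3 gh]]|_ ->] /=.
  have gL : g \in L by apply: V0L; rewrite gh.
  have [<- //|[p _]] := hLh g gL.
  by rewrite gh.
split=> //; split; first exact: ballxx.
move=> g gL; have [E|/eqP N] := eqVneq (mob g) f; first by left.
right; apply: contrapT => H; apply: N; apply: PU21_eq => p.
by apply: contrapT => E; apply: H; exists p => /esym.
Qed.
End Discrete.

(** * Reduction to cones at the cusps *)

Section Reduction.
Variable R : realType.
Notation C := R[i].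
Notation ball_mx := (@ball_mx R).
Notation ball_mx_pres := (@ball_mx_pres R).
Notation emb := (@emb R).
Implicit Types (z q : 'rV[C]_2).

Definition distsq z q : R := normsq (z 0 0 - q 0 0) + normsq (z 0 1 - q 0 1).
(* For q on the sphere this is a nontangential region with vertex q. *)
Definition cone q (k : R) z : Prop := k * distsq z q <= defect z ^+ 2.
(** The boundary point of the cusp [e1], which [cayley] maps to (1, 0, 1). *)
Definition cusp_q0 : 'rV[C]_2 := \row_j (j == 0)%:R.

Lemma cusp_q0_0 : cusp_q0 0 0 = 1. Proof. by rewrite mxE. Qed.
Lemma cusp_q0_1 : cusp_q0 0 1 = 0. Proof. by rewrite mxE. Qed.

Definition siegel z : vec C := mv (memb R cayleyV) (homog z).

Lemma ball_mx_siegel g z : mv (ball_mx g) (homog z) = mv (memb R cayley) (mv (memb R (val g)) (siegel z)).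
Proof. by rewrite /ball_mx !mv_mm. Qed.

Lemma siegelform_siegel z : siegelform (siegel z) (siegel z) = - (defect z)%:C%C.
Proof.
rewrite -ballform_Cm -!mv_mm -memb_mm cayleyK memb1 mv1 ballform_homog -defect_sqnorm; ring.
Qed.

Lemma siegelform_e1 (v : vec C) : siegelform v (1, 0, 0) = v.2.
Proof. by rewrite /siegelform /= conjC0 conjC1; ring. Qed.

Lemma vemb_e1 : vemb R e1 = (1, 0, 0).
Proof. by rewrite /vemb /= rmorph0 rmorph1. Qed.

Lemma ballform_lower_bound z (v : vec C) : B2 R z -> normsq v.1.1 + normsq v.1.2 - normsq v.2 = 0 ->
  normsq v.2 * defect z ^+ 3 <= 2 * normsq (ballform (homog z) v).
Proof.
case: v => [[p q] r] /= zB e; rewrite -(normsqJ r) -normsqN.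
have -> : ballform (homog z) (p, q, r) = p^* * z 0 0 + q^* * z 0 1 + - r^*.
  by rewrite /ballform /=; ring.
by apply: affine_lower_bound => //; rewrite normsqN !normsqJ; lra.
Qed.

Lemma ballform_integral_lower_bound z (N : vec O) : B2 R z -> N.2 != 0 ->
  normsq (emb N.1.1) + normsq (emb N.1.2) - normsq (emb N.2) = 0 ->
  defect z ^+ 3 / 2 <= normsq (ballform (homog z) (vemb R N)).
Proof.
move=> zB N3 e; have h := ballform_lower_bound zB (v := vemb R N) e.
have N31 : 1 <= normsq (vemb R N).2.
  rewrite normsq_emb (_ : 1 = 1%:~R) // ler_int.
  by have := enorm_ge0 N.2; have := enorm_eq0 N.2; rewrite (negPf N3); lia.
have s0 : 0 < defect z ^+ 3 by rewrite exprn_gt0 //; apply/B2_defect.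
have aux (u c w : R) : 0 < c -> 1 <= u -> u * c <= 2 * w -> c / 2 <= w by nra.
exact: aux s0 N31 h.
Qed.

(** By unitarity the third coordinate is the product of z with an integral null vector; its last
    coordinate is a nonzero Eisenstein integer, of norm at least 1. This makes the infimum in
    [siegel_reduce] positive. *)
Lemma siegel_lower_bound (g : U) z : B2 R z ->
  defect z ^+ 3 / 2 <= normsq (mv (memb R (val g)) (siegel z)).2.
Proof.
move=> zB; rewrite -siegelform_e1 -vemb_e1.
have -> : vemb R e1 = mv (memb R (val g)) (vemb R (act g^-1%g e1)).
  by rewrite -vemb_mv -[mv _ _]/(act g _) actVK.
rewrite siegelform_act -ballform_Cm -mv_mm -memb_mm cayleyK memb1 mv1 -vemb_mv.
set n := act _ _; set N := mv cayley n.
have n0 : n != (0, 0, 0).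
  apply/eqP => h.
  by have := actVK g e1; rewrite -/n h => /(congr1 (fun v => v.1.1)); rewrite /act /mv /dotp /= !mulr0.
have : ballform (vemb R N) (vemb R N) = 0.
  rewrite /N vemb_mv ballform_Cm siegelform_vemb herm_act herm_e1; exact: rmorph0.
rewrite ballform_normsq => /(congr1 (@complex.Re R)) e'.
have {e'} e : normsq (emb N.1.1) + normsq (emb N.1.2) - normsq (emb N.2) = 0 := e'.
have N3 : N.2 != 0.
  apply: contra n0 => /eqP N3.
  move: e; rewrite N3 rmorph0 normsq0 subr0 => /eqP; rewrite paddr_eq0 ?normsq_ge0 //.
  move=> /andP[/eqP/normsq_eq0 N1 /eqP/normsq_eq0 N2].
  have -> : n = mv cayleyV N by rewrite /N -mv_mm cayleyVK mv1.
  have -> : N = (0, 0, 0).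
    rewrite [N]surjective_pairing [N.1]surjective_pairing N3; congr (_, _, _).
    by apply: (@emb_inj R); rewrite N1 rmorph0.
    by apply: (@emb_inj R); rewrite N2 rmorph0.
  by [].
exact: ballform_integral_lower_bound.
Qed.

Lemma round_eisC (x : C) : exists b : O, normsq (x + emb b) <= 1/3.
Proof.
have sq3 := @sqr_sqrtr R 3 (ler0n _ _).
have r0 : Num.sqrt 3 != 0 :> R by rewrite gt_eqF ?sqrtr_gt0 ?ltr0n.
case: x => u v; pose y := 2 * v / Num.sqrt 3.
have [m [n h]] := round_eis (u + y / 2) y.
exists (Eis (- m) (- n)); apply: le_trans h.
rewrite /normsq /emb /= !rmorphN /=.
have -> : v = y * (Num.sqrt 3 / 2) by rewrite /y; field.
by rewrite -mulrDl exprMn exprMn sq3 /qf le_eqVlt; apply/orP; left; apply/eqP; field.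
Qed.

Lemma round_Im (x : C) (b : O) : exists j : int,
  complex.Im (x + emb (Eis j (height b j))) ^+ 2 <= 3/4.
Proof.
have sq3 := @sqr_sqrtr R 3 (ler0n _ _).
have r0 : Num.sqrt 3 != 0 :> R by rewrite gt_eqF ?sqrtr_gt0 ?ltr0n.
case: x => u v; pose y := 2 * v / Num.sqrt 3.
have [j h] := round_even (- y - (enorm b)%:~R).
exists j; rewrite /height /= rmorphD rmorphM /=.
have -> : v = y * (Num.sqrt 3 / 2) by rewrite /y; field.
rewrite -mulrDl exprMn exprMn sq3; move: h; rewrite (_ : 2%:~R = 2) //.
set J := j%:~R; set E := (enorm b)%:~R => h.
have -> : y + (2 * J + E) = 2 * J - (- y - E) by ring.
by lra.
Qed.

(* Choose g nearly minimizing the third coordinate; comparing it with [swap * g]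
   then bounds A from below. *)
Lemma siegel_reduce z : B2 R z -> exists (g : U) (A B y : C),
  [/\ mv (memb R (val g)) (siegel z) = vscale y (A, B, 1), y != 0,
      normsq B <= 1/3, complex.Im A ^+ 2 <= 3/4 & 9/10 <= normsq A].
Proof.
move=> zB; pose Y (g : U) := mv (memb R (val g)) (siegel z).
have s0 : 0 < defect z ^+ 3 / 2 by rewrite divr_gt0 // exprn_gt0 //; apply/B2_defect.
pose E := [set normsq (Y g).2 | g in [set: U]].
have lbE : lbound E (defect z ^+ 3 / 2) by move=> _ [g _ <-]; exact: siegel_lower_bound.
have E1 : has_inf E by split; [exists (normsq (Y 1%g).2); exists 1%g|exists (defect z ^+ 3 / 2)].
have iE : defect z ^+ 3 / 2 <= inf E by apply: lb_le_inf => //; case: E1.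
have i0 : 0 < inf E := lt_le_trans s0 iE.
(* Within a factor 10/9 of the infimum: since |A y|^2, the value for [swap], is at least the
   infimum, |A|^2 >= 9/10. *)
have [_ [g _ <-] hg] := inf_adherent (divr_gt0 i0 (ltr0n R 9)) E1.
have Y0 : (Y g).2 != 0.
  apply/eqP => h; have : inf E <= normsq (Y g).2 by apply: ge_inf; [case: E1|exists g].
  by rewrite h normsq0; lra.
set y := (Y g).2 in Y0; pose B0 := (Y g).1.2 / y; pose A0 := (Y g).1.1 / y.
have [b hb] := round_eisC B0.
have [j hj] := round_Im (A0 - emb (econj b) * B0) b.
exists (tr b j * g)%g, (A0 - emb (econj b) * B0 + emb (Eis j (height b j))), (B0 + emb b), y.
have eY : Y (tr b j * g)%g = vscale y (A0 - emb (econj b) * B0 + emb (Eis j (height b j)), B0 + emb b, 1).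
  rewrite /Y [val _]/(mm (tr_mx b j) (val g)) memb_mm mv_mm -/(Y g).
  rewrite [Y g]surjective_pairing [(Y g).1]surjective_pairing -/y.
  have -> : (Y g).1.1 = y * A0 by rewrite mulrC divfK.
  have -> : (Y g).1.2 = y * B0 by rewrite mulrC divfK.
  rewrite /vscale /mv /dotp /memb /vemb /= rmorphN rmorph0 rmorph1.
  by apply: vec_eq; ring.
split=> //.
set A := (A0 - _ + _) in eY *; set B := B0 + _ in eY *.
have : inf E <= normsq (Y (swap * (tr b j * g))%g).2 by apply: ge_inf; [case: E1|exists (swap * (tr b j * g))%g].
have -> : Y (swap * (tr b j * g))%g = mv (memb R (val swap)) (Y (tr b j * g)%g).
  by rewrite /Y [val (swap * _)%g]/(mm (val swap) (val (tr b j * g)%g)) memb_mm mv_mm.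
rewrite eY /mv /dotp /memb /vemb /= rmorph0 rmorph1 !mul0r mul1r !addr0 normsqM.
have y0 : 0 < normsq y by rewrite normsq_gt0.
move: hg; rewrite -/y => hg h; nra.
Qed.

Lemma mv_cayley (v : vec C) : mv (memb R cayley) v =
  (v.1.1 + (1 + emb (Eis 0 1)) * v.2, v.1.2, v.1.1 + emb (Eis 0 1) * v.2).
Proof.
have om : emb (Eis 1 1) = 1 + emb (Eis 0 1) by rewrite -(rmorph1 emb) -rmorphD.
by apply: vec_eq; rewrite /dotp /= ?om rmorph0 ?rmorph1; ring.
Qed.

(** The lower bound 9/10 forces t >= 2/5, whence 2 |A|^2 + 2 <= 25 t^2 for A = a1 + i a2; the
    constant 3/100 is chosen so that 3/100 times 4/3 times 25 is 1. *)
Lemma cone_siegel (a1 a2 b t : R) : 0 <= b <= 1/3 -> a2 ^+ 2 <= 3/4 ->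
  9/10 <= a1 ^+ 2 + a2 ^+ 2 -> t = - (2 * a1 + b) -> 0 < t ->
  3/100 * (1 + b) * (2 * (a1 ^+ 2 + a2 ^+ 2) + 2) <= t ^+ 2.
Proof.
move=> hb ha hA tE t0; have e : a1 = - (t + b) / 2 by rewrite tE; field.
have h4 : 2/5 <= t.
  rewrite leNgt; apply/negP => h; move: hA; rewrite e; nra.
have h1 : a1 ^+ 2 <= t ^+ 2 by rewrite e; nra.
have h2 : 3/4 <= 5 * t ^+ 2 by nra.
have h3 : 2 * (a1 ^+ 2 + a2 ^+ 2) + 2 <= 25 * t ^+ 2 by nra.
apply: le_trans (_ : 3 / 100 * (1 + b) * (25 * t ^+ 2) <= _); last by nra.
by rewrite ler_wpM2l //; lra.
Qed.

(** With D the denominator and t = -(2 Re A + |B|^2), the squared distance to [cusp_q0] is |y|^2 (1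
    + |B|^2) / |D|^2 and the defect |y|^2 t / |D|^2. As |D|^2 <= |y|^2 (2 |A|^2 + 2), [cone_siegel]
    applies. *)
Lemma cone_reduce z : B2 R z -> exists g : U, cone cusp_q0 (3/100) (frac (ball_mx g) z).
Proof.
move=> zB; have [g [A [B [y [eY y0 hB hIm hA]]]]] := siegel_reduce zB; exists g.
have d0 := den_neq0 (ball_mx_pres g) zB.
have y1 := normsq_gt0 y0.
have sz : defect z = normsq y * - (2 * complex.Re A + normsq B).
  have := siegelform_siegel z; rewrite -(siegelform_act g) eY => /(congr1 (@complex.Re R)) h.
  apply: oppr_inj; rewrite -[- defect z]/(complex.Re (- (defect z)%:C%C)) -h /siegelform /vscale /normsq.
  by case: A B y {eY y0 hB hIm hA y1 h} => [A1 A2] [B1 B2] [y1 y2] /=; ring.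
have e := ball_mx_siegel g z; rewrite eY (mv_homog d0) mv_cayley in e.
have e1 := congr1 (fun v => v.1.1) e; have e2 := congr1 (fun v => v.1.2) e.
have {e} e3 := congr1 (fun v => v.2) e.
move: e1 e2 e3; rewrite /vscale /homog; cbn [fst snd].
set D := den _ _; set o := emb (Eis 0 1); rewrite !mulr1 => e1 e2 e3.
have eD : D = y * (A + o) by rewrite e3; ring.
have n2D : normsq D <= normsq y * (2 * normsq A + 2).
  rewrite eD normsqM ler_pM2l //; have := normsqD_le A o ltr01.
  by rewrite invr1 normsq_emb (_ : enorm (Eis 0 1) = 1) // (_ : 1 + 1 = 2) // mulr1.
have D1 : 0 < normsq D by rewrite normsq_gt0.
have ed : distsq (frac (ball_mx g) z) cusp_q0 = normsq y * (1 + normsq B) / normsq D.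
  rewrite /distsq cusp_q0_0 cusp_q0_1 subr0.
  have -> : frac (ball_mx g) z 0 0 - 1 = y / D.
    by apply: (mulfI d0); rewrite -/D mulrBr e1 mulr1 [RHS]mulrC divfK // e3; ring.
  have -> : frac (ball_mx g) z 0 1 = y * B / D.
    by apply: (mulfI d0); rewrite -/D e2 [RHS]mulrC divfK //; ring.
  by rewrite !normsqM normsqV -mulrDl; congr (_ / _); ring.
rewrite /cone ed defect_frac //; last exact: ball_mx_pres.
rewrite -/D exprMn exprVn mulrA ler_pdivlMr ?exprn_gt0 //.
set t := - (2 * complex.Re A + normsq B) in sz.
have t0 : 0 < t by move: (zB) => /B2_defect; rewrite sz pmulr_rgt0.
have b0 : 0 <= normsq B <= 1/3 by rewrite normsq_ge0.
have key := cone_siegel b0 hIm hA erefl t0.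
rewrite -/(normsq A) -/t in key.
rewrite sz (_ : _ * normsq D ^+ 2 = 3 / 100 * (normsq y * (1 + normsq B)) * normsq D); last by field; rewrite gt_eqF.
apply: (@le_trans _ _ (3 / 100 * (normsq y * (1 + normsq B)) * (normsq y * (2 * normsq A + 2)))).
  by rewrite ler_wpM2l // !mulr_ge0 ?normsq_ge0 //; lra.
rewrite exprMn (_ : 3 / 100 * _ * _ = normsq y ^+ 2 * (3 / 100 * (1 + normsq B) * (2 * normsq A + 2))); last ring.
by rewrite ler_wpM2l // sqr_ge0.
Qed.

(** The map divides the defect by |den z|^2 exactly and the squared distance to q by |den z|^2 up to
    a constant; since |den z| is bounded above on the ball, only the aperture of the cone
    changes. *)
Lemma cone_transfer (g : U) q k : den (ball_mx g) q != 0 -> 0 < k ->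
  exists2 k', 0 < k' & forall z, B2 R z -> cone q k z ->
    cone (frac (ball_mx g) q) k' (frac (ball_mx g) z).
Proof.
move=> dq k0; have pg := ball_mx_pres g; move: (ball_mx g) pg dq => a pa dq.
pose N (i : bool) z := if i then (mv a (homog z)).1.1 else (mv a (homog z)).1.2.
pose r (i : bool) := if i then a.1.1 else a.1.2.
pose al i := (r i).1.1 * den a q - N i q * a.2.1.1.
pose be i := (r i).1.2 * den a q - N i q * a.2.1.2.
have NE i z : N i z * den a q - N i q * den a z =
    al i * (z 0 0 - q 0 0) + be i * (z 0 1 - q 0 1).
  by rewrite /al /be /N /r /den; case: i; rewrite /mv /dotp /=; ring.
pose K := normsq (al true) + normsq (be true) + (normsq (al false) + normsq (be false)).
pose J := 1 + normsq a.2.1.1 + normsq a.2.1.2 + normsq a.2.2.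
have K0 : 0 <= K by rewrite /K; have := (normsq_ge0 (al true), normsq_ge0 (be true), normsq_ge0 (al false), normsq_ge0 (be false)) => -[[[]]]; lra.
have J0 : 0 < J by rewrite /J; have := normsq_ge0 a.2.1.1; have := normsq_ge0 a.2.1.2; have := normsq_ge0 a.2.2; lra.
have q1 := normsq_gt0 dq.
exists (k * normsq (den a q) / ((K + 1) * (4 * J))).
  by rewrite divr_gt0 ?mulr_gt0 //; lra.
move=> z zB; have dz := den_neq0 pa zB; have z1 := normsq_gt0 dz.
have hJ : normsq (den a z) <= 4 * J.
  have := normsqD_le (a.2.1.1 * z 0 0 + a.2.1.2 * z 0 1) a.2.2 ltr01.
  have := normsq_dot a.2.1.1 a.2.1.2 (z 0 0) (z 0 1).
  have : normsq (z 0 0) + normsq (z 0 1) <= 1 by move: (zB) => /B2_defect; rewrite /defect; lra.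
  have -> : den a z = a.2.1.1 * z 0 0 + a.2.1.2 * z 0 1 + a.2.2.
    by rewrite /den /mv /dotp /= mulr1.
  rewrite invr1 /J; have := normsq_ge0 a.2.1.1; have := normsq_ge0 a.2.1.2; have := normsq_ge0 a.2.2.
  have := normsq_ge0 (z 0 0); have := normsq_ge0 (z 0 1).
  move: (normsq a.2.1.1) (normsq a.2.1.2) (normsq a.2.2) (normsq (z 0 0)) (normsq (z 0 1)) => x y w u v.
  move: (normsq _) (normsq _) => m m' *; nra.
have dE : distsq (frac a z) (frac a q) * (normsq (den a z) * normsq (den a q)) <= K * distsq z q.
  have X i : N i z / den a z - N i q / den a q = (N i z * den a q - N i q * den a z) / (den a z * den a q).
    by field; rewrite dz dq.
  have -> : distsq (frac a z) (frac a q) =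
      normsq (N true z / den a z - N true q / den a q) + normsq (N false z / den a z - N false q / den a q).
    by rewrite /distsq !mxE.
  rewrite !X !NE !(normsqM _ (_^-1)) !normsqV !(normsqM (den a z)) -mulrDl divfK ?mulf_neq0 ?gt_eqF //.
  by rewrite [K * _](mulrDl (normsq (al true) + normsq (be true))); apply: lerD; apply: normsq_dot.
rewrite /cone defect_frac // => h.
have d0 : 0 <= distsq z q by rewrite /distsq; have := (normsq_ge0 (z 0 0 - q 0 0), normsq_ge0 (z 0 1 - q 0 1)) => -[]; lra.
move: dE h; rewrite exprMn exprVn ler_pdivlMr ?exprn_gt0 //.
have e0 : 0 <= distsq (frac a z) (frac a q).
  rewrite /distsq; set u := _ - _; set v := _ - _.
  by have := (normsq_ge0 u, normsq_ge0 v) => -[]; lra.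
move: (distsq (frac a z) _) e0 (distsq z q) d0 (normsq (den a z)) z1 hJ (normsq (den a q)) q1 (defect z) => e e0 d d0 Dz z1 hJ Dq q1 S dE h.
move: (4 * J) hJ => J' hJ; have c0 : 0 < (K + 1) * J' by rewrite mulr_gt0 //; lra.
rewrite (_ : k * Dq / ((K + 1) * J') * e * Dz ^+ 2 = k * (e * (Dz * Dq)) * Dz / ((K + 1) * J')); last ring.
rewrite ler_pdivrMr //.
have h1 : k * (e * (Dz * Dq)) <= K * S ^+ 2.
  by apply: le_trans (ler_wpM2l (ltW k0) dE) _; rewrite mulrCA ler_wpM2l.
apply: le_trans (ler_wpM2r (ltW z1) h1) _.
rewrite mulrAC mulrC ler_wpM2l ?sqr_ge0 //.
by apply: ler_pM => //; lra.
Qed.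

Lemma ballform_null0 (w : vec C) : ballform w w = 0 -> w.2 = 0 -> w = (0, 0, 0).
Proof.
case: w => [[x y] z] /= + z0; rewrite ballform_normsq /= z0 normsq0 subr0.
move=> /(congr1 (@complex.Re R)) /= /eqP; rewrite paddr_eq0 ?normsq_ge0 //.
by move=> /andP[/eqP/normsq_eq0 -> /eqP/normsq_eq0 ->].
Qed.

Lemma den_cusp_q0 (g : U) : den (ball_mx g) cusp_q0 != 0.
Proof.
apply/eqP => d0.
have h : ballform (homog cusp_q0) (homog cusp_q0) = 0.
  by rewrite /ballform /homog cusp_q0_0 cusp_q0_1 /= !conjC1 conjC0; ring.
rewrite -(ball_mx_pres g) in h; have w0 := ballform_null0 h d0.
have : mv (ball_mx g^-1%g) (mv (ball_mx g) (homog cusp_q0)) = homog cusp_q0 by rewrite -mv_mm -ball_mxM mulVg ball_mx1 mv1.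
rewrite w0; move: (ball_mx g^-1%g) => b /(congr1 (fun v => v.2)) /=.
by rewrite /dotp /= !mulr0 !addr0 => /eqP; rewrite eq_sym oner_eq0.
Qed.

Lemma reduction : exists L : seq ('rV[C]_2 * R), (forall p, p \in L -> 0 < p.2) /\
  forall z, B2 R z -> exists2 g, Gamma3 g & exists2 p, p \in L & cone p.1 p.2 (frac (ball_mx g) z).
Proof.
(* Induction over the residues modulo 3. For a class met by U a representative c is fixed; c^-1 g is
   in the congruence subgroup for g in that class, and the cone is carried along by c^-1. *)
suff [L [L0 hL]] : exists L : seq ('rV[C]_2 * R), (forall p, p \in L -> 0 < p.2) /\
  forall z (g : U), B2 R z -> mred3 (val g) \in M3s -> cone cusp_q0 (3/100) (frac (ball_mx g) z) ->
    exists2 g, Gamma3 g & exists2 p, p \in L & cone p.1 p.2 (frac (ball_mx g) z).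
  exists L; split=> // z zB; have [g hg] := cone_reduce zB.
  exact: hL zB (mem_M3s _) hg.
elim: M3s => [|r rs [L [L0 hL]]]; first by exists [::].
have [[c hc]|nc] := pselect (exists c : U, mred3 (val c) = r); last first.
  exists L; split=> // z g zB; rewrite inE => /orP[/eqP h|]; last exact: hL.
  by case: nc; exists g.
have k3 : 0 < 3/100 :> R by rewrite divr_gt0 // ltr0n.
have [k k0 hk] := cone_transfer (den_cusp_q0 c^-1%g) k3.
exists ((frac (ball_mx c^-1%g) cusp_q0, k) :: L); split.
  by move=> p; rewrite inE => /predU1P[->|/L0].
move=> z g zB; rewrite inE => /orP[/eqP h|h] cg; last first.
  have [g' g3 [p pL hp]] := hL z g zB h cg; exists g' => //.
  by exists p; rewrite // inE pL orbT.
have d0 := den_neq0 (ball_mx_pres g) zB.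
exists (c^-1 * g)%g.
  rewrite /Gamma3 [val _]/(mm (val c^-1%g) (val g)) mred3_mm h -hc -mred3_mm.
  by rewrite -[mm _ _]/(val (c^-1 * c)%g) mulVg Gamma3_1.
exists (frac (ball_mx c^-1%g) cusp_q0, k); first by rewrite inE eqxx.
by rewrite ball_mxM frac_mm //; apply: hk => //; apply: frac_B2 => //; exact: ball_mx_pres.
Qed.
End Reduction.

(** * The fundamental domain *)

Section Measurable.
Variable R : realType.
Notation C := R[i].
Notation RB := (measurableTypeR R).
Notation R4 := (RB * RB * RB * RB)%type.

Definition cmeasurable (f : R4 -> C) : Prop :=
  measurable_fun setT (fun x => complex.Re (f x) : RB) /\
  measurable_fun setT (fun x => complex.Im (f x) : RB).

Lemma cmeasurable_cst c : cmeasurable (fun=> c).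
Proof. by split; exact: measurable_cst. Qed.

Lemma cmeasurableD f g : cmeasurable f -> cmeasurable g -> cmeasurable (fun x => f x + g x).
Proof.
move=> [f1 f2] [g1 g2]; split.
  rewrite (_ : (fun _ => _) = (fun x => complex.Re (f x)) \+ (fun x => complex.Re (g x))).
    exact: measurable_funD.
  by apply/funext => x /=; case: (f x) (g x) => [? ?] [? ?].
rewrite (_ : (fun _ => _) = (fun x => complex.Im (f x)) \+ (fun x => complex.Im (g x))).
  exact: measurable_funD.
by apply/funext => x /=; case: (f x) (g x) => [? ?] [? ?].
Qed.

Lemma cmeasurableM f g : cmeasurable f -> cmeasurable g -> cmeasurable (fun x => f x * g x).
Proof.
move=> [f1 f2] [g1 g2]; split.
  rewrite (_ : (fun _ => _) = ((fun x => complex.Re (f x)) \* (fun x => complex.Re (g x)))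
     \- ((fun x => complex.Im (f x)) \* (fun x => complex.Im (g x)))).
    by apply: measurable_funB; apply: measurable_funM.
  by apply/funext => x /=; case: (f x) (g x) => [? ?] [? ?].
rewrite (_ : (fun _ => _) = ((fun x => complex.Re (f x)) \* (fun x => complex.Im (g x)))
     \+ ((fun x => complex.Im (f x)) \* (fun x => complex.Re (g x)))).
  by apply: measurable_funD; apply: measurable_funM.
by apply/funext => x /=; case: (f x) (g x) => [? ?] [? ?].
Qed.

Lemma measurable_normsq f : cmeasurable f -> measurable_fun setT (fun x => normsq (f x) : RB).
Proof.
move=> [f1 f2]; apply: measurable_funD; exact: measurable_funX.
Qed.

Lemma cmeasurableV f : cmeasurable f -> cmeasurable (fun x => (f x)^-1).
Proof.
move=> mf; have [f1 f2] := mf.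
have mi : measurable_fun setT (fun x => (normsq (f x))^-1 : RB).
  rewrite (_ : (fun _ => _) = (@powR R ^~ (-1)) \o (fun x => normsq (f x))).
    by apply: measurableT_comp (measurable_normsq mf); exact: measurable_powR.
  by apply/funext => x /=; rewrite powR_inv1 // normsq_ge0.
split.
  rewrite (_ : (fun _ => _) = (fun x => complex.Re (f x)) \* (fun x => (normsq (f x))^-1)).
    exact: measurable_funM.
  by apply/funext => x /=; case: (f x).
rewrite (_ : (fun _ => _) = (\- (fun x => complex.Im (f x))) \* (fun x => (normsq (f x))^-1)).
  by apply: measurable_funM => //; apply: measurable_funN.
by apply/funext => x /=; case: (f x) => a b; rewrite /= mulNr.
Qed.

Definition vmeasurable (F : R4 -> 'rV[C]_2) : Prop :=
  forall j, cmeasurable (fun x => F x 0 j).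

Lemma vmeasurable_coords : vmeasurable (@C2_of_R4 R).
Proof.
move=> j; rewrite (_ : (fun _ => _) = fun x : R4 => if j == 0 then (x.1.1.1 +i* x.1.1.2)%C else (x.1.2 +i* x.2)%C).
  have m1 : measurable_fun setT (fst : R4 -> _) := measurable_fst.
  case: (j == 0); split => /=.
  - by do ![apply: measurableT_comp]; exact: measurable_fst.
  - apply: measurableT_comp measurable_snd _; apply: measurableT_comp measurable_fst _; exact: measurable_fst.
  - apply: measurableT_comp measurable_snd _; exact: measurable_fst.
  - exact: measurable_snd.
by apply/funext => x; rewrite mxE.
Qed.

Lemma measurable_le (f g : R4 -> R) :
  measurable_fun setT (f : R4 -> RB) -> measurable_fun setT (g : R4 -> RB) ->
  measurable [set x | f x <= g x].
Proof. by move=> mf mg; rewrite -[X in measurable X]setTI; exact: measurable_fun_le. Qed.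

Lemma vmeasurable_frac (a : mat C) F : vmeasurable F -> vmeasurable (fun x => frac a (F x)).
Proof.
move=> mF j.
have md (r : vec C) : cmeasurable (fun x => dotp r (homog (F x))).
  rewrite /dotp /homog /=; apply: cmeasurableD; last exact: cmeasurable_cst.
  by apply: cmeasurableD; apply: cmeasurableM; (exact: cmeasurable_cst || exact: mF).
rewrite (_ : (fun _ => _) = (fun x => dotp (if j == 0 then a.1.1 else a.1.2) (homog (F x)) * (dotp a.2 (homog (F x)))^-1)).
  by apply: cmeasurableM => //; exact: cmeasurableV.
by apply/funext => x; rewrite mxE /den /mv /=; case: (j == 0).
Qed.

Lemma measurable_defect F : vmeasurable F -> measurable_fun setT (fun x => defect (F x) : RB).
Proof.
move=> mF; apply: measurable_funB; last exact: measurable_normsq.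
by apply: measurable_funB; [exact: measurable_cst|exact: measurable_normsq].
Qed.

Lemma measurable_ball F : vmeasurable F -> measurable [set x | B2 R (F x)].
Proof.
move=> mF; rewrite (_ : [set x | _] = ~` [set x | defect (F x) <= 0]).
  by apply: measurableC; apply: measurable_le; [exact: measurable_defect|exact: measurable_cst].
apply/seteqP; split=> x /=; rewrite leNgt; first by move/B2_defect => ->.
by move/negP; rewrite negbK => h; apply/B2_defect.
Qed.

Lemma measurable_cone F q k : vmeasurable F -> measurable [set x | cone q k (F x)].
Proof.
move=> mF; apply: measurable_le; last by apply: measurable_funX; exact: measurable_defect.
apply: measurable_funM; first exact: measurable_cst.
by apply: measurable_funD; apply: measurable_normsq; apply: cmeasurableD; (exact: mF || exact: cmeasurable_cst).
Qed.

Definition cones (L : seq ('rV[C]_2 * R)) (z : 'rV[C]_2) : Prop :=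
  exists2 p, p \in L & cone p.1 p.2 z.

Lemma measurable_cones F L : vmeasurable F -> measurable [set x | cones L (F x)].
Proof.
move=> mF; elim: L => [|p L IH].
  by rewrite (_ : [set x | _] = set0) //; apply/seteqP; split=> // x [].
rewrite (_ : [set x | _] = [set x | cone p.1 p.2 (F x)] `|` [set x | cones L (F x)]).
  by apply: measurableU => //; exact: measurable_cone.
apply/seteqP; split=> x /=.
  by move=> [p']; rewrite inE => /predU1P[->|h hc]; [left|right; exists p'].
by move=> [h|[p' h hc]]; [exists p; rewrite ?inE ?eqxx|exists p'; rewrite ?inE ?h ?orbT].
Qed.

(* Comparing |z|^2 first makes minima over orbits exist, since orbits are discrete;
   the coordinates break the ties. *)
Definition lex_key (z : 'rV[C]_2) : seqlexi R :=
  [:: 1 - defect z; complex.Re (z 0 0); complex.Im (z 0 0); complex.Re (z 0 1); complex.Im (z 0 1)].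

Lemma lex_key_inj z w : lex_key z = lex_key w -> z = w.
Proof.
by move=> [_ h1 h2 h3 h4]; apply: row2P; apply: complex_eq.
Qed.

Lemma measurable_lexi (fs gs : seq (R4 -> R)) :
  (forall f, List.In f fs -> measurable_fun setT (f : R4 -> RB)) ->
  (forall f, List.In f gs -> measurable_fun setT (f : R4 -> RB)) ->
  measurable [set x | ([seq f x | f <- fs] : seqlexi R) <= [seq g x | g <- gs]]%O.
Proof.
elim: fs gs => [|f fs IH] [|g gs] hf hg /=.
- by rewrite (_ : [set x | _] = setT) //; apply/seteqP; split.
- by rewrite (_ : [set x | _] = setT) //; apply/seteqP; split.
- by rewrite (_ : [set x | _] = set0) //; apply/seteqP; split.
rewrite (_ : [set x | _] = [set x | f x <= g x] `&` (~` [set x | g x <= f x] `|`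
  [set x | ([seq f x | f <- fs] : seqlexi R) <= [seq g x | g <- gs]]%O)).
  have mf := hf f (or_introl erefl); have mg := hg g (or_introl erefl).
  apply: measurableI; first exact: measurable_le.
  apply: measurableU; first by apply: measurableC; exact: measurable_le.
  by apply: IH => h hh; [apply: hf|apply: hg]; right.
apply/seteqP; split=> x /=; rewrite Order.SeqLexiOrder.lexi_cons.
  by move=> /andP[-> /implyP h]; split=> //; have [/h|] := boolP (g x <= f x); [right|move/negP; left].
by move=> [-> [/negP/negPf ->|h]] //=; apply/implyP.
Qed.

Lemma measurable_lex_key F G : vmeasurable F -> vmeasurable G ->
  measurable [set x | (lex_key (F x) <= lex_key (G x))%O].
Proof.
move=> mF mG.
pose l (H : R4 -> 'rV[C]_2) : seq (R4 -> R) := [:: (fun x => 1 - defect (H x)); (fun x => complex.Re (H x 0 0));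
  (fun x => complex.Im (H x 0 0)); (fun x => complex.Re (H x 0 1)); (fun x => complex.Im (H x 0 1))].
have ml H : vmeasurable H -> forall f, List.In f (l H) -> measurable_fun setT (f : R4 -> RB).
  move=> mH f; have [m1 m2] := mH 0; have [m3 m4] := mH 1.
  case=> [<-|[<-|[<-|[<-|[<-|[]]]]]] //.
  by apply: measurable_funB; [exact: measurable_cst|exact: measurable_defect].
exact: measurable_lexi (ml F mF) (ml G mG).
Qed.

End Measurable.

(** Countability turns the condition over the whole group in [lex_domain] into a countable
    intersection of measurable sets. *)
Lemma U_enum : exists u : nat -> U, forall g, exists n, u n = g.
Proof.
pose f (v : int * int * (int * int) * (int * int)) : vec O :=
  (pair_eis v.1.1, pair_eis v.1.2, pair_eis v.2).
pose h (v : vec O) := (eis_pair v.1.1, eis_pair v.1.2, eis_pair v.2).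
have hK v : f (h v) = v by case: v => [[[a b] [c d]] [e k]].
pose T := (int * int * (int * int) * (int * int))%type.
pose mf (m : T * T * T) : mat O := (f m.1.1, f m.1.2, f m.2).
exists (fun n => if unpickle n is Some m then insubd U1 (mf m) else U1) => g.
pose m : T * T * T := (h (val g).1.1, h (val g).1.2, h (val g).2).
exists (pickle m); rewrite pickleK.
have -> : mf m = val g by rewrite /mf /= !hK; case: (val g) => [[]].
exact: valKd.
Qed.

Lemma exists_argmin d (T : orderType d) (A : eqType) (f : A -> T) (x : A) (s : seq A) :
  x \in s -> exists2 y, y \in s & forall w, w \in s -> (f y <= f w)%O.
Proof.
elim: s x => // a s IH x _.
case: s IH => [|b s] IH.
  by exists a; rewrite ?inE // => w; rewrite inE => /eqP ->.
have [y ys hy] := IH b (mem_head _ _).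
have [h|h] := leP (f a) (f y).
  by exists a; rewrite ?mem_head // => w; rewrite inE => /predU1P[-> //|/hy]; exact: le_trans.
by exists y; [rewrite inE ys orbT|move=> w; rewrite inE => /predU1P[-> //|/hy //]; exact: ltW].
Qed.

Section Domain.
Variable R : realType.
Notation C := R[i].
Notation mob := (@mob R).
Notation ball_mx := (@ball_mx R).
Notation ball_mx_pres := (@ball_mx_pres R).
Variable L : seq ('rV[C]_2 * R).
Hypothesis LP : forall z, B2 R z -> exists2 g, Gamma3 g &
  exists2 p, p \in L & cone p.1 p.2 (frac (ball_mx g) z).

Definition lex_domain : set (B2 R) := [set z | cones L (\val z) /\
  forall g, Gamma3 g -> cones L (frac (ball_mx g) (\val z)) ->
    (lex_key (\val z) <= lex_key (frac (ball_mx g) (\val z)))%O].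

(** By [finite_den] finitely many translates have defect at least that of a first translate in the
    cones, and the key is minimized among those in the cones. Every other translate has smaller
    defect, hence a larger first entry of the key. *)
Lemma domain_meets_orbit (z : B2 R) : exists2 g, Gamma3 g & lex_domain (mob g z).
Proof.
have zB := in_ball z; have [g0 g03 S0] := LP zB.
have [l hl] := finite_den (normsq (den (ball_mx g0) (\val z))) zB.
pose P g := `[< [/\ Gamma3 g, cones L (frac (ball_mx g) (\val z))
  & normsq (den (ball_mx g) (\val z)) <= normsq (den (ball_mx g0) (\val z))] >].
have P0 : g0 \in [seq g <- l | P g].
  by rewrite mem_filter hl ?lexx // andbT; apply/asboolP.
have [g1 + hmin] := exists_argmin (fun g => lex_key (frac (ball_mx g) (\val z))) P0.
rewrite mem_filter => /andP[/asboolP[g13 S1 d1] _].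
have d0 := den_neq0 (ball_mx_pres g1) zB.
exists g1 => //; split; first exact: S1.
move=> g g3; rewrite mob_val -frac_mm // -ball_mxM => Sg.
have g33 := Gamma3M g3 g13.
have [h|h] := leP (normsq (den (ball_mx (g * g1)%g) (\val z))) (normsq (den (ball_mx g0) (\val z))).
  by apply: hmin; rewrite mem_filter hl // andbT; apply/asboolP.
rewrite /lex_key Order.SeqLexiOrder.lexi_cons.
have lt : defect (frac (ball_mx (g * g1)%g) (\val z)) < defect (frac (ball_mx g1) (\val z)).
  rewrite !defect_frac ?(den_neq0 (ball_mx_pres _)) //; try exact: ball_mx_pres.
  have s0 : 0 < defect (\val z) by apply/B2_defect.
  have dg := normsq_gt0 d0.
  have lt1 := le_lt_trans d1 h; have dgg := lt_trans dg lt1.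
  by rewrite ltr_pM2l // ltf_pV2 ?posrE.
apply/andP; split; first by rewrite lerD2l lerN2 ltW.
by apply/implyP; rewrite lerD2l lerN2 leNgt lt.
Qed.

(** Two minimizers in one orbit have equal keys and coincide; then [Gamma3_free] applies. *)
Lemma domain_disjoint g : Gamma3 g -> mob g <> 1%g -> (mob g @` lex_domain) `&` lex_domain = set0.
Proof.
move=> g3 g1; apply/seteqP; split=> // _ [[z [Sz hz] <-] [Sw hw]].
have zB := in_ball z; apply: g1.
have d0 := den_neq0 (ball_mx_pres g) zB.
have h1 := hz g g3 Sw.
have gz : frac (ball_mx g^-1%g) (frac (ball_mx g) (\val z)) = \val z.
  by rewrite -frac_mm // -ball_mxM mulVg ball_mx1 frac1.
have h2 := hw g^-1%g (Gamma3V g3).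
rewrite mob_val gz in h2.
have /lex_key_inj e : lex_key (\val z) = lex_key (frac (ball_mx g) (\val z)).
  by apply/eqP; rewrite eq_le h1 h2.
by rewrite (Gamma3_free g3 zB (esym e)) mob1.
Qed.

Lemma coords_domain : coords lex_domain = [set x | B2 R (C2_of_R4 x)] `&`
  ([set x | cones L (C2_of_R4 x)] `&`
   [set x | forall g, Gamma3 g -> cones L (frac (ball_mx g) (C2_of_R4 x)) ->
     (lex_key (C2_of_R4 x) <= lex_key (frac (ball_mx g) (C2_of_R4 x)))%O]).
Proof.
apply/seteqP; split=> x /=.
  by move=> [z [Sz hz] e]; rewrite -e; split; [exact: in_ball|].
by move=> [xB [Sx hx]]; exists (SigSub (mem_set xB)).
Qed.

Lemma measurable_domain : measurable (coords lex_domain).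
Proof.
have mc := @vmeasurable_coords R.
rewrite coords_domain; apply: measurableI; first exact: measurable_ball.
apply: measurableI; first exact: measurable_cones.
have [u hu] := U_enum.
rewrite (_ : [set x | _] = \bigcap_n [set x | Gamma3 (u n) -> cones L (frac (ball_mx (u n)) (C2_of_R4 x)) ->
     (lex_key (C2_of_R4 x) <= lex_key (frac (ball_mx (u n)) (C2_of_R4 x)))%O]).
  apply: bigcapT_measurable => n.
  have [g3|g3] := pselect (Gamma3 (u n)); last first.
    by rewrite (_ : [set x | _] = setT) //; apply/seteqP; split=> // x _ /g3.
  have mf := vmeasurable_frac (ball_mx (u n)) mc.
  rewrite (_ : [set x | _] = ~` [set x | cones L (frac (ball_mx (u n)) (C2_of_R4 x))] `|`
    [set x | (lex_key (C2_of_R4 x) <= lex_key (frac (ball_mx (u n)) (C2_of_R4 x)))%O]).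
    by apply: measurableU; [apply: measurableC; exact: measurable_cones|exact: measurable_lex_key].
  apply/seteqP; split=> x /= h; last by move=> _ hc; case: h.
  by have [hc|hc] := pselect (cones L (frac (ball_mx (u n)) (C2_of_R4 x))); [right; exact: h|left].
apply/seteqP; split=> x /= h; first by move=> n _; exact: h.
by move=> g; have [n <-] := hu g; exact: h.
Qed.

Lemma bergman_volume0 : bergman_volume (set0 : set (B2 R)) = 0%E.
Proof.
rewrite /bergman_volume (_ : coords set0 = set0) ?integral_set0 //.
by apply/seteqP; split=> // x [].
Qed.

Lemma domain_fundamental : fundamental_domain (Gamma (R := R)) lex_domain.
Proof.
split; first exact: measurable_domain.
- by move=> z; have [g g3 h] := domain_meets_orbit z; exists (mob g) => //; exists g.
- by move=> _ [g g3 <-] g1; rewrite domain_disjoint // bergman_volume0.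
Qed.
End Domain.

(** * The volume *)

Section Volume.
Variable R : realType.
Notation C := R[i].
Notation RB := (measurableTypeR R).
Notation R4 := (RB * RB * RB * RB)%type.

Lemma det_bergman (z : 'rV[C]_2) : B2 R z ->
  complex.Re (\det (bergman_mx z)) = 9 / defect z ^+ 3.
Proof.
move=> /B2_defect s0.
have sC : (defect z)%:C%C != 0 by rewrite fmorph_eq0 gt_eqF.
suff -> : \det (bergman_mx z) = (9 / defect z ^+ 3)%:C%C by [].
rewrite (rmorphM (real_complex R)) (fmorphV (real_complex R)) (rmorphXn (real_complex R)) (rmorph_nat (real_complex R)).
have e : sqnorm z = (z 0 0)^* * z 0 0 + (z 0 1)^* * z 0 1.
  by rewrite sqnorm2 !normCK [z 0 0 * _]mulrC [z 0 1 * _]mulrC.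
rewrite (expand_det_row _ 0) big_ord_recl big_ord1 /cofactor !det_mx11 !mxE /=.
rewrite (_ : lift 0 0 = 1); last exact: val_inj.
rewrite (_ : lift 1 0 = 0 :> 'I_2); last exact: val_inj.
rewrite defect_sqnorm; have := defect_sqnorm z; rewrite e.
move: (defect z)%:C%C sC (z 0 0) (z 0 0)^* (z 0 1) (z 0 1)^* => s sC' x x' y y' es.
transitivity (9 * (s ^+ 2 + s * (1 - (1 - (x' * x + y' * y)))) / s ^+ 4).
  by field.
by rewrite es; field.
Qed.

Lemma dyadic_scale (s : R) : 0 < s <= 1 -> exists n, (2 ^ n.+1)%:R^-1 < s <= (2 ^ n)%:R^-1.
Proof.
move=> /andP[s0 s1].
have ex : exists n, (2 ^ n.+1)%:R^-1 < s.
  exists (Num.truncn s^-1); rewrite invf_plt ?posrE ?ltr0n ?expn_gt0 //.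
  apply: lt_trans (truncnS_gt _) _; rewrite ltr_nat; exact: ltn_expl.
exists (ex_minn ex); case: ex_minnP => n -> /= hmin.
case: n hmin => [|n] hmin; first by rewrite expn0 invr1.
by rewrite leNgt; apply/negP => /hmin; rewrite ltnn.
Qed.

(** In a cone of aperture k, a point of defect at most 2^-n is within 2^-n / sqrt k of the vertex,
    and 1 + 1/k bounds 1 / sqrt k. *)
Definition radius (k : R) (n : nat) : R := (1 + k^-1) / (2 ^ n)%:R.

Definition box (p : 'rV[C]_2 * R) (n : nat) : set R4 :=
  let r := radius p.2 n in let I (c : R) := [set` `[c - r, c + r]] in
  I (complex.Re (p.1 0 0)) `*` I (complex.Im (p.1 0 0))
  `*` I (complex.Re (p.1 0 1)) `*` I (complex.Im (p.1 0 1)).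

Lemma measurable_box p n : measurable (box p n).
Proof. by do 3![apply: measurableX => //]. Qed.

Lemma box_volume p n : 0 < p.2 -> lebesgue4 R (box p n) = ((2 * radius p.2 n) ^+ 4)%:E.
Proof.
move=> k0; rewrite /lebesgue4 /box; set r := radius _ _.
have r0 : 0 < r by rewrite divr_gt0 ?ltr0n ?expn_gt0 // addr_gt0 ?invr_gt0.
have I (c : R) : lebesgue_measure ([set` `[c - r, c + r]] : set RB) = (2 * r)%:E.
  rewrite lebesgue_measure_itv /= lte_fin ifT; last by rewrite ltrD2l gtrN.
  by rewrite -EFinB; congr EFin; ring.
have mI (c : R) : measurable ([set` `[c - r, c + r]] : set RB) by exact: measurable_itv.
apply: etrans (product_measure1E _ _ (measurableX (measurableX (mI _) (mI _)) (mI _)) (mI _)) _.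
apply: etrans (congr2 mule (product_measure1E _ _ (measurableX (mI _) (mI _)) (mI _)) (I _)) _.
apply: etrans (congr2 mule (congr2 mule (product_measure1E _ _ (mI _) (mI _)) (I _)) erefl) _.
apply: etrans (congr2 mule (congr2 mule (congr2 mule (I _) (I _)) erefl) erefl) _.
by rewrite -!EFinM; congr EFin; ring.
Qed.

Fixpoint boxes (L : seq ('rV[C]_2 * R)) (n : nat) : set R4 :=
  if L is p :: L' then box p n `|` boxes L' n else set0.

Lemma measurable_boxes L n : measurable (boxes L n).
Proof. by elim: L => //= p L IH; apply: measurableU => //; exact: measurable_box. Qed.

Lemma boxes_volume L : (forall p, p \in L -> 0 < p.2) -> exists2 c : R, 0 <= c &
  forall n, (lebesgue4 R (boxes L n) <= (c / (2 ^ n)%:R ^+ 4)%:E)%E.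
Proof.
elim: L => [|p L IH] hL.
  by exists 0 => // n; rewrite measure0 mul0r.
have [|c c0 hc] := IH; first by move=> q qL; apply: hL; rewrite inE qL orbT.
have p0 : 0 < p.2 by apply: hL; rewrite mem_head.
exists ((2 * (1 + p.2^-1)) ^+ 4 + c) => [|n].
  by rewrite addr_ge0 // exprn_ge0 // mulr_ge0 // addr_ge0 // invr_ge0 ltW.
apply: le_trans (measureU2 _ (measurable_box p n) (measurable_boxes L n)) _.
rewrite mulrDl EFinD; apply: leeD (hc n).
apply: (@le_trans _ _ ((2 * radius p.2 n) ^+ 4)%:E).
  by rewrite -(box_volume n p0); exact: lexx.
by rewrite lee_fin /radius mulrA expr_div_n.
Qed.

Lemma cone_box p n (x : R4) : 0 < p.2 -> 0 <= defect (C2_of_R4 x) <= (2 ^ n)%:R^-1 ->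
  cone p.1 p.2 (C2_of_R4 x) -> box p n x.
Proof.
case: p => q k /= k0; set z := C2_of_R4 x; move=> /andP[s0 s1] h.
have n0 : 0 < (2 ^ n)%:R^-1 :> R by rewrite invr_gt0 ltr0n expn_gt0.
have r0 : 0 < radius k n by rewrite mulr_gt0 // addr_gt0 // invr_gt0.
have hd : distsq z q <= radius k n ^+ 2.
  rewrite -(ler_pM2l k0); apply: le_trans h _; apply: le_trans (_ : (2 ^ n)%:R^-1 ^+ 2 <= _).
    by rewrite lerXn2r ?nnegrE // ltW.
  rewrite /radius exprMn mulrA ler_peMl ?sqr_ge0 //.
  have k1 : k * k^-1 = 1 by rewrite divff // gt_eqF.
  have : 0 < k^-1 by rewrite invr_gt0.
  nra.
have bnd (t c : R) : (t - c) ^+ 2 <= distsq z q -> t \in `[c - radius k n, c + radius k n].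
  move=> htc; rewrite in_itv /=; apply/andP.
  have : `|t - c| <= radius k n.
    by rewrite -(ler_sqr (normr_ge0 _) (ltW r0)) real_normK ?num_real // (le_trans htc).
  by rewrite ler_norml => /andP[]; split; lra.
have q1 := sqr_ge0 (x.1.1.1 - complex.Re (q 0 0)).
have q2 := sqr_ge0 (x.1.1.2 - complex.Im (q 0 0)).
have q3 := sqr_ge0 (x.1.2 - complex.Re (q 0 1)).
have q4 := sqr_ge0 (x.2 - complex.Im (q 0 1)).
have dE : distsq z q = (x.1.1.1 - complex.Re (q 0 0)) ^+ 2 + (x.1.1.2 - complex.Im (q 0 0)) ^+ 2
  + ((x.1.2 - complex.Re (q 0 1)) ^+ 2 + (x.2 - complex.Im (q 0 1)) ^+ 2).
  by rewrite /distsq /normsq /z !mxE /=; case: (q 0 0) => ? ?; case: (q 0 1).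
rewrite dE in bnd.
by do ![split]; apply: bnd; lra.
Qed.

Lemma cones_boxes L n (x : R4) : (forall p, p \in L -> 0 < p.2) ->
  0 <= defect (C2_of_R4 x) <= (2 ^ n)%:R^-1 -> cones L (C2_of_R4 x) -> boxes L n x.
Proof.
move=> hL hs [p pL hp]; elim: L hL pL => // q L IH hL; rewrite inE => /predU1P[e|pL].
  by left; rewrite -e; apply: cone_box => //; apply: hL; rewrite e mem_head.
by right; apply: IH => // p' h; apply: hL; rewrite inE h orbT.
Qed.

(* Where the defect is about 2^-n the Bergman density is O(8^n), and the part of a
   cone where this happens lies in a box of volume O(16^-n). *)
Lemma finite_volume L (D : set (B2 R)) : (forall p, p \in L -> 0 < p.2) ->
  measurable (coords D) -> (forall z, D z -> cones L (\val z)) ->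
  (bergman_volume D < +oo)%E.
Proof.
move=> hL mD DL.
have [c c0 hc] := boxes_volume hL.
(* The density is 9 / defect^3 and the defect exceeds 2^-(n+1) on the n-th layer, hence 72 = 9 times
   2^3. *)
pose w n : R := 72 * (2 ^ n)%:R ^+ 3.
have w0 n : 0 <= w n by rewrite mulr_ge0 // exprn_ge0.
pose G n (x : R4) : \bar R := ((w n)%:E * (\1_(boxes L n) x)%:E)%E.
have G0 n x : (0 <= G n x)%E by rewrite mule_ge0 ?lee_fin.
have mG n : measurable_fun (coords D) (G n).
  apply: measurable_funeM; apply/measurable_EFinP; exact: measurable_indic (measurable_boxes L n).
have CB (x : R4) : coords D x -> B2 R (C2_of_R4 x) /\ cones L (C2_of_R4 x).
  by move=> [z Dz e]; rewrite -e; split; [exact: in_ball|exact: DL].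
(* Equal to the density on [coords D] and measurable on the whole of [R4]. *)
pose f (x : R4) : R := 9 * (defect (C2_of_R4 x) * (defect (C2_of_R4 x) ^+ 4) `^ (-1)).
have fE x : coords D x -> complex.Re (\det (bergman_mx (C2_of_R4 x))) = f x.
  move=> /CB[xB _]; rewrite det_bergman // /f; have /B2_defect s0 := xB.
  rewrite powR_inv1 ?exprn_ge0 ?ltW //; field; by rewrite gt_eqF.
have mf : measurable_fun setT (f : R4 -> RB).
  have ms := measurable_defect (@vmeasurable_coords R).
  apply: measurable_funM; first exact: measurable_cst.
  apply: measurable_funM => //.
  apply: (measurableT_comp (measurable_powR (-1))); exact: measurable_funX.
rewrite /bergman_volume.
under eq_integral => x /set_mem xD do rewrite fE //.
have fG x : coords D x -> ((f x)%:E <= \sum_(n <oo) G n x)%E.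
  move=> xD; rewrite -fE //; have [xB xL] := CB x xD; have /B2_defect s0 := xB.
  have s1 : defect (C2_of_R4 x) <= 1.
    by rewrite /defect; have := (normsq_ge0 (C2_of_R4 x 0 0), normsq_ge0 (C2_of_R4 x 0 1)) => -[]; lra.
  have [|n /andP[h1 h2]] := @dyadic_scale (defect (C2_of_R4 x)); first by rewrite s0.
  apply: le_trans (nneseries_lim_ge n.+1 (fun m _ _ => G0 m x)).
  rewrite big_nat_recr //=; apply: le_trans (leeDr _ _); last by apply: sume_ge0.
  rewrite /G indicE mem_set; last by apply: cones_boxes => //; rewrite (ltW s0).
  rewrite mule1 lee_fin det_bergman // /w.
  have p0 : 0 < (2 ^ n)%:R :> R by rewrite ltr0n expn_gt0.
  move: h1; rewrite expnS natrM invf_plt ?posrE ?mulr_gt0 // => h1.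
  rewrite -exprVn; have : (defect (C2_of_R4 x))^-1 ^+ 3 <= (2 * (2 ^ n)%:R) ^+ 3.
    by rewrite lerXn2r ?nnegrE ?invr_ge0 ?ltW // mulr_gt0.
  by rewrite exprMn; lra.
have f0 x : coords D x -> (0 <= (f x)%:E)%E.
  move=> xD; rewrite lee_fin -fE //; have [xB _] := CB x xD; rewrite det_bergman //.
  by rewrite divr_ge0 // exprn_ge0 // ltW //; apply/B2_defect.
have mf' : measurable_fun (coords D) (fun x => (f x)%:E).
  by apply/measurable_EFinP; exact: measurable_funTS.
have mS : measurable_fun (coords D) (fun x => (\sum_(n <oo) G n x)%E).
  by apply: (@ge0_emeasurable_sum _ _ _ (coords D) G xpredT) => // n x _ _; exact: G0.
apply: (@le_lt_trans _ _ _ _ _ (@ge0_le_integral _ _ R (lebesgue4 R) (coords D) mD _ _ f0 mf' mS fG)).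
rewrite integral_nneseries //.
(* The n-th integral is at most 72 c / 2^n = 144 c / 2^(n+1), and these bounds sum to 144 c. *)
apply: (@le_lt_trans _ _ (144 * c)%:E); last exact: ltry.
apply: le_trans (epsilon_trick0 xpredT (mulr_ge0 (ler0n R 144) c0)).
apply: lee_nneseries => [n _ _|n _]; first by apply: integral_ge0 => x _; exact: G0.
have p0 : 0 < (2 ^ n)%:R :> R by rewrite ltr0n expn_gt0.
rewrite ge0_integralZl_EFin //; last 1 first.
- by apply/measurable_EFinP; exact: measurable_indic (measurable_boxes L n).
rewrite integral_indic //; last exact: measurable_boxes.
apply: (@le_trans _ _ ((w n)%:E * (c / (2 ^ n)%:R ^+ 4)%:E)%E).
  apply: lee_wpmul2l; first by rewrite lee_fin.
  apply: le_trans (hc n); apply: le_measure; rewrite ?inE //; first exact: measurableI (measurable_boxes L n) mD.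
  exact: measurable_boxes.
rewrite -EFinM lee_fin /w expnS natrM le_eqVlt; apply/orP; left; apply/eqP.
by field; rewrite gt_eqF.
Qed.
End Volume.

Local Close Scope ring_scope.

Theorem theorem2 (R : realType) :
  exists (Gamma : set (PU21 R)) (rho : PU21 R -> int),
    [/\ is_lattice Gamma, torsion_free Gamma, homomorphism_to_int Gamma rho,
        rho @` Gamma = [set: int] & finitely_generated (hom_kernel Gamma rho)].
Proof.
have [rho [rhoM rho_surj rho_ker]] := Gamma_fibration R.
have [L [L0 LP]] := reduction R.
exists (@Gamma R), rho; split=> //; last exact: Gamma_torsion_free.
split; [exact: Gamma_subgroup|exact: Gamma_discrete|].
exists (lex_domain L); first exact: domain_fundamental.
by apply: finite_volume L0 (measurable_domain L) _ => z [].
Qed.
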